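(* There exists a polynomial $P$ such that for every mean-payoff game $G$, every requirement $\lambda:V\to\mathbb{Q}\cup\{\pm\infty\}$, each player $i$, each $v_0\in V_i$ and every integer $\beta\ge P(\lVert G\rVert+\lVert\lambda\rVert)$, we have $\mathsf{nego}(\lambda)(v_0)=\mathsf{val}_\mathbb{C}\big(\mathsf{Red}^\beta_{\lambda i}(G)_{\|v_0}\big)$, where $\mathsf{val}_\mathbb{C}$ is the value $\inf_{\tau_\mathbb{P}}\sup_{\tau_\mathbb{C}}\nu_\mathbb{C}(\langle\tau_\mathbb{P},\tau_\mathbb{C}\rangle)=\sup_{\tau_\mathbb{C}}\inf_{\tau_\mathbb{P}}\nu_\mathbb{C}(\langle\tau_\mathbb{P},\tau_\mathbb{C}\rangle)$ of the game for Challenger from $v_0$.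
   Context: Mean-payoff game $G$: finite player set $\Pi$, finite directed graph $(V,E)$ with every vertex having an outgoing edge, partition $(V_i)_i$, rewards $r_i:E\to\mathbb{Q}$, payoff $\mu_i(\rho)=\liminf_n\frac1n\sum_{k<n}r_i(\rho_k\rho_{k+1})$. $\mathsf{Occ}(\rho)$ is the set of vertices occurring in $\rho$; $|h|$ is the number of vertices of a history $h$. A requirement is $\lambda:V\to\mathbb{R}\cup\{\pm\infty\}$; a play $\rho$ is $\lambda$-consistent if $\mu_j(\rho_{\ge n})\ge\lambda(\rho_n)$ for all $n$, $j$ with $\rho_n\in V_j$. A profile $\bar\sigma_{-i}$ from $v$ is $\lambda$-rational if some strategy $\sigma_i$ makes $\langle\bar\sigma_{\|hw}\rangle$ $\lambda$-consistent for every history $hw$ from $v$ compatible with $\bar\sigma_{-i}$ (where $\sigma_{j\|hw}(h')=\sigma_j(hh')$); $\mathsf{nego}(\lambda)(v)=\inf_{\bar\sigma_{-i}\ \lambda\text{-rational}}\sup_{\sigma_i}\mu_i(\langle\bar\sigma\rangle)$ for $v\in V_i$, with $\inf\emptyset=+\infty$. Size of rationals: $\lVert p/q\rVert=1+\lceil\log_2(|p|+1)\rceil+\lceil\log_2(|q|+1)\rceil$ (coprime), $\lVert\pm\infty\rVert=1$; size of tuples/functions = number of entries + sum of entry sizes. Punishment family: for a simple history $h$, a nonempty simple cycle $c$, $W\subseteq V$, $\bar x\in\mathbb{R}^\Pi$, the set $hc^\infty\rho=\{hc^n\rho' : n>0,\ hc^n\rho'\text{ is a play},\ \mu(\rho')=\bar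 x,\ \mathsf{Occ}(\rho')=W\}$ (nonempty), for any play $\rho$ with $\mu(\rho)=\bar x$, $\mathsf{Occ}(\rho)=W$; $c$ is its punishing cycle; it is a $\beta$-punishment family if $\lVert\bar x\rVert\le\beta$; it is $\lambda$-consistent if its elements are; all its elements have payoff vector $\bar x$. Reduced negotiation game $\mathsf{Red}^\beta_{\lambda i}(G)$: two players, Prover and Challenger. Prover's states are the vertices of $V$. Challenger's states are: $[hc^\infty\rho]$ for each $\lambda$-consistent $\beta$-punishment family; $(c,u)$ where $c$ is the punishing cycle of such a family $hc^\infty\rho$ and some vertex of $\rho$ in $V_i$ has an edge to $u$; $[h'w]$ where $h'$ is a prefix of $hc$ for such a family, $\mathsf{last}(h')\in V_i$ and $\mathsf{last}(h')w\in E$; and two states $\top,\bot$. Transitions: $v\to[hc^\infty\rho]$ (Prover proposes a family whose plays start at $v$), $v\to\bot$ (Prover gives up), $[hc^\infty\rho]\to\top$ (Challenger accepts), $[hc^\infty\rho]\to[h'w]$ (pre-cycle deviation, $h'$ prefix of $hc$), $[hc^\infty\rho]\to(c,u)$ (post-cycle deviation), $[h'w]\to w$, $(c,u)\to u$, $\top\to\top$, $\bot\to\bot$. For a history or play $H=H_0H_1\dots$ not reaching $\bot$, define $\dot H=h^{(1)}h^{(2)}\dots$ in $G$ by: if $H_{k-1}H_k=v[hc^\infty\rho]$, or $[h'w]w$, or $(c,w)w$, then $h^{(k)}$ is empty; if $H_{k-1}H_k=[hc^\infty\rho]\top$, then $h^{(k)}h^{(k+1)}\dots=hc^{N^2}\rho$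 with $N=|h^{(1)}\dots h^{(k-1)}h|$; if $H_{k-1}H_k=[hc^\infty\rho][h'w]$, then $h^{(k)}=h'$; if $H_{k-1}H_k=[hc^\infty\rho](c,w)$, then $h^{(k)}=hc^{N^2}h'$ with $N$ as before and $h'$ a shortest history with $\mathsf{Occ}(h')\subseteq\mathsf{Occ}(\rho)$, $\mathsf{last}(h')\in V_i$, $\mathsf{last}(h')w\in E$. Payoffs: $\nu_\mathbb{C}(\pi)=-\nu_\mathbb{P}(\pi)=+\infty$ if $\pi$ reaches $\bot$, and $\mu_i(\dot\pi)$ otherwise. *)

(* Defs.v *)
From HB Require Import structures.
From mathcomp Require Import all_boot all_order all_algebra.
From mathcomp Require Import all_classical all_reals all_analysis.
Set Implicit Arguments. Unset Strict Implicit. Unset Printing Implicit Defensive.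
Import Order.TTheory GRing.Theory Num.Theory.
Local Open Scope ring_scope.
Local Open Scope classical_set_scope.

(* ||p/q|| = 1 + ceil(log2(|p|+1)) + ceil(log2(|q|+1))  (p/q reduced;   *)
(* mathcomp's numq/denq are coprime). ceil(log2 m) = up_log 2 m, m>=1.  *)
Definition rat_size (r : rat) : nat :=
  1 + up_log 2 ((absz (numq r)).+1) + up_log 2 ((absz (denq r)).+1).

Definition erat_size (r : \bar rat) : nat :=
  match r with EFin q => rat_size q | _ => 1 end.

Definition tuple_size (I : finType) (x : I -> rat) : nat :=
  #|I| + \sum_(j : I) rat_size (x j).

Definition req_size (V : finType) (lam : V -> \bar rat) : nat :=
  #|V| + \sum_(v : V) erat_size (lam v).

Record game (Pl V : finType) := Game {
  owner : V -> Pl;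
  edge : rel V;
  edge_total : forall v, exists w, edge v w;
  reward : Pl -> V -> V -> rat }.

Definition game_size (Pl V : finType) (G : game Pl V) : nat :=
  #|V| + #|Pl| + #|[set e : V * V | edge G e.1 e.2]|
  + \sum_(e : V * V | edge G e.1 e.2) tuple_size (fun j => reward G j e.1 e.2).

Section MeanPayoff.
Context (R : realType) (Pl V : finType) (G : game Pl V).
Local Notation owner := (owner G).
Local Notation edge := (edge G).

Definition is_play (rho : nat -> V) : Prop := forall k, edge (rho k) (rho k.+1).

Definition mp (j : Pl) (rho : nat -> V) : \bar R :=
  limn_einf (fun n : nat =>
    ((\sum_(k < n) (ratr (reward G j (rho k) (rho k.+1)) : R)) / n%:R)%:E).

Definition suffix_from (rho : nat -> V) (n : nat) : nat -> V := fun k => rho (n + k)%N.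

Definition occ_eq (rho : nat -> V) (W : {set V}) : Prop :=
  forall v, v \in W <-> exists k, rho k = v.

Definition prepend (s : seq V) (rho : nat -> V) : nat -> V :=
  fun k => if (k < size s)%N then nth (rho 0%N) s k else rho (k - size s)%N.

Definition er2R (x : \bar rat) : \bar R :=
  match x with EFin q => (ratr q : R)%:E | EPInf => +oo%E | ENInf => -oo%E end.

Definition lam_consistent (lam : V -> \bar rat) (rho : nat -> V) : Prop :=
  forall n, (er2R (lam (rho n)) <= mp (owner (rho n)) (suffix_from rho n))%E.

Definition strat := seq V -> V.
Definition valid_strat (j : Pl) (s : strat) : Prop :=
  forall h x, owner x = j -> edge x (s (rcons h x)).

(* outcome from w of the profile sigma after the prefix pre, i.e. the
   outcome of sigma_{|| pre w} (with sigma_{j||hw}(h') = sigma_j(h h')). *)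
Fixpoint out_hist (pre : seq V) (sigma : Pl -> strat) (w : V) (n : nat) : seq V :=
  match n with
  | 0 => [:: w]
  | n'.+1 => let hs := out_hist pre sigma w n' in
             rcons hs (sigma (owner (last w hs)) (pre ++ hs))
  end.
Definition outcome (pre : seq V) (sigma : Pl -> strat) (w : V) : nat -> V :=
  fun n => last w (out_hist pre sigma w n).

Definition upd_profile (sigma : Pl -> strat) (i : Pl) (t : strat) : Pl -> strat :=
  fun j => if j == i then t else sigma j.

Definition compatible (i : Pl) (sigma : Pl -> strat) (v : V) (g : seq V) : Prop :=
  exists t, g = v :: t /\ path edge v t /\
    forall k, (k.+1 < size g)%N -> owner (nth v g k) != i ->
      nth v g k.+1 = sigma (owner (nth v g k)) (take k.+1 g).

(* sigma_{-i} (the i-th component is irrelevant) is lambda-rational from v *)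
Definition lam_rational (lam : V -> \bar rat) (i : Pl) (sigma : Pl -> strat) (v : V)
  : Prop :=
  exists t, valid_strat i t /\
    forall g, compatible i sigma v g ->
      lam_consistent lam
        (outcome (belast v (behead g)) (upd_profile sigma i t) (last v (behead g))).

Definition nego (lam : V -> \bar rat) (v : V) : \bar R :=
  let i := owner v in
  ereal_inf [set ereal_sup [set mp i (outcome [::] (upd_profile sigma i t) v)
                            | t in [set t | valid_strat i t]]
            | sigma in [set sigma | (forall j, j != i -> valid_strat j (sigma j))
                                    /\ lam_rational lam i sigma v]].

(* Punishment families  h c^oo rho, encoded by (h, c, xbar, W)          *)
Definition fam := (seq V * seq V * (Pl -> rat) * {set V})%type.

Definition ncat (n : nat) (c : seq V) : seq V := flatten (nseq n c).

(* rho' can follow h c^n (n>0) in the family (h,c,x,W) *)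
Definition fam_tail (f : fam) (rho : nat -> V) : Prop :=
  let: (h, c, x, W) := f in
  is_play rho /\ (forall j, mp j rho = (ratr (x j) : R)%:E) /\ occ_eq rho W
  /\ edge (last (head (rho 0%N) h) c) (rho 0%N).

Definition valid_fam (lam : V -> \bar rat) (beta : int) (f : fam) : Prop :=
  let: (h, c, x, W) := f in
  [/\ (* h simple history *) exists v t, h = v :: t /\ path edge v t /\ uniq h,
      exists u t, c = u :: t /\ cycle edge c /\ uniq c /\ edge (last u h) u,
      ((tuple_size x)%:Z <= beta)%R,
      exists rho, fam_tail f rho &
      forall n rho, (0 < n)%N -> fam_tail f rho ->
        lam_consistent lam (prepend (h ++ ncat n c) rho)].

Inductive rstate :=
| SProv of V
| SFam of fam
| SPost of seq V & V
| SPre of seq V & V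
| STop | SBot.

Inductive rplayer := Prover | Challenger.
Definition rowner (s : rstate) : rplayer :=
  match s with SProv _ => Prover | _ => Challenger end.

Section Red.
Context (lam : V -> \bar rat) (i : Pl) (beta : int).

Definition post_ok (f : fam) (u : V) : Prop :=
  let: (h, c, x, W) := f in exists2 z, z \in W & owner z = i /\ edge z u.

Definition pre_ok (f : fam) (h' : seq V) (w : V) : Prop :=
  let: (h, c, x, W) := f in
  [/\ h' != [::], prefix h' (h ++ c), owner (last w h') = i & edge (last w h') w].

Definition is_rstate (s : rstate) : Prop :=
  match s with
  | SProv _ => True
  | SFam f => valid_fam lam beta f
  | SPost c u => exists f, valid_fam lam beta f /\ f.1.1.2 = c /\ post_ok f u
  | SPre h' w => exists f, valid_fam lam beta f /\ pre_ok f h' w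
  | STop => True
  | SBot => True
  end.

Definition rmove (s t : rstate) : Prop :=
  match s, t with
  | SProv v, SFam f => valid_fam lam beta f /\ head v f.1.1.1 = v
  | SProv _, SBot => True
  | SFam f, STop => True
  | SFam f, SPre h' w => pre_ok f h' w
  | SFam f, SPost c u => f.1.1.2 = c /\ post_ok f u
  | SPre _ w, SProv v => v = w
  | SPost _ u, SProv v => v = u
  | STop, STop => True
  | SBot, SBot => True
  | _, _ => False
  end.

Definition rstrat := seq rstate -> rstate.
Definition valid_rstrat (p : rplayer) (t : rstrat) : Prop :=
  forall hs s, is_rstate s -> rowner s = p -> rmove s (t (rcons hs s)).

Fixpoint rhist (tP tC : rstrat) (s0 : rstate) (n : nat) : seq rstate :=
  match n with
  | 0 => [:: s0]
  | n'.+1 => let hs := rhist tP tC s0 n' in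
             let s := last s0 hs in
             rcons hs ((if rowner s is Prover then tP else tC) hs)
  end.
Definition rout (tP tC : rstrat) (s0 : rstate) : nat -> rstate :=
  fun n => last s0 (rhist tP tC s0 n).

(* The play \dot H in G associated with a play H of Red.
   pick f w : the shortest history h' chosen in the post-cycle case;
   tailpick f : the play rho of the family f used after Challenger accepts. *)
Context (pick : fam -> V -> seq V) (tailpick : fam -> nat -> V).

Definition dot_step (acc : seq V * option (nat -> V)) (s t : rstate)
  : seq V * option (nat -> V) :=
  let: (pre, tl) := acc in
  match s, t with
  | SFam (h, c, x, W), STop =>
      let N := size (pre ++ h) in (pre ++ h ++ ncat (N * N) c, Some (tailpick (h, c, x, W)))
  | SFam f, SPre h' _ => (pre ++ h', tl)
  | SFam (h, c, x, W), SPost _ w =>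
      let N := size (pre ++ h) in (pre ++ h ++ ncat (N * N) c ++ pick (h, c, x, W) w, tl)
  | STop, STop =>
      match tl with
      | Some r => (rcons pre (r 0%N), Some (fun n => r n.+1))
      | None => (pre, tl)
      end
  | _, _ => (pre, tl)
  end.

Fixpoint dot_acc (H : nat -> rstate) (n : nat) : seq V * option (nat -> V) :=
  match n with
  | 0 => ([::], None)
  | n'.+1 => dot_step (dot_acc H n') (H n') (H n)
  end.

(* \dot H = h^(1) h^(2) ... ; the prefixes (dot_acc H k).1 are increasing and
   (dot_acc H (3n+3)).1 has more than n vertices on every play from a Prover
   state not reaching bot (each 3 steps at least one new vertex). *)
Definition dot_play (d : V) (H : nat -> rstate) : nat -> V :=
  fun n => nth d (dot_acc H (3 * n + 3)).1 n.

Definition nuC (d : V) (H : nat -> rstate) : \bar R :=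
  if pselect (exists n, H n = SBot) then +oo%E else mp i (dot_play d H).

Definition val_infsup (v0 : V) : \bar R :=
  ereal_inf [set ereal_sup [set nuC v0 (rout tP tC (SProv v0))
                             | tC in [set t | valid_rstrat Challenger t]]
            | tP in [set t | valid_rstrat Prover t]].
Definition val_supinf (v0 : V) : \bar R :=
  ereal_sup [set ereal_inf [set nuC v0 (rout tP tC (SProv v0))
                             | tP in [set t | valid_rstrat Prover t]]
            | tC in [set t | valid_rstrat Challenger t]].

Definition shortest_pick_spec : Prop :=
  forall (f : fam) (w : V), valid_fam lam beta f ->
    let: (h, c, x, W) := f in
    let P := fun h' : seq V =>
      exists a t, h' = a :: t /\ edge (last a c) a /\ path edge a t /\
        {subset h' <= W} /\ owner (last a h') = i /\ edge (last a h') w in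
    (exists h', P h') ->
      P (pick f w) /\ forall h', P h' -> (size (pick f w) <= size h')%N.

Definition tail_pick_spec : Prop :=
  forall f : fam, valid_fam lam beta f -> fam_tail f (tailpick f).

End Red.
End MeanPayoff.

(* Main.v *)
Require Import Defs.
From HB Require Import structures.
From mathcomp Require Import all_boot all_order all_algebra.
From mathcomp Require Import perm.
From mathcomp Require Import all_classical all_reals all_analysis.
From mathcomp Require Import zify ring lra.

Set Implicit Arguments. Unset Strict Implicit. Unset Printing Implicit Defensive.
Import Order.TTheory GRing.Theory Num.Theory numFieldNormedType.Exports.
Local Open Scope ring_scope.

(** The proof establishes nego <= sup inf <= inf sup <= nego, thresholding everything at a real [a]
    and weighting each edge by its reward for player [i] minus [a].

    For nego <= sup inf, play the reduced game only until some Prover vertex repeats.  A round that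
    ends with a pre-cycle deviation has the weight of the path played; a round that ends with a
    post-cycle deviation is good or bad for Challenger according to the sign of the punishing
    cycle, whose [N^2] repetitions dominate everything else.  This finite game is determined, and
    the stack discipline of the first cycle game turns a winning strategy of Prover into a
    lambda-rational coalition that keeps player [i] at most at [a], and a winning strategy of
    Challenger into a strategy of the reduced game that secures at least [a].

    For inf sup <= nego, Prover simulates a lambda-rational coalition that keeps player [i] below
    [a].  The play the coalition expects has mean payoff below [a], so removing from it the cycles
    of nonnegative weight must at some point reveal a negative simple cycle [c]; the acyclic
    remainder [h] and [c] make a punishment family.  Its payoff can be taken small: a limit of the
    cycle frequencies along the play solves a linear program expressing the requirement and the
    bound [a], a basic solution of it is bounded by Cramer's rule, and every rational solution is
    the payoff of a play. *)

(** * Weights of walks and mean payoffs *)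

(** The [N^2] laps count for the time they take more than for the weight they carry. The [N]
    vertices before them contribute a sum of order [N], and when the laps end the date is at least
    [N^2]. For a negative cycle this is a date with a negligible average; the mean payoff being a
    lower limit, infinitely many such dates settle the matter whatever happens in between. A
    nonnegative cycle costs Challenger at most a constant per round, and the number of such rounds
    is at most the square root of the elapsed time. So only the sign of the cycle has to be
    remembered, which makes the truncated game independent of [N] and hence finite.

    Neither simulation is literal. A deviation in a late lap is read as one in the first lap, the
    skipped laps having negative weight. Conversely, a prefix of [h c] stands for a longer history
    of the coalition, so the link between the two must hold for every prefix of the stack and not
    just for its top.

    The linear program has a variable per simple cycle but only one row per player and one for
    normalisation. The rows govern the determinants, whence a polynomial bound. *)

Fixpoint wsum (R : nmodType) (V : Type) (g : V -> V -> R) (s : seq V) (e : V) : R :=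
  if s is x :: s' then g x (head e s') + wsum g s' e else 0.

Definition csum (R : nmodType) (V : Type) (g : V -> V -> R) (c : seq V) : R :=
  if c is x :: _ then wsum g c x else 0.

Definition pays (R : nmodType) (V : Type) (g : V -> V -> R) (rho : nat -> V) (n : nat) : R :=
  \sum_(k < n) g (rho k) (rho k.+1).

(** Walks are half-open: the endpoint [x] stays outside the list. Weights and edge conditions of
    [s1 ++ s2] then split exactly, the head of [s2] being the endpoint of [s1], and a cycle is a
    list that ends at its own head. *)
Fixpoint wpath (V : Type) (e : rel V) (s : seq V) (x : V) : bool :=
  if s is y :: s' then e y (head x s') && wpath e s' x else true.

Section WalkPaths.
Context (V : finType) (e : rel V).

Lemma wpath_cat s1 s2 x : wpath e (s1 ++ s2) x = wpath e s1 (head x s2) && wpath e s2 x.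
Proof. by elim: s1 => [|y s1 IH] //=; rewrite IH andbA; case: s1 {IH}. Qed.

Lemma wpath_rcons s y x : wpath e (rcons s y) x = wpath e s y && e y x.
Proof. by rewrite -cats1 wpath_cat /= andbT. Qed.

Lemma wpath_cons y s x : wpath e (y :: s) x = path e y (rcons s x).
Proof. by elim: s y => [|z s IH] y //=; rewrite -IH. Qed.

Lemma wpath_ncat n y t : wpath e (y :: t) y -> wpath e (ncat n (y :: t)) y.
Proof.
move=> h; elim: n => // n IH.
rewrite (_ : ncat n.+1 _ = (y :: t) ++ ncat n (y :: t)) // wpath_cat IH andbT.
by case: n {IH}.
Qed.

Lemma wpath_mkseq (rho : nat -> V) n :
  (forall k, e (rho k) (rho k.+1)) -> wpath e (mkseq rho n) (rho n).
Proof. by move=> p; elim: n => // n IH; rewrite mkseqS wpath_rcons IH p. Qed.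

End WalkPaths.

Section WalkSums.
Context (R : nmodType) (V : finType) (g : V -> V -> R).
Implicit Types (s c : seq V) (rho : nat -> V).

Lemma wsum_cat s1 s2 e : wsum g (s1 ++ s2) e = wsum g s1 (head e s2) + wsum g s2 e.
Proof.
elim: s1 => [|x s1 IH] /=; first by rewrite add0r.
by rewrite IH addrA; case: s1 {IH}.
Qed.

Lemma wsum_rcons s x e : wsum g (rcons s x) e = wsum g s x + g x e.
Proof. by rewrite -cats1 wsum_cat /= addr0. Qed.

Lemma wsum_mkseq rho n : wsum g (mkseq rho n) (rho n) = pays g rho n.
Proof.
elim: n => [|n IH]; first by rewrite /pays big_ord0.
by rewrite mkseqS wsum_rcons IH /pays big_ord_recr.
Qed.

Lemma wsum_ncat n x t : wsum g (ncat n (x :: t)) x = csum g (x :: t) *+ n.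
Proof.
elim: n => [|n IH]; first by rewrite mulr0n.
rewrite (_ : ncat n.+1 _ = (x :: t) ++ ncat n (x :: t)) // wsum_cat mulrS IH.
by congr (_ + _); case: n {IH}.
Qed.

Lemma paysD rho m n : pays g rho (m + n) = pays g rho m + pays g (suffix_from rho m) n.
Proof.
rewrite /pays big_split_ord /=; congr (_ + _); apply: eq_bigr => k _.
by rewrite /suffix_from addnS.
Qed.

End WalkSums.

Section WalkBounds.
Context (R : numDomainType) (V : finType) (g : V -> V -> R) (M : R).
Hypothesis gM : forall u v, `|g u v| <= M.

Lemma wsum_bound s e : `|wsum g s e| <= M *+ size s.
Proof.
elim: s => [|x s IH] /=; first by rewrite normr0 mulr0n.
by rewrite mulrS (le_trans (ler_normD _ _)) // lerD.
Qed.

Lemma pays_bound rho n : `|pays g rho n| <= M *+ n.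
Proof. by rewrite -wsum_mkseq (le_trans (wsum_bound _ _)) // size_mkseq. Qed.

End WalkBounds.

(** Only the last edge depends on the endpoint. *)
Lemma wsum_end (R : realDomainType) (V : finType) (g : V -> V -> R) (M : R) s e e' :
  (forall u v, `|g u v| <= M) -> wsum g s e <= wsum g s e' + (M + M).
Proof.
move=> gM; elim/last_ind: s => [|s x _] /=.
  rewrite add0r; have := gM e e; have := normr_ge0 (g e e); lra.
rewrite !wsum_rcons -addrA lerD2l.
have := gM x e; have := gM x e'; rewrite !ler_norml => /andP[? ?] /andP[? ?]; lra.
Qed.

Lemma finite_bound (R : numDomainType) (V : finType) (g : V -> V -> R) :
  exists2 M : R, 0 <= M & forall u v, `|g u v| <= M.
Proof.
exists (\sum_u \sum_v `|g u v|); first by apply: sumr_ge0 => u _; apply: sumr_ge0.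
move=> u v; rewrite (bigD1 u) //= (bigD1 v) //= -addrA lerDl.
by rewrite addr_ge0 // !sumr_ge0 // => w _; rewrite sumr_ge0.
Qed.

Lemma archi_bound (R : archiRealFieldType) (c e : R) : 0 < e ->
  exists n0 : nat, forall n, (n0 <= n)%N -> c <= e * n%:R.
Proof.
move=> e0; exists (Num.bound (`|c| / e)) => n hn.
have : `|c| / e < n%:R.
  by rewrite (lt_le_trans (archi_boundP _)) ?divr_ge0 ?ler_nat // ltW.
by rewrite ltr_pdivrMr // mulrC => /ltW; apply: le_trans; rewrite ler_norm.
Qed.

Lemma eq_ereal_lb (R : realType) (x y : \bar R) :
  (forall a : R, (a%:E <= x)%E <-> (a%:E <= y)%E) -> x = y.
Proof.
suff H : forall x y : \bar R, (forall a : R, (a%:E <= x)%E -> (a%:E <= y)%E) -> (x <= y)%E.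
  by move=> h; apply/eqP; rewrite eq_le; apply/andP; split; apply: H => a; apply h.
move=> {}x {}y h; case: x h => [r||] h; first exact: h.
- case: y h => [s||] h //; first by have := h (s + 1)%R (leey _); rewrite lee_fin gerDl ler10.
  by have := h 0%R (leey _).
- exact: leNye.
Qed.

Section MeanPayoffSums.
Context (R : realType) (Pl V : finType) (G : game Pl V).
Implicit Types (j : Pl) (a x : R) (rho : nat -> V).

Definition gain j a (u v : V) : R := ratr (reward G j u v) - a.

Let avg j rho n : R := (\sum_(k < n) (ratr (reward G j (rho k) (rho k.+1)) : R)) / n%:R.

Let mpE j rho : mp R G j rho = ereal_sup (range (einfs (fun n => (avg j rho n)%:E))).
Proof. by rewrite /mp limn_einf_lim; apply: cvg_lim => //; exact: cvg_einfs_sup. Qed.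

Let pays_avg j a rho n : (0 < n)%N -> pays (gain j a) rho n = (avg j rho n - a) * n%:R.
Proof.
move=> n0; rewrite /pays /gain big_split /= sumr_const card_ord mulrBl divfK ?mulr_natr //.
by rewrite -mulNrn.
by rewrite pnatr_eq0 -lt0n.
Qed.

(** Averages are eventually at least [a - e]; multiplying by [n] gives a form without division, also
    valid at [n = 0], in which all later estimates are made. *)
Lemma mp_geP j a rho : (a%:E <= mp R G j rho)%E <->
  (forall e : R, 0 < e -> exists n0 : nat, forall n, (n0 <= n)%N -> - (e * n%:R) <= pays (gain j a) rho n).
Proof.
rewrite mpE; split=> [h e e0|h].
  have /ereal_sup_gtP[_ [n0 _ <-] lt] :
      ((a - e)%:E < ereal_sup (range (einfs (fun n => (avg j rho n)%:E))))%E.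
    by apply: lt_le_trans h; rewrite lte_fin; lra.
  exists n0 => n hn; case: (posnP n) => [->|n1]; first by rewrite mulr0 oppr0 /pays big_ord0.
  rewrite pays_avg // -mulNr ler_wpM2r //.
  have : ((a - e)%:E <= (avg j rho n)%:E)%E.
    by apply: (le_trans (ltW lt)); apply: ereal_inf_lbound; exists n.
  by rewrite lee_fin; lra.
apply/lee_addgt0Pr => e e0; have [n0 hn] := h e e0.
rewrite -leeBlDr // -EFinB.
apply: (@le_trans _ _ (einfs (fun n => (avg j rho n)%:E) n0.+1)); last first.
  by apply: ereal_sup_ubound; exists n0.+1.
apply: le_ereal_inf_tmp => _ [n /= ln <-]; rewrite lee_fin.
have n1 : (0 < n)%N by apply: leq_trans ln.
have := hn n (ltnW ln); rewrite pays_avg // -mulNr ler_pM2r ?ltr0n //; lra.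
Qed.

(** Strictness removes the error term: if the partial sums were positive from some date on, [mp_geP]
    would give the opposite inequality. *)
Lemma mp_lt j a rho : (mp R G j rho < a%:E)%E ->
  forall n0 : nat, exists2 n, (n0 <= n)%N & pays (gain j a) rho n <= 0.
Proof.
move=> lt n0; apply: contrapT => H.
have : (a%:E <= mp R G j rho)%E.
  apply/mp_geP => e e0; exists n0 => n hn.
  apply: (@le_trans _ _ 0); first by rewrite oppr_le0 mulr_ge0 // ltW.
  by rewrite leNgt; apply/negP => /ltW h; apply: H; exists n.
by rewrite leNgt lt.
Qed.

(** To bound a lower limit from above, low dates only have to recur; nothing is asked in between. *)
Lemma mp_le j a rho :
  (forall e : R, 0 < e -> forall n0 : nat, exists2 n, (n0 <= n)%N & pays (gain j a) rho n <= e * n%:R) ->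
  (mp R G j rho <= a%:E)%E.
Proof.
move=> h; rewrite leNgt; apply/negP; rewrite mpE => /ereal_sup_gtP[_ [n0 _ <-] lt].
have ub n : (n0 <= n)%N -> (einfs (fun n => (avg j rho n)%:E) n0 <= (avg j rho n)%:E)%E.
  by move=> hn; apply: ereal_inf_lbound; exists n.
move: lt ub; case: (einfs _ n0) => [b||] // lt ub; last by have := ub n0 (leqnn _).
rewrite lte_fin in lt.
have [|n hn] := h ((b - a) / 2) _ n0.+1; first by lra.
have n1 : (0 < n)%N by apply: leq_trans hn.
rewrite pays_avg // ler_pM2r ?ltr0n //.
have := ub n (ltnW hn); rewrite lee_fin; lra.
Qed.

Lemma mp_eq j a rho :
  (forall e : R, 0 < e -> exists n0 : nat, forall n, (n0 <= n)%N -> `|pays (gain j a) rho n| <= e * n%:R) ->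
  mp R G j rho = a%:E.
Proof.
move=> h; apply/eqP; rewrite eq_le; apply/andP; split.
  apply: mp_le => e e0 n0; have [n1 hn] := h e e0; exists (maxn n0 n1); rewrite ?leq_maxl //.
  by rewrite (le_trans (ler_norm _)) // hn // leq_maxr.
by apply/mp_geP => e e0; have [n0 hn] := h e e0; exists n0 => n /hn; rewrite ler_norml => /andP[].
Qed.

Lemma mp_suffix j rho m : mp R G j (suffix_from rho m) = mp R G j rho.
Proof.
apply: eq_ereal_lb => a; rewrite !mp_geP; split=> h e e0.
- have [|n0 hn] := h (e / 2); first by lra.
  have [|n1 hn1] := @archi_bound R (`|pays (gain j a) rho m|) (e / 2); first by lra.
  exists (m + (n0 + n1))%N => n ln; rewrite -(subnKC (leq_trans (leq_addr _ _) ln)) paysD.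
  have {}hn := hn (n - m)%N; have := hn1 (n - m)%N; rewrite natrD.
  have h0 : (0 : R) <= m%:R by [].
  have h3 : - `|pays (gain j a) rho m| <= pays (gain j a) rho m by rewrite lerNnormlW.
  move=> /(_ _)h1; have {}h1 := h1 ltac:(lia); have {}hn := hn ltac:(lia).
  have : 0 <= e * m%:R by rewrite mulr_ge0 // ltW.
  lra.
- have [|n0 hn] := h (e / 2); first by lra.
  have [|n1 hn1] := @archi_bound R (`|pays (gain j a) rho m| + (e / 2) * m%:R) (e / 2); first by lra.
  exists (n0 + n1)%N => n ln; have := hn (m + n)%N ltac:(lia); rewrite paysD natrD.
  have := hn1 n ltac:(lia).
  have h3 : pays (gain j a) rho m <= `|pays (gain j a) rho m| by rewrite ler_norm.
  lra.
Qed.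

End MeanPayoffSums.

Section Prepend.
Context (V : finType).
Implicit Types (s t : seq V) (rho : nat -> V).

Lemma suffix_from_add rho m n : suffix_from (suffix_from rho m) n = suffix_from rho (m + n).
Proof. by apply/funext => k; rewrite /suffix_from addnA. Qed.

End Prepend.

Section PrependFin.
Context (V : finType).
Implicit Types (s t : seq V) (rho : nat -> V).

Lemma suffix_prepend s rho : suffix_from (prepend s rho) (size s) = rho.
Proof. by apply/funext => k; rewrite /suffix_from /prepend ltnNge leq_addr /= addKn. Qed.

Lemma prepend_lt s rho k e : (k < size s)%N -> prepend s rho k = nth e s k.
Proof. by move=> h; rewrite /prepend h; apply: set_nth_default. Qed.

Lemma prepend_ge s rho k : prepend s rho (size s + k) = rho k.
Proof. by rewrite /prepend ltnNge leq_addr /= addKn. Qed.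

Lemma prepend0 s rho : prepend s rho 0 = head (rho 0%N) s.
Proof. by case: s. Qed.

End PrependFin.

Section MpPrepend.
Context (R : realType) (Pl V : finType) (G : game Pl V).

Lemma mp_prepend j s rho : mp R G j (prepend s rho) = mp R G j rho.
Proof. by rewrite -(mp_suffix R G _ (prepend s rho) (size s)) suffix_prepend. Qed.

Lemma mp_suffix_prepend j s rho n :
  mp R G j (suffix_from (prepend s rho) n) = mp R G j rho.
Proof. by rewrite mp_suffix mp_prepend. Qed.

Lemma prepend_play s rho : is_play G rho -> wpath (edge G) s (rho 0%N) ->
  is_play G (prepend s rho).
Proof.
move=> pr; elim: s => [_ k|x s IH /= /andP[e /IH p] k]; first by rewrite /prepend /= subn0.
rewrite (_ : prepend (x :: s) rho k.+1 = prepend s rho k); last by rewrite /prepend /= ltnS subSS.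
case: k => [|k]; first by rewrite !prepend0.
by rewrite (_ : prepend (x :: s) rho k.+1 = prepend s rho k) // /prepend /= ltnS subSS.
Qed.

End MpPrepend.

(** * Basic solutions of linear systems *)

(** Leibniz formula: [n!] products of [n] entries each. Cruder than Hadamard's bound, but still of
    polynomial bit length. *)
Lemma det_bound (n K : nat) (A : 'M[int]_n) :
  (forall i j, `|A i j| <= K%:Z) -> `|\det A| <= (n`! * K ^ n)%:Z.
Proof.
move=> hA; rewrite /determinant (le_trans (ler_norm_sum _ _ _)) //.
apply: (@le_trans _ _ (\sum_(s : 'S_n) (K ^ n)%:Z)).
  apply: ler_sum => s _; rewrite normrM normrX normrN1 expr1n mul1r normr_prod.
  have -> : (K ^ n)%:Z = \prod_(i < n) K%:Z by rewrite prodr_const card_ord -natz natrX natz.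
  by apply: ler_prod => i _; rewrite normr_ge0 hA.
by rewrite sumr_const (eq_card (B := 'S_n)) // card_Sn PoszM -mulr_natl natz.
Qed.

Section BasicSolutions.
Context (R : realFieldType) (m n : nat) (A : 'M[R]_(m, n)) (b : 'cV[R]_m).

Definition csupp (y : 'cV[R]_n) : {set 'I_n} := [set k | y k 0 != 0].

(* Moving along a kernel direction supported by the support of [y], with the sign
   that does not increase the objective, kills a coordinate of [y]. *)
Lemma basic_solution (y : 'cV[R]_n) (obj : 'rV[R]_n) :
  (forall d : 'cV[R]_n, A *m d = 0 -> (forall k, 0 <= d k 0) -> d = 0) ->
  A *m y = b -> (forall k, 0 <= y k 0) ->
  exists z : 'cV[R]_n,
    [/\ A *m z = b, forall k, 0 <= z k 0, csupp z \subset csupp y,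
        (obj *m z) 0 0 <= (obj *m y) 0 0 &
        forall d : 'cV[R]_n, csupp d \subset csupp z -> A *m d = 0 -> d = 0].
Proof.
move=> bnd; have [N] := ubnP #|csupp y|.
elim: N y => // N IH y hN Ay y0.
case: (pselect (forall d : 'cV[R]_n, csupp d \subset csupp y -> A *m d = 0 -> d = 0)) => [h|h].
  by exists y; split.
have [d [sd Ad d0 od]] : exists d : 'cV[R]_n,
    [/\ csupp d \subset csupp y, A *m d = 0, d <> 0 & (obj *m d) 0 0 <= 0].
  move/existsNP: h => [d] /not_implyP[sd] /not_implyP[Ad d0].
  case: (lerP ((obj *m d) 0 0) 0) => od; first by exists d.
  exists (- d); split.
  - by apply: fintype.subset_trans sd; apply/fintype.subsetP => k; rewrite !inE mxE oppr_eq0.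
  - by rewrite mulmxN Ad oppr0.
  - by move=> /eqP; rewrite oppr_eq0 => /eqP.
  - by rewrite mulmxN mxE oppr_le0 ltW.
(* By [bnd] the feasible set has no unbounded direction, so a nonzero kernel direction decreases
   some coordinate. *)
have [k1 k1n] : exists k, d k 0 < 0.
  apply: contrapT => /forallNP hk; apply: d0; apply: bnd => // k.
  by rewrite leNgt; apply/negP; apply: hk.
(* Ratio test: [k0] is the first coordinate to vanish along [d], so the others stay nonnegative. *)
have [k0 k0n kmin] : exists2 k, d k 0 < 0 & forall l, d l 0 < 0 -> y k 0 / - d k 0 <= y l 0 / - d l 0.
  exists [arg min_(k < k1 | d k 0 < 0) (y k 0 / - d k 0)]%O; case: Order.TotalTheory.arg_minP => //.
pose t := y k0 0 / - d k0 0.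
have t0 : 0 <= t by rewrite divr_ge0 // oppr_ge0 ltW.
pose y' := y + t *: d.
have yk0 : y' k0 0 = 0.
  by rewrite !mxE /t; field; rewrite lt_eqF.
have ss : csupp y' \subset csupp y.
  apply/fintype.subsetP => k; rewrite !inE !mxE; apply: contraNneq => yk.
  have : k \notin csupp d by apply: contraT; rewrite negbK => /(fintype.subsetP sd); rewrite inE yk eqxx.
  by rewrite inE negbK => /eqP ->; rewrite yk mulr0 addr0.
have k0y : k0 \in csupp y by apply: (fintype.subsetP sd); rewrite inE lt_eqF.
have [|||z [Az z0 sz oz iz]] := IH y'.
- rewrite -ltnS; apply: leq_trans hN; rewrite ltnS; apply: proper_card; rewrite properE ss /=.
  by apply/fintype.subsetPn; exists k0 => //; rewrite inE yk0 eqxx.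
- by rewrite mulmxDr -scalemxAr Ad scaler0 addr0.
- move=> k; rewrite !mxE; case: (lerP 0 (d k 0)) => dk; first by rewrite addr_ge0 ?y0 // mulr_ge0.
  have := kmin k dk; rewrite -/t ler_pdivlMr ?oppr_gt0 //; lra.
- exists z; split=> //; first exact: fintype.subset_trans ss.
  apply: (le_trans oz); rewrite mulmxDr -scalemxAr !mxE gerDl.
  by rewrite mulr_ge0_le0 //; move: od; rewrite mxE.
Qed.

End BasicSolutions.

(** The columns of the support are independent, hence contain an invertible square block [B] of
    order at most [m]. Its adjugate has integer entries, so [|det B|] is a common denominator. *)
Lemma cramer_solution (R : realFieldType) (m n K : nat) (A : 'M[int]_(m, n)) (b : 'cV[int]_m)
    (z : 'cV[R]_n) :
  (0 < K)%N -> (forall i j, `|A i j| <= K%:Z) ->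
  map_mx intr A *m z = map_mx intr b -> (forall k, 0 <= z k 0) ->
  (forall d : 'cV[R]_n, csupp d \subset csupp z -> map_mx intr A *m d = 0 -> d = 0) ->
  exists q : nat, exists p : 'I_n -> nat,
    [/\ (0 < q)%N, (q <= m`! * K ^ m)%N & forall k, z k 0 * q%:R = (p k)%:R].
Proof.
move=> K0 hA Az z0 ind; set AR := map_mx intr A in Az ind.
set S := csupp z in ind; pose sel (l : 'I_#|S|) : 'I_n := enum_val l.
have selS l : sel l \in S by apply: enum_valP.
pose AS := colsub sel AR.
have sumS (F : 'I_n -> R) : (forall j, j \notin S -> F j = 0) ->
    \sum_j F j = \sum_(l < #|S|) F (sel l).
  move=> F0; rewrite (bigID (mem S)) /= [X in _ + X]big1 ?addr0; last by move=> j /F0.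
  by rewrite big_enum_val.
have ASf : row_full AS.
  rewrite /row_full -mxrank_tr; apply/inj_row_free => u uA.
  pose d : 'cV[R]_n := \col_j (if [pick l | sel l == j] is Some l then u 0 l else 0).
  have dsel l : d (sel l) 0 = u 0 l.
    rewrite mxE; case: pickP => [l' /eqP/enum_val_inj -> //|/(_ l)]; by rewrite eqxx.
  have d0 j : j \notin S -> d j 0 = 0.
    by move=> jS; rewrite mxE; case: pickP => // l /eqP e; rewrite -e selS in jS.
  have dz : d = 0.
    apply: ind; first by apply/fintype.subsetP => j; rewrite inE; apply: contraNT => /d0 ->.
    apply/matrixP => i j; rewrite !mxE (ord1 j) sumS => [|j' /d0 ->]; last by rewrite mulr0.
    have /matrixP/(_ 0 i) := uA; rewrite !mxE => e; rewrite -[RHS]e; apply: eq_bigr => l _.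
    by rewrite dsel !mxE mulrC.
  by apply/rowP => l; rewrite -dsel dz !mxE.
(* Full column rank lets one select as many rows as there are columns and keep an invertible
   block. *)
pose f := fullrankfun ASf.
have fu : rowsub f AS \in unitmx by apply: fullrowsub_unit.
pose B : 'M[int]_#|S| := \matrix_(k, l) A (f k) (sel l).
have BE : rowsub f AS = map_mx intr B by apply/matrixP => k l; rewrite !mxE.
pose bf : 'cV[int]_#|S| := \col_k b (f k) 0.
pose zS : 'cV[R]_#|S| := \col_l z (sel l) 0.
have Bz : map_mx intr B *m zS = map_mx intr bf.
  apply/matrixP => k j; rewrite !mxE (ord1 j).
  have /matrixP/(_ (f k) 0) := Az; rewrite !mxE => <-.
  rewrite sumS => [|j']; last by rewrite inE negbK => /eqP ->; rewrite mulr0.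
  by apply: eq_bigr => l _; rewrite !mxE.
have dz : (\det B)%:~R *: zS = map_mx intr (\adj B *m bf).
  by rewrite map_mxM map_mx_adj -Bz mulmxA mul_adj_mx mul_scalar_mx det_map_mx.
have dB : \det B != 0.
  by move: fu; rewrite BE unitmxE det_map_mx unitfE intr_eq0.
(* The sign of the determinant is unknown; since [z] is nonnegative, absolute values on both sides
   suffice. *)
pose p j := if [pick l | sel l == j] is Some l then absz ((\adj B *m bf) l 0) else 0%N.
have kS : (#|S| <= m)%N by rewrite -(eqP ASf) rank_leq_row.
exists `|\det B|%N, p; split.
- by rewrite absz_gt0.
- have := det_bound (A := B) (K := K) (fun k l => _).
  have hB k l : `|B k l| <= K%:Z by rewrite mxE.
  move=> /(_ hB); rewrite -abszE lez_nat => /leq_trans; apply.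
  by rewrite leq_mul // ?leq_pexp2l // leq_fact.
- move=> j; rewrite /p; case: pickP => [l /eqP <-|h].
    have /matrixP/(_ l 0) := dz; rewrite ![in X in X -> _]mxE => e.
    rewrite !natr_absz !intr_norm.
    by rewrite -{1}[z _ _]ger0_norm // -normrM mulrC e [in RHS]mxE.
  have : j \notin S by apply/negP => jS; have := h (enum_rank_in jS j); rewrite /sel enum_rankK_in ?eqxx.
  by rewrite inE negbK => /eqP ->; rewrite mul0r.
Qed.

(** * Cycle decompositions of plays *)

Lemma uniq_size_card (V : finType) (s : seq V) : uniq s -> (size s <= #|V|)%N.
Proof. by move=> /card_uniqP <-; apply: max_card. Qed.

Lemma wsum_const1 (R : pzSemiRingType) (V : finType) (s : seq V) x :
  wsum (fun _ _ => 1 : R) s x = (size s)%:R.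
Proof. by elim: s => //= y s ->; rewrite -natr1 addrC. Qed.

Lemma pays_const1 (R : pzSemiRingType) (V : finType) (rho : nat -> V) n :
  pays (fun _ _ => 1 : R) rho n = n%:R.
Proof. by rewrite /pays sumr_const card_ord. Qed.

Lemma csum_const1 (R : pzSemiRingType) (V : finType) (s : seq V) :
  csum (fun _ _ => 1 : R) s = (size s)%:R.
Proof. by case: s => // x s; rewrite /csum wsum_const1. Qed.

Lemma head_take (T : Type) (x : T) k s : (0 < k)%N -> head x (take k s) = head x s.
Proof. by case: s k => [|y s] []. Qed.

Section Cut.
Context (V : finType) (e : rel V).

Lemma cut_uniq (st : seq V) (x u : V) : uniq (rcons st x) ->
  uniq (rcons (take (index u (rcons st x)) (rcons st x)) u).
Proof.
move=> un; rewrite rcons_uniq take_uniq // andbT.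
by apply/negP => /index_ltn; rewrite ltnn.
Qed.

Lemma cut_head (s : seq V) u : u \in s -> exists t, drop (index u s) s = u :: t.
Proof. by move=> us; exists (drop (index u s).+1 s); rewrite -drop_index. Qed.

Lemma cut_wsum (R : nmodType) (g : V -> V -> R) (s : seq V) u : u \in s ->
  wsum g s u = wsum g (take (index u s) s) u + csum g (drop (index u s) s).
Proof.
move=> us; rewrite -{1}(cat_take_drop (index u s) s) wsum_cat.
by have [t ->] := cut_head us.
Qed.

Lemma cut_wpath (s : seq V) u : u \in s -> wpath e s u ->
  wpath e (take (index u s) s) u && wpath e (drop (index u s) s) u.
Proof.
move=> us; rewrite -{1}(cat_take_drop (index u s) s) wpath_cat.
by have [t ->] := cut_head us.
Qed.

End Cut.

(** Simple cycles have at most [#|V|] vertices; bounding the length makes a finite type, over which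
    weights can be summed and indexed as matrix columns. *)
Definition bcycle (V : finType) := #|V|.-bseq V.

Definition scycle (V : finType) (e : rel V) (c : seq V) : bool :=
  if c is x :: _ then uniq c && wpath e c x else false.

(** Each time the next vertex is already on the stack, the cycle it closes is counted and removed.
    The multiplicities do not depend on [g], so one decomposition serves all players at once. *)
Lemma cycle_decomposition (R : nmodType) (V : finType) (e : rel V) (rho : nat -> V) n :
  (forall k, e (rho k) (rho k.+1)) ->
  exists (mult : bcycle V -> nat) (st : seq V),
  [/\ uniq (rcons st (rho n)) /\ wpath e st (rho n), forall v, v \in st -> exists k, v = rho k,
      forall c, (0 < mult c)%N -> scycle e c /\ forall v, v \in (c : seq V) -> exists k, v = rho k &
      forall g : V -> V -> R, pays g rho n = \sum_(c : bcycle V) csum g c *+ mult c + wsum g st (rho n)].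
Proof.
move=> pl; elim: n => [|n [mult [st [[un wp] occ hm hs]]]].
  exists (fun=> 0%N), [::]; split=> // g.
  by rewrite /pays big_ord0 big1 ?add0r // => c _; rewrite mulr0n.
pose s := rcons st (rho n); pose u := rho n.+1.
have wps : wpath e s u by rewrite wpath_rcons wp pl.
have occs v : v \in s -> exists k, v = rho k.
  by rewrite mem_rcons inE => /orP[/eqP ->|/occ //]; exists n.
have hps (g : V -> V -> R) : pays g rho n.+1 = \sum_(c : bcycle V) csum g c *+ mult c + wsum g s u.
  by rewrite /s wsum_rcons addrA -hs /pays big_ord_recr.
case: (boolP (u \in s)) => us; last first.
  exists mult, s; split=> //; split=> //; rewrite rcons_uniq us; exact: un.
have szc : (size (drop (index u s) s) <= #|V|)%N.
  by apply: uniq_size_card; apply: drop_uniq.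
pose c0 : bcycle V := Bseq szc.
have /andP[wt wd] := cut_wpath us wps.
exists (fun c => mult c + (c == c0))%N, (take (index u s) s); split.
- by split=> //; apply: cut_uniq.
- by move=> v /mem_take /occs.
- move=> c; case: eqP => [-> _|_]; last by rewrite addn0; apply: hm.
  split; last by move=> v /mem_drop /occs.
  have [t ht] := cut_head us; rewrite /scycle /= ht -ht wd andbT.
  exact: drop_uniq.
- move=> g; rewrite hps (cut_wsum _ us) addrA addrAC; congr (_ + _).
  under [in RHS]eq_bigr do rewrite mulrnDr.
  rewrite big_split /=; congr (_ + _).
  rewrite (bigD1 c0) //= eqxx mulr1n big1 ?addr0 // => c /negbTE ->.
  by rewrite mulr0n.
Qed.

Section Lasso.
Context (R : realType) (V : finType) (e : rel V) (g : V -> V -> R) (rho : nat -> V).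
Hypothesis pl : forall k, e (rho k) (rho k.+1).

(* [rcons st (rho n)] is what remains of [rho 0 .. rho n] after removing simple cycles of
   nonnegative weight; each of its prefixes is no heavier than a prefix of [rho] with the same end. *)
Definition lasso_stack (n : nat) (st : seq V) : Prop :=
  [/\ uniq (rcons st (rho n)), wpath e st (rho n), head (rho n) st = rho 0%N,
      wsum g st (rho n) <= pays g rho n &
      forall k, (k <= size st)%N -> exists m,
        [/\ (m <= n)%N, nth (rho n) (rcons st (rho n)) k = rho m &
            wsum g (take k st) (rho m) <= pays g rho m]].

Definition lasso_stop (n : nat) : Prop := exists st,
  [/\ lasso_stack n st, rho n.+1 \in rcons st (rho n) &
      csum g (drop (index (rho n.+1) (rcons st (rho n))) (rcons st (rho n))) < 0].

(** While no negative cycle has been closed, every removed cycle has nonnegative weight, so removal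
    can only make the stack lighter than the play. A prefix that survives keeps the date recorded
    for it earlier. *)
Lemma lasso_stack_ex n : (forall m, (m < n)%N -> ~ lasso_stop m) -> exists st, lasso_stack n st.
Proof.
elim: n => [_|n IH ns].
  exists [::]; split=> //=; first by rewrite /pays big_ord0.
  by case=> // _; exists 0%N; split=> //=; rewrite /pays big_ord0.
have [m lm|st [un wp hd sm pf]] := IH; first by apply: ns; rewrite ltnS ltnW.
have := ns n (ltnSn n) => nst.
pose s := rcons st (rho n); pose u := rho n.+1.
have wps : wpath e s u by rewrite wpath_rcons wp pl.
have hds : head u s = rho 0%N by rewrite /s; case: st hd {un wp sm pf nst s wps}.
have ss : wsum g s u <= pays g rho n.+1.
  by rewrite wsum_rcons /pays big_ord_recr lerD2r.
have pfs k : (k < size s)%N -> exists m, [/\ (m <= n.+1)%N, nth u s k = rho m &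
    wsum g (take k s) (rho m) <= pays g rho m].
  rewrite size_rcons ltnS => lk; have [m [lm e1 e2]] := pf k lk; exists m; split.
  - exact: leqW.
  - by rewrite -e1; apply: set_nth_default; rewrite size_rcons ltnS.
  - by rewrite /s -cats1 takel_cat.
case: (boolP (u \in s)) => us; last first.
  exists s; split=> //; first by rewrite rcons_uniq us; exact: un.
  move=> k; rewrite leq_eqVlt => /orP[/eqP ->|lk].
    by exists n.+1; rewrite nth_rcons ltnn eqxx take_size; split.
  by have [m [lm e1 e2]] := pfs k lk; exists m; rewrite nth_rcons lk; split.
have /andP[wt wd] := cut_wpath us wps.
have cge : 0 <= csum g (drop (index u s) s).
  by rewrite leNgt; apply/negP => lt; apply: nst; exists st; split.
have full : wsum g (take (index u s) s) u <= pays g rho n.+1.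
  by apply: le_trans ss; rewrite (cut_wsum g us) lerDl.
have il : (index u s < size s)%N by rewrite index_mem.
exists (take (index u s) s); split=> //.
- exact: cut_uniq.
- case: (posnP (index u s)) => i0; last by rewrite head_take.
  by rewrite i0 take0 /= -hds; have [t] := cut_head us; rewrite i0 drop0 => ->.
- have sz : size (take (index u s) s) = index u s by rewrite size_takel // ltnW.
  move=> k; rewrite sz leq_eqVlt => /orP[/eqP ->|lk].
    exists n.+1; split=> //; first by rewrite nth_rcons sz ltnn eqxx.
    by rewrite take_oversize // sz.
  have [m [lm e1 e2]] := pfs k (ltn_trans lk il); exists m; split=> //.
    by rewrite nth_rcons sz lk nth_take.
  by rewrite -take_min (minn_idPl (ltnW lk)).
Qed.

Lemma lasso_stack_lb n st (M : R) : 0 <= M -> (forall u v, `|g u v| <= M) -> lasso_stack n st ->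
  - (M * #|V|%:R) <= pays g rho n.
Proof.
move=> M0 gM [un _ _ sm _]; apply: le_trans sm.
have := wsum_bound gM st (rho n); rewrite ler_norml => /andP[h _]; apply: le_trans h.
rewrite lerN2 -[M *+ _]mulr_natr ler_wpM2l // ler_nat.
by apply: leq_trans (uniq_size_card un); rewrite size_rcons.
Qed.

End Lasso.

(** If no negative cycle ever closed, the partial sums would stay above the weight of a simple walk,
    a constant, and the mean payoff would be at least [a]. The first closing is taken so that a
    stack exists at every earlier date. *)
Lemma lasso_stop_ex (R : realType) (Pl V : finType) (G : game Pl V) i (a : R) rho :
  is_play G rho -> (mp R G i rho < a%:E)%E ->
  exists n, [/\ lasso_stop (edge G) (gain G i a) rho n &
    forall m, (m <= n)%N -> exists st, lasso_stack (edge G) (gain G i a) rho m st].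
Proof.
move=> pl lt; set g := gain G i a.
have [[n0 hn0]|h] := pselect (exists n, lasso_stop (edge G) g rho n).
  have ex : exists n, `[< lasso_stop (edge G) g rho n >] by exists n0; apply/asboolP.
  case: (ex_minnP ex) => n /asboolP hn nmin; exists n; split=> // m mn.
  apply: lasso_stack_ex => // m' m'm st; have := nmin m'; rewrite leqNgt (leq_trans m'm mn).
  by move=> h; have := h ((introT (asboolP _) st)).
have [M M0 gM] := finite_bound g.
have : (a%:E <= mp R G i rho)%E.
  apply/mp_geP => ep e0; have [n0 hn] := archi_bound (M * #|V|%:R) e0; exists n0 => n ln.
  have [|st hst] := @lasso_stack_ex R V (edge G) g rho pl n.
    by move=> m _ hm; apply: h; exists m.
  by apply: le_trans (lasso_stack_lb M0 gM hst); rewrite lerN2 hn.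
by rewrite leNgt lt.
Qed.

Lemma cvg_finsum (R : realType) (T : Type) (F : set_system T) (I : Type) (r : seq I)
    (f : I -> T -> R) (l : I -> R) : Filter F ->
  (forall k, f k x @[x --> F] --> l k)%classic ->
  ((\sum_(k <- r) f k x) @[x --> F] --> \sum_(k <- r) l k)%classic.
Proof.
move=> FF h; elim: r => [|k r IH].
  rewrite big_nil; under eq_fun do rewrite big_nil; exact: cvg_cst.
rewrite big_cons; under eq_fun do rewrite big_cons; exact: cvgD.
Qed.

(** The total violation is continuous on a compact box, so it attains its minimum; approximate
    solutions push this minimum down to zero. Excluded coordinates are confined to the segment from
    0 to 0. *)
Lemma compact_linear_system (R : realType) (C K : finType) (P : pred C)
    (A : K -> C -> R) (b : K -> R) :
  (forall e : R, 0 < e -> exists w : C -> R,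
    [/\ forall c, 0 <= w c <= 1, forall c, ~~ P c -> w c = 0 &
        forall k, \sum_c A k c * w c <= b k + e]) ->
  exists w : C -> R,
    [/\ forall c, 0 <= w c, forall c, ~~ P c -> w c = 0 &
        forall k, \sum_c A k c * w c <= b k].
Proof.
move=> h.
pose L k (x : 'rV[R]_#|C|) : R := (\sum_c A k c * x ord0 (enum_rank c)) - b k.
(* [z + |z|] is twice the positive part of [z]. *)
pose F (x : 'rV[R]_#|C|) : R := \sum_k (L k x + `|L k x|).
pose S (l : 'I_#|C|) : set R := `[0, (if P (enum_val l) then 1 else 0)%R]%classic.
pose D : set 'rV[R]_#|C| := [set x | forall l, S l (x ord0 l)]%classic.
have cD : compact D by apply: rV_compact => l; apply: segment_compact.
have ofw (w : C -> R) : (forall c, 0 <= w c <= 1) -> (forall c, ~~ P c -> w c = 0) ->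
    D (\row_l w (enum_val l)).
  move=> w1 w2 l; rewrite /S /= mxE in_itv /=; case: ifPn => [_|/w2 ->]; first exact: w1.
  by rewrite lexx.
have Lw k (w : C -> R) : L k (\row_l w (enum_val l)) = (\sum_c A k c * w c) - b k.
  by congr (_ - _); apply: eq_bigr => c _; rewrite mxE enum_rankK.
have Lc k : continuous (L k).
  move=> x; apply: (@cvgB R R _ (nbhs x) _
    (fun x : 'rV[R]_#|C| => \sum_c A k c * x ord0 (enum_rank c)) (fun=> b k)).
    by apply: cvg_finsum => c; apply: cvgMr; apply: coord_continuous.
  exact: cvg_cst.
have Fc : continuous F.
  move=> x; apply: (@cvg_finsum R _ (nbhs x) K _ (fun k y => L k y + `|L k y|)
    (fun k => L k x + `|L k x|)) => k.
  by apply: (@cvgD R R _ (nbhs x) _ (L k) (fun y => `|L k y|));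
    [exact: Lc|apply: cvg_norm; exact: Lc].
have [|x /set_mem xD xmin] := @EVT_min_rV R #|C| F D _ cD (continuous_subspaceT Fc).
  have [w [w1 w2 _]] := h 1 ltr01; exists (\row_l w (enum_val l)); exact: ofw.
have pn (r : R) : 0 <= r + `|r| by have := ler_norm (- r); rewrite normrN; lra.
have Fx : F x <= 0.
  apply/ler_addgt0Pr => /= e; rewrite add0r => e0.
  have [d d0 de] : exists2 d : R, 0 < d & \sum_(k : K) d <= e.
    exists (e / (#|K|.+1)%:R); first by rewrite divr_gt0.
    rewrite sumr_const -[X in X <= _]mulr_natr mulrAC ler_pdivrMr ?ltr0n //.
    by rewrite ler_wpM2l ?(ltW e0) // ler_nat.
  have [|w [w1 w2 w3]] := h (d / 2); first by lra.
  apply: (le_trans (xmin _ (mem_set (ofw w w1 w2)))); apply: le_trans de.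
  apply: ler_sum => k _; rewrite Lw; move: (\sum_c _) (w3 k) => z hz.
  case: (leP 0 (z - b k)) => z0; [rewrite (ger0_norm z0)|rewrite (ltr0_norm z0)]; lra.
exists (fun c => x ord0 (enum_rank c)); split=> [c|c Pc|k].
- by have := xD (enum_rank c); rewrite /S /= in_itv /= => /andP[].
- have := xD (enum_rank c); rewrite /S /= in_itv /= enum_rankK (negbTE Pc) => /andP[? ?].
  by apply: le_anti; apply/andP.
- have : L k x + `|L k x| <= 0.
    apply: le_trans Fx; rewrite /F (bigD1 k) //= lerDl; by apply: sumr_ge0.
  have := ler_norm (L k x); rewrite /L; lra.
Qed.

(** * Small payoff vectors *)

Definition occ_cycle (V : finType) (e : rel V) (rho : nat -> V) (c : seq V) : Prop :=
  scycle e c /\ forall v, v \in c -> exists k, v = rho k.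

(** The approximate solutions are the multiplicities in the decomposition of the first [n] edges,
    divided by [n]; the simple remainder has bounded weight and disappears in the limit. Compactness
    replaces the extraction of a convergent subsequence. *)
Lemma limit_weights (R : realType) (Pl V : finType) (G : game Pl V) (i : Pl) (a : R)
    (b : Pl -> R) rho :
  is_play G rho -> (forall j, ((b j)%:E <= mp R G j rho)%E) -> (mp R G i rho < a%:E)%E ->
  exists w : bcycle V -> R,
  [/\ (forall c, 0 <= w c) /\ (forall c, w c != 0 -> occ_cycle (edge G) rho c),
      \sum_(c : bcycle V) (size (c : seq V))%:R * w c = 1,
      forall j, 0 <= \sum_(c : bcycle V) csum (gain G j (b j)) c * w c &
      \sum_(c : bcycle V) csum (gain G i a) c * w c <= 0].
Proof.
move=> pl hb ha.
pose P (c : bcycle V) := `[< occ_cycle (edge G) rho c >].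
(* The normalisation is an equality, hence the two opposite rows [None] and [Some None]. *)
pose A (k : option (option (option Pl))) (c : bcycle V) : R :=
  match k with
  | None => (size (c : seq V))%:R
  | Some None => - (size (c : seq V))%:R
  | Some (Some None) => csum (gain G i a) c
  | Some (Some (Some j)) => - csum (gain G j (b j)) c
  end.
pose be (k : option (option (option Pl))) : R :=
  match k with None => 1 | Some None => -1 | _ => 0 end.
have [|w [w0 w1 w2]] := @compact_linear_system R _ _ P A be; last first.
  exists w; split.
  - split=> // c wc; apply/asboolP; apply: contraT => /w1 e; by rewrite e eqxx in wc.
  - apply: le_anti; rewrite (w2 None) /=; have := w2 (Some None); rewrite /A /be /=.
    by under eq_bigr do rewrite mulNr; rewrite sumrN lerN2.
  - move=> j; have := w2 (Some (Some (Some j))); rewrite /A /be /=.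
    by under eq_bigr do rewrite mulNr; rewrite sumrN oppr_le0.
  - exact: (w2 (Some (Some None))).
move=> e e0.
have e2 : 0 < e / 2 by lra.
have [M0 M00 hM0] := finite_bound (gain G i a).
have /choice[M hM] : forall j, exists M : R, 0 <= M /\ forall u v, `|gain G j (b j) u v| <= M.
  by move=> j; have [M ? ?] := finite_bound (gain G j (b j)); exists M.
pose MM : R := 1 + M0 + \sum_j M j.
have sM : 0 <= \sum_j M j by apply: sumr_ge0 => j _; have [] := hM j.
have MMi u v : `|gain G i a u v| <= MM by rewrite (le_trans (hM0 u v)) // /MM; lra.
have MMj j u v : `|gain G j (b j) u v| <= MM.
  have [_ h] := hM j; apply: (le_trans (h u v)).
  rewrite /MM (bigD1 j) //=.
  have : 0 <= \sum_(k | k != j) M k by apply: sumr_ge0 => k _; have [] := hM k.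
  lra.
have MM1 : 1 <= MM by rewrite /MM; lra.
have /choice[n0 hn0] : forall j, exists n0 : nat, forall n, (n0 <= n)%N ->
    - ((e / 2) * n%:R) <= pays (gain G j (b j)) rho n.
  by move=> j; have /mp_geP/(_ _ e2) := hb j.
have [n1 hn1] := archi_bound (MM * #|V|%:R) e2.
(* Dates that are low for player [i] are only infinitely many, whereas the bounds of the other
   players hold from some date on; summing the thresholds yields one date for all. *)
have [n nn npay] := mp_lt ha (1 + n1 + \sum_j n0 j).
have nj j : (n0 j <= n)%N.
  by apply: leq_trans nn; rewrite (bigD1 j) //= addnCA leq_addr.
have {}hn1 := hn1 n ltac:(lia).
have n0' : (0 < n)%N by lia.
have nR : 0 < n%:R :> R by rewrite ltr0n.
have [mult [st [[un _] _ hm hs]]] := cycle_decomposition R n pl.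
have szst : (size st <= #|V|)%N.
  by apply: leq_trans (uniq_size_card un); rewrite size_rcons.
have stb (g : V -> V -> R) : (forall u v, `|g u v| <= MM) -> `|wsum g st (rho n)| <= (e / 2) * n%:R.
  move=> gb; apply: (le_trans (wsum_bound gb _ _)); apply: le_trans hn1.
  by rewrite -[X in X <= _]mulr_natr ler_wpM2l ?ler_nat //; lra.
have sums (g : V -> V -> R) : \sum_(c : bcycle V) csum g c * ((mult c)%:R / n%:R) =
    (pays g rho n - wsum g st (rho n)) / n%:R.
  rewrite hs addrK mulr_suml; apply: eq_bigr => c _; by rewrite mulrA mulr_natr.
have sumsz : \sum_(c : bcycle V) (size (c : seq V))%:R * ((mult c)%:R / n%:R) =
    1 - (size st)%:R / n%:R :> R.
  have := sums (fun _ _ => 1 : R); rewrite pays_const1 wsum_const1 mulrBl divff ?gt_eqF // => <-.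
  by apply: eq_bigr => c _; rewrite csum_const1.
have stn : (size st)%:R / n%:R <= e / 2.
  rewrite ler_pdivrMr //; apply: le_trans hn1; rewrite -[X in X <= _]mul1r ler_pM ?ler_nat //.
exists (fun c => (mult c)%:R / n%:R); split.
- move=> c; rewrite divr_ge0 //= ler_pdivrMr // mul1r.
  case: (posnP (mult c)) => [->|mc] //.
  have [sc _] := hm c mc.
  have sz1 : 1 <= (size (c : seq V))%:R :> R.
    by rewrite (ler_nat _ 1); move: sc; rewrite /scycle; case: (c : seq V).
  have : (size (c : seq V))%:R * ((mult c)%:R / n%:R) <= 1 :> R.
    apply: (@le_trans _ _ (1 - (size st)%:R / n%:R)).
      rewrite -sumsz (bigD1 c) //= lerDl; apply: sumr_ge0 => c' _.
      by rewrite mulr_ge0 // divr_ge0.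
    by rewrite gerBl divr_ge0.
  rewrite mulrA ler_pdivrMr // mul1r; apply: le_trans.
  by rewrite -[X in X <= _]mul1r ler_wpM2r.
- move=> c /asboolPn nP; case: (posnP (mult c)) => [->|mc]; first by rewrite mul0r.
  by case: nP; exact: hm.
- have st0 : 0 <= (size st)%:R / n%:R :> R by rewrite divr_ge0.
  case=> [[[j|]|]|]; rewrite /A /be /=.
  + under eq_bigr do rewrite mulNr.
    rewrite sumrN sums -mulNr ler_pdivrMr // add0r.
    have := hn0 j n (nj j); have := stb _ (MMj j); rewrite ler_norml => /andP[h1 h2]; lra.
  + rewrite sums ler_pdivrMr // add0r.
    have := stb _ MMi; rewrite ler_norml => /andP[h1 h2]; lra.
  + under eq_bigr do rewrite mulNr.
    rewrite sumrN sumsz; lra.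
  + rewrite sumsz; lra.
Qed.

Lemma sum_enum_val (R : nmodType) (T : finType) (F : T -> R) :
  \sum_(k < #|T|) F (enum_val k) = \sum_x F x.
Proof.
by rewrite [RHS](reindex (@enum_val T predT)) //; apply: onW_bij; apply: enum_val_bij.
Qed.

(** A slack variable per player puts the program in equality form. It has [#|Pl|.+1] rows, so the
    bound on [q] involves the number of players but not the number of cycles. *)
Lemma small_weights (R : realType) (C Pl : finType) (len : C -> nat) (T : Pl -> C -> int)
    (B : Pl -> int) (K : nat) (obj w : C -> R) :
  (forall c, 0 < len c <= K)%N -> (0 < K)%N -> (forall j c, `|T j c| <= K%:Z) ->
  (forall c, 0 <= w c) -> \sum_c (len c)%:R * w c = 1 ->
  (forall j, (B j)%:~R <= \sum_c (T j c)%:~R * w c) ->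
  exists (q : nat) (p : C -> nat),
  [/\ (0 < q)%N /\ (q <= (#|Pl|.+1)`! * K ^ (#|Pl|.+1))%N, forall c, p c != 0%N -> w c != 0,
      (\sum_c len c * p c)%N = q, forall j, B j * q%:Z <= \sum_c T j c * (p c)%:Z &
      \sum_c obj c * (p c)%:R <= q%:R * \sum_c obj c * w c].
Proof.
move=> hl K0 hT w0 w1 wB.
pose aent (r : option Pl) (x : C + Pl) : int :=
  match r, x with
  | None, inl c => (len c)%:Z
  | None, inr _ => 0
  | Some j, inl c => T j c
  | Some j, inr j' => - (j == j')%:Z
  end.
pose bent (r : option Pl) : int := if r is Some j then B j else 1.
pose yent (x : C + Pl) : R :=
  match x with inl c => w c | inr j => \sum_c (T j c)%:~R * w c - (B j)%:~R end.
pose oent (x : C + Pl) : R := if x is inl c then obj c else 0.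
pose A : 'M[int]_(#|{: option Pl}|, #|{: C + Pl}|) := \matrix_(r, k) aent (enum_val r) (enum_val k).
pose b : 'cV[int]_#|{: option Pl}| := \col_r bent (enum_val r).
pose y : 'cV[R]_#|{: C + Pl}| := \col_k yent (enum_val k).
pose o : 'rV[R]_#|{: C + Pl}| := \row_k oent (enum_val k).
have Arow (z : C + Pl -> R) r : \sum_x (aent r x)%:~R * z x =
    if r is Some j then \sum_c (T j c)%:~R * z (inl c) - z (inr j)
    else \sum_c (len c)%:R * z (inl c).
  rewrite big_sumType /=; case: r => [j|] /=; last first.
    by rewrite [X in _ + X]big1 ?addr0 // => j _; rewrite mul0r.
  congr (_ + _); rewrite (bigD1 j) //= eqxx mulrN1z mulN1r big1 ?addr0 // => j' /negbTE.
  by rewrite eq_sym => ->; rewrite oppr0 mul0r.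
have Amul (z : C + Pl -> R) r : (map_mx intr A *m (\col_k z (enum_val k))) r 0 =
    \sum_x (aent (enum_val r) x)%:~R * z x.
  rewrite mxE -(sum_enum_val (fun x => (aent (enum_val r) x)%:~R * z x)); by apply: eq_bigr => k _; rewrite !mxE.
have colE (d : 'cV[R]_#|{: C + Pl}|) : d = \col_k (d (enum_rank (enum_val k)) 0).
  by apply/colP => k; rewrite mxE enum_valK.
have Amul' (d : 'cV[R]_#|{: C + Pl}|) r : (map_mx intr A *m d) (enum_rank r) 0 =
    if r is Some j then \sum_c (T j c)%:~R * d (enum_rank (inl c)) 0 - d (enum_rank (inr j)) 0
    else \sum_c (len c)%:R * d (enum_rank (inl c)) 0.
  by rewrite {1}[d]colE (Amul (fun x => d (enum_rank x) 0)) enum_rankK Arow.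
(* Positive lengths in the normalisation row force the cycle coordinates to be zero, and then each
   player's row forces its slack to be zero. *)
have bnd (d : 'cV[R]_#|{: C + Pl}|) : map_mx intr A *m d = 0 -> (forall k, 0 <= d k 0) -> d = 0.
  move=> Ad d0.
  have dc c : d (enum_rank (inl c)) 0 = 0.
    have := Amul' d None; rewrite Ad mxE => /esym/psumr_eq0P.
    move=> /(_ (fun c _ => mulr_ge0 (ler0n _ _) (d0 _))) /(_ c isT)/eqP.
    rewrite mulf_eq0 pnatr_eq0 => /orP[/eqP l0|/eqP //].
    by have := hl c; rewrite l0.
  apply/colP => k; rewrite mxE -[k]enum_valK; case: (enum_val k) => [c|j]; first exact: dc.
  have := Amul' d (Some j); rewrite Ad mxE big1 => [/esym/eqP|c _]; last by rewrite dc mulr0.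
  by rewrite sub0r oppr_eq0 => /eqP.
have Ay : map_mx intr A *m y = map_mx intr b.
  apply/colP => r; rewrite Amul Arow !mxE; case: (enum_val r) => [j|] //=.
  by rewrite opprB addrC subrK.
have y0 k : 0 <= y k 0.
  by rewrite mxE; case: (enum_val k) => [c|j] //=; rewrite subr_ge0.
have [z [Az z0 sz oz iz]] := basic_solution o bnd Ay y0.
have hA r k : `|A r k| <= K%:Z.
  rewrite mxE; case: (enum_val r) => [j|]; case: (enum_val k) => [c|j'] //=.
  - by rewrite normrN; case: (_ == _); rewrite ?normr0 ?normr1 lez_nat.
  - by have /andP[_] := hl c; rewrite -lez_nat ger0_norm.
have [q [p [q0 qb pz]]] := cramer_solution K0 hA Az z0 iz.
rewrite card_option in qb.
have qR : 0 < q%:R :> R by rewrite ltr0n.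
exists q, (fun c => p (enum_rank (inl c))); split=> //.
- move=> c; rewrite -(@pnatr_eq0 R) -pz mulf_eq0 negb_or => /andP[zc _].
  by have := fintype.subsetP sz (enum_rank (inl c)); rewrite !inE mxE enum_rankK; apply.
- apply/eqP; rewrite -(@eqr_nat R) natr_sum.
  have := Amul' z None; rewrite Az !mxE enum_rankK /= mulr1z => e.
  have -> : q%:R = (\sum_c (len c)%:R * z (enum_rank (inl c)) 0) * q%:R by rewrite -e mul1r.
  by rewrite mulr_suml; apply/eqP/eq_bigr => c _; rewrite natrM -pz mulrA.
- move=> j; have := Amul' z (Some j); rewrite Az !mxE enum_rankK /= => e.
  rewrite -(@ler_int R) rmorphM /= rmorph_sum /= e mulrBl mulr_suml.
  under [X in _ <= X]eq_bigr do rewrite rmorphM /= -[(_%:Z)%:~R]/(_%:R) -pz mulrA.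
  by rewrite gerBl mulr_ge0.
- have oE (v : C + Pl -> R) : (o *m \col_k v (enum_val k)) 0 0 = \sum_c obj c * v (inl c).
    rewrite mxE (eq_bigr (fun k => oent (enum_val k) * v (enum_val k))); last by move=> k _; rewrite !mxE.
    by rewrite (sum_enum_val (fun x => oent x * v x)) big_sumType /= [X in _ + X]big1 ?addr0 // => j _; rewrite mul0r.
  move: oz; rewrite {1}[z]colE (oE (fun x => z (enum_rank x) 0)) oE /= => oz.
  under eq_bigr do rewrite -pz mulrA.
  by rewrite -mulr_suml mulrC ler_pM2l.
Qed.

(** * Infinite plays glued from finite segments *)

Lemma wpath_nth (V : finType) (e : rel V) s x d k : wpath e s x -> (k.+1 < size s)%N ->
  e (nth d s k) (nth d s k.+1).
Proof.
elim: s k => [|y s IH] [|k] //= /andP[h1 h2] h3; last exact: IH.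
by case: s h1 h3 {IH h2}.
Qed.

Section ChainLimit.
Context (V : finType) (d : V) (p s : nat -> seq V).
Hypotheses (p0 : p 0%N = [::]) (pS : forall n, p n.+1 = p n ++ s n) (s0 : forall n, s n != [::]).

(** Segments are nonempty, so [p k.+1] has more than [k] vertices and the default [d] is never
    read. *)
Definition chain_lim (k : nat) : V := nth d (p k.+1) k.

Lemma chain_size n : (n <= size (p n))%N.
Proof.
elim: n => // n IH; rewrite pS size_cat -addn1 leq_add // lt0n size_eq0; exact: s0.
Qed.

Lemma chain_cat m n : (m <= n)%N -> exists t, p n = p m ++ t.
Proof.
elim: n => [|n IH]; first by rewrite leqn0 => /eqP ->; exists [::]; rewrite cats0.
rewrite leq_eqVlt => /orP[/eqP ->|]; first by exists [::]; rewrite cats0.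
by rewrite ltnS => /IH[t e]; exists (t ++ s n); rewrite pS e catA.
Qed.

Lemma chain_lim_nth n k : (k < size (p n))%N -> chain_lim k = nth d (p n) k.
Proof.
move=> lk; rewrite /chain_lim; case: (leqP n k.+1) => h.
  by have [t ->] := chain_cat h; rewrite nth_cat lk.
by have [t ->] := chain_cat (ltnW h); rewrite nth_cat (chain_size k.+1).
Qed.

Lemma mkseq_chain_lim n : mkseq chain_lim (size (p n)) = p n.
Proof.
apply: (@eq_from_nth _ d); rewrite size_mkseq // => k lk.
by rewrite nth_mkseq // (chain_lim_nth lk).
Qed.

Lemma chain_lim_segment n k : (k < size (s n))%N -> chain_lim (size (p n) + k) = nth d (s n) k.
Proof.
move=> lk; rewrite (@chain_lim_nth n.+1) pS ?size_cat ?ltn_add2l //.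
by rewrite nth_cat ltnNge leq_addr /= addKn.
Qed.

Lemma chain_lim_head n : chain_lim (size (p n)) = head d (s n).
Proof.
have := @chain_lim_segment n 0; rewrite addn0 nth0; apply.
by rewrite lt0n size_eq0.
Qed.

Lemma chain_locate t : exists n, (size (p n) <= t < size (p n.+1))%N.
Proof.
have ex : exists n, (t < size (p n))%N by exists t.+1; apply: chain_size.
case: (ex_minnP ex) => [[|n] hn nmin]; first by rewrite p0 in hn.
exists n; rewrite hn andbT leqNgt; apply/negP => h; have := nmin _ h; by rewrite ltnn.
Qed.

Lemma chain_mono m n : (m <= n)%N -> (size (p m) <= size (p n))%N.
Proof. by move=> /chain_cat[t ->]; rewrite size_cat leq_addr. Qed.

Lemma chain_pays (R : nmodType) (g : V -> V -> R) n :
  pays g chain_lim (size (p n)) = wsum g (p n) (head d (s n)).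
Proof. by rewrite -wsum_mkseq mkseq_chain_lim chain_lim_head. Qed.

Lemma chain_wsumS (R : nmodType) (g : V -> V -> R) n :
  wsum g (p n.+1) (head d (s n.+1)) =
  wsum g (p n) (head d (s n)) + wsum g (s n) (head d (s n.+1)).
Proof. by rewrite pS wsum_cat; have := s0 n; case: (s n). Qed.

Lemma chain_play (e : rel V) : (forall n, wpath e (s n) (head d (s n.+1))) ->
  forall k, e (chain_lim k) (chain_lim k.+1).
Proof.
move=> ws k.
have wp n : wpath e (p n) (head d (s n)).
  elim: n => [|n IH]; first by rewrite p0.
  by rewrite pS wpath_cat ws andbT; have := s0 n; case: (s n) IH.
rewrite (@chain_lim_nth k.+2); last by rewrite (leq_trans _ (chain_size _)).
rewrite (@chain_lim_nth k.+2); last exact: chain_size.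
apply: wpath_nth (wp _) _; exact: chain_size.
Qed.

End ChainLimit.

Lemma gainE (R : realType) (Pl V : finType) (G : game Pl V) j (a : R) s x :
  wsum (gain G j a) s x = ratr (wsum (reward G j) s x) - a *+ size s.
Proof.
elim: s => [|y s IH] /=; first by rewrite rmorph0 mulr0n subr0.
by rewrite IH rmorphD /= /gain mulrS; ring.
Qed.

Lemma csum_gain (R : realType) (Pl V : finType) (G : game Pl V) j (a : R) c :
  csum (gain G j a) c = ratr (csum (reward G j) c) - a *+ size c.
Proof. by case: c => [|x c]; rewrite /csum ?gainE // rmorph0 subr0. Qed.

Lemma size_ncat (V : finType) n (c : seq V) : size (ncat n c) = (n * size c)%N.
Proof. by elim: n => //= n IH; rewrite size_cat IH mulSn. Qed.

Lemma mem_ncat (V : finType) n (c : seq V) v : v \in ncat n c -> v \in c.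
Proof. by elim: n => //= n IH; rewrite mem_cat => /orP[|/IH]. Qed.

Section Realization.
Context (R : realType) (Pl V : finType) (G : game Pl V) (rho : nat -> V).
Context (p : bcycle V -> nat) (q : nat).
Hypotheses (pl : is_play G rho) (rec : forall m k, exists2 k', (k <= k')%N & rho k' = rho m).
Hypothesis pocc : forall c, p c != 0%N -> occ_cycle (edge G) rho c.
Hypotheses (pq : (\sum_(c : bcycle V) size (c : seq V) * p c)%N = q) (q0 : (0 < q)%N).

Definition cycle_average j : rat := (\sum_(c : bcycle V) (csum (reward G j) c *+ p c)) / q%:R.

Let b := rho 0%N.

(* Each cycle [c] is reached from [b] by [uv.1] and left back to [b] by [uv.2]. *)
Let connect c : exists uv : seq V * seq V, p c != 0%N ->
  [/\ wpath (edge G) uv.1 (head b c), head (head b c) uv.1 = b,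
      wpath (edge G) uv.2 b, head b uv.2 = head b c &
      forall v, v \in uv.1 ++ uv.2 -> exists k, v = rho k].
Proof.
case: (eqVneq (p c) 0%N) => [_|pc]; first by exists ([::], [::]).
have [sc oc] := pocc pc.
have [x [t ct]] : exists x t, (c : seq V) = x :: t.
  by move: sc; case: (c : seq V) => [|x t] // _; exists x, t.
have [k xk] : exists k, x = rho k by apply: oc; rewrite ct inE eqxx.
have [k' kk' k'b] := rec 0 k.
exists (mkseq rho k, mkseq (suffix_from rho k) (k' - k)) => _; rewrite ct /= xk; split.
- by apply: wpath_mkseq.
- by case: (k).
- rewrite /b -k'b -{2}(subnKC kk'); apply: wpath_mkseq => l.
  by rewrite /suffix_from addnS; apply: pl.
- move: kk' k'b; rewrite leq_eqVlt => /orP[/eqP ->|]; first by rewrite subnn /= => ->.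
  by rewrite -subn_gt0; case: (k' - k)%N => //= l _ _; rewrite /suffix_from addn0.
- move=> v; rewrite mem_cat => /orP[] /mapP[l _ ->]; first by exists l.
  by exists (k + l)%N.
Qed.

Let uv := projT1 (choice connect).
Let uvP := projT2 (choice connect).

(** Laps grow linearly with the round while the connecting paths stay fixed: after [n] rounds
    transit takes a time linear in [n] and the laps a quadratic one, so transit vanishes in the
    average. *)
Let blk (m : nat) (c : bcycle V) : seq V :=
  if p c == 0%N then [::] else (uv c).1 ++ ncat (m * p c) c ++ (uv c).2.

Let round (m : nat) : seq V := flatten [seq blk m.+1 c | c <- enum {: bcycle V}].

Let pre (n : nat) : seq V := flatten [seq round m.+1 | m <- iota 0 n].

Let blk_cycle c : p c != 0%N -> exists x t, (c : seq V) = x :: t /\ wpath (edge G) c x.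
Proof.
move=> /pocc[+ _]; case e : (c : seq V) => [|x t] //= /andP[_ w]; by exists x, t; rewrite -e.
Qed.

Let blk_mid_head m (c : bcycle V) x t : (c : seq V) = x :: t -> p c != 0%N ->
  head b (ncat (m.+1 * p c) c ++ (uv c).2) = x.
Proof.
move=> ct; rewrite -lt0n ct => pc; have : (0 < m.+1 * p c)%N by rewrite muln_gt0 pc.
by case: (m.+1 * p c)%N.
Qed.

Let blk_head m c y : blk m.+1 c ++ y = [::] \/ p c = 0%N \/ head b (blk m.+1 c ++ y) = b.
Proof.
rewrite /blk; case: eqP => [|/eqP pc]; first by right; left.
right; right; have [x [t [ct _]]] := blk_cycle pc; have [_ h _ _ _] := uvP pc.
rewrite -/uv in h; move: h; rewrite ct; case: ((uv c).1) => [|z u'] //=.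
have : (0 < m.+1 * p c)%N by rewrite muln_gt0 /= lt0n.
by case: (m.+1 * p c)%N.
Qed.

Let blk_wpath m c : wpath (edge G) (blk m.+1 c) b.
Proof.
rewrite /blk; case: eqP => // /eqP pc; have [x [t [ct wc]]] := blk_cycle pc.
have [h1 h2 h3 h4 _] := uvP pc; rewrite -/uv in h1 h2 h3 h4.
rewrite wpath_cat (blk_mid_head _ ct pc) wpath_cat h4 h3 andbT.
move: h1; rewrite ct /= => -> /=; apply: wpath_ncat; by rewrite -ct.
Qed.

Let blk_wsum (S : nmodType) (g : V -> V -> S) m c : wsum g (blk m.+1 c) b =
  wsum g (blk 1 c) b + csum g c *+ (m * p c).
Proof.
rewrite /blk; case: eqP => [->|/eqP pc]; first by rewrite muln0 mulr0n addr0.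
have [x [t [ct wc]]] := blk_cycle pc.
have [h1 h2 h3 h4 _] := uvP pc; rewrite -/uv in h1 h2 h3 h4.
have hb : head b c = x by rewrite ct.
have wn k : wsum g (ncat k c) x = csum g c *+ k by rewrite ct wsum_ncat.
rewrite !wsum_cat !(blk_mid_head _ ct pc) h4 hb !wn mul1n mulSn mulrnDr.
by rewrite -!addrA; congr (_ + (_ + _)); rewrite addrC.
Qed.

Let blks_head m (l : seq (bcycle V)) : head b (flatten [seq blk m.+1 c | c <- l]) = b.
Proof.
elim: l => //= c l IH; have [|[pc|//]] := blk_head m c (flatten [seq blk m.+1 c | c <- l]).
  by move=> ->.
by rewrite /blk pc eqxx.
Qed.

Let round_head m : head b (round m) = b.
Proof. exact: blks_head. Qed.

Let round_wpath m : wpath (edge G) (round m) b.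
Proof.
rewrite /round; elim: (enum _) => //= c l IH.
by rewrite wpath_cat blks_head blk_wpath.
Qed.

Let round_wsum (S : nmodType) (g : V -> V -> S) m : wsum g (round m) b =
  wsum g (round 0) b + (\sum_(c : bcycle V) csum g c *+ p c) *+ m.
Proof.
have rE k : wsum g (round k) b = \sum_(c : bcycle V) wsum g (blk k.+1 c) b.
  rewrite /round -big_enum; elim: (enum _) => /= [|c l IH]; first by rewrite big_nil.
  by rewrite wsum_cat blks_head IH big_cons.
rewrite !rE (eq_bigr _ (fun c _ => blk_wsum g m c)) big_split /=; congr (_ + _).
by rewrite -sumrMnl; apply: eq_bigr => c _; rewrite mulnC mulrnA.
Qed.

Let round_size m : size (round m) = (size (round 0) + q * m)%N.
Proof.
apply/eqP; rewrite -(eqr_nat int) natrD natrM -!(wsum_const1 int _ b) round_wsum mulr_natr -pq.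
rewrite natr_sum; apply/eqP; congr (_ + _ *+ m); apply: eq_bigr => c _.
by rewrite csum_const1 natrM mulr_natr.
Qed.

Let round_neq0 m : round m.+1 != [::].
Proof. by rewrite -size_eq0 round_size -lt0n ltn_addl // muln_gt0 q0. Qed.

Let preS n : pre n.+1 = pre n ++ round n.+1.
Proof. by rewrite /pre -[in LHS]addn1 iotaD map_cat flatten_cat /= cats0. Qed.

Let pre_size n : (n * n.+1 <= 2 * size (pre n))%N.
Proof.
elim: n => // n IH; rewrite preS size_cat round_size mulnDr.
have : (n.+1 <= q * n.+1)%N by rewrite leq_pmull.
by lia.
Qed.

Let round_occ m v : v \in round m -> exists k, v = rho k.
Proof.
move=> /flattenP[_ /mapP[c _ ->]]; rewrite /blk; case: eqP => // /eqP pc.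
have [_ _ _ _ h5] := uvP pc; rewrite -/uv in h5.
rewrite mem_cat => /orP[h|]; first by apply: h5; rewrite mem_cat h.
rewrite mem_cat => /orP[/mem_ncat h|h]; last by apply: h5; rewrite mem_cat h orbT.
by have [_] := pocc pc; apply.
Qed.

(** With rewards centred at the target average, the laps of a round sum to zero; each round
    therefore contributes only the constant [kap], the weight of [round 0]. *)
Lemma realize_average : exists rho' : nat -> V,
  [/\ is_play G rho', rho' 0%N = rho 0%N, forall k, exists m, rho' k = rho m &
      forall j, mp R G j rho' = (ratr (cycle_average j) : R)%:E].
Proof.
have p0 : pre 0 = [::] by [].
pose rs n := round n.+1.
have hd n : head b (rs n) = b by apply: round_head.
exists (chain_lim b pre); split.
- by apply: (chain_play p0 preS round_neq0) => n; rewrite hd; apply: round_wpath.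
- by have := chain_lim_head b preS round_neq0 0; rewrite p0 /= hd.
- move=> k; have /mem_nth : (k < size (pre k.+1))%N := chain_size preS round_neq0 k.+1.
  by move=> /(_ b)/flattenP[_ /mapP[m _ ->]] /round_occ.
move=> j; set x : R := ratr (cycle_average j); set g := gain G j x.
have [M M0 gM] := finite_bound g.
have cyc0 : \sum_(c : bcycle V) csum g c *+ p c = 0.
  have -> : \sum_(c : bcycle V) csum g c *+ p c =
      ratr (\sum_(c : bcycle V) csum (reward G j) c *+ p c) - x * q%:R.
    rewrite -pq natr_sum rmorph_sum /= mulr_sumr -sumrB; apply: eq_bigr => c _.
    by rewrite /g csum_gain mulrnBl rmorphMn /=; congr (_ - _); rewrite natrM mulrA !mulr_natr.
  rewrite /x /cycle_average rmorphM /= fmorphV /= ratr_nat divfK ?subrr //.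
  by rewrite pnatr_eq0 -lt0n.
pose kap := wsum g (round 0) b.
have wpre n : wsum g (pre n) b = kap *+ n.
  elim: n => [|n IH]; first by rewrite mulr0n.
  have := chain_wsumS b preS round_neq0 g n; rewrite !round_head IH => ->.
  by rewrite round_wsum cyc0 mul0rn addr0 mulrSr.
pose A : R := `|kap| + M * (size (round 0) + q)%:R.
have A0 : 0 <= A by rewrite addr_ge0 // mulr_ge0.
apply: mp_eq => e e0; have [n0 hn0] := archi_bound (2 * A) e0.
exists (size (pre n0)) => t lt.
have [n /andP[n1 n2]] := chain_locate p0 preS round_neq0 t.
have nn0 : (n0 <= n)%N.
  rewrite leqNgt; apply/negP => h; have := chain_mono preS h; lia.
have {}hn0 := hn0 n nn0.
have rsz : (t - size (pre n) <= (size (round 0) + q) * n.+1)%N.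
  have : (t - size (pre n) <= size (round n.+1))%N by move: n2; rewrite preS size_cat; lia.
  move/leq_trans; apply; rewrite round_size mulnDl leq_add2r; exact: leq_pmulr.
have szR : n%:R * n.+1%:R <= 2 * (size (pre n))%:R :> R.
  by rewrite -!natrM ler_nat pre_size.
have tR : (size (pre n))%:R <= t%:R :> R by rewrite ler_nat.
have -> : pays g (chain_lim b pre) t =
    kap *+ n + pays g (suffix_from (chain_lim b pre) (size (pre n))) (t - size (pre n)).
  by rewrite -{1}(subnKC n1) paysD (chain_pays b preS round_neq0) round_head wpre.
apply: (le_trans (ler_normD _ _)).
(* Finished rounds and the current one together cost at most [A * n.+1], while the date is at least
   half of [n * n.+1]. *)
apply: (@le_trans _ _ (A * n.+1%:R)).
  rewrite /A mulrDl lerD //.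
    by rewrite normrMn -[X in X <= _]mulr_natr ler_wpM2l // ler_nat.
  apply: (le_trans (pays_bound gM _ _)); rewrite -[X in X <= _]mulr_natr -mulrA ler_wpM2l //.
  by rewrite -natrM ler_nat.
have n1R : 0 <= n.+1%:R :> R by [].
have := ler_wpM2r n1R hn0; rewrite -[e * n%:R * _]mulrA => h1.
have := ler_wpM2l (ltW e0) (le_trans szR (ler_wpM2l (ler0n R 2) tR)) => h2.
lra.
Qed.

End Realization.

(** * Sizes of rationals and common denominators *)

Lemma absz_numq_le (r : rat) : (absz (numq r) <= 2 ^ rat_size r)%N.
Proof.
rewrite /rat_size (leq_trans (leqnSn _)) // (leq_trans (@up_logP 2 _ isT)) // leq_pexp2l //; lia.
Qed.

Lemma absz_denq_le (r : rat) : (absz (denq r) <= 2 ^ rat_size r)%N.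
Proof.
rewrite /rat_size (leq_trans (leqnSn _)) // (leq_trans (@up_logP 2 _ isT)) // leq_pexp2l //; lia.
Qed.

Lemma normr_le_numq (r : rat) : `|r| <= (absz (numq r))%:R.
Proof.
rewrite -{1}[r]divq_num_den normrM normfV natr_absz -intr_norm ler_pdivrMr ?normr_gt0 ?intr_eq0 //.
rewrite ler_peMr ?normr_ge0 //.
by rewrite -intr_norm -[1]/(1%:~R) ler_int -gtz0_ge1 normr_gt0.
Qed.

(** The reduced denominator divides every integer that clears the fraction. *)
Lemma denq_le (x : rat) (d : nat) (z : int) : (0 < d)%N -> x * d%:R = z%:~R ->
  (absz (denq x) <= d)%N.
Proof.
move=> d0 e; apply: dvdn_leq => //.
have h : numq x * d%:Z = z * denq x.
  apply/eqP; rewrite -(eqr_int rat) !rmorphM /= -e -[d%:~R]/(d%:R) -[X in _ == X]mulrA mulrC.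
  rewrite [in X in _ == X]mulrC -mulrA; apply/eqP; congr (_ * _).
  by rewrite mulrC -numqE.
have : (absz (denq x) %| absz (numq x) * d)%N.
  by rewrite -[d in X in (_ %| X)%N]absz_nat -abszM h abszM dvdn_mull.
by rewrite Gauss_dvdr // coprime_sym coprime_num_den.
Qed.

Lemma rat_size_le (x : rat) (s t : nat) :
  (absz (numq x) <= 2 ^ s)%N -> (absz (denq x) <= 2 ^ t)%N -> (rat_size x <= s + t + 3)%N.
Proof.
move=> hs ht; rewrite /rat_size.
have h1 : (up_log 2 (absz (numq x)).+1 <= s.+1)%N.
  by apply: up_log_min => //; rewrite expnS mul2n -addnn -addn1 leq_add // expn_gt0.
have h2 : (up_log 2 (absz (denq x)).+1 <= t.+1)%N.
  by apply: up_log_min => //; rewrite expnS mul2n -addnn -addn1 leq_add // expn_gt0.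
lia.
Qed.

Lemma fact_leq_expn n : (n`! <= n ^ n)%N.
Proof.
elim: n => // n IH; rewrite factS expnS leq_mul // (leq_trans IH) //.
by case: n {IH} => // n; rewrite leq_exp2r.
Qed.

Section GameBounds.
Context (Pl V : finType) (G : game Pl V) (lam : V -> \bar rat).

Let n := (game_size G + req_size lam)%N.

Lemma rat_size_le_game j u v : edge G u v -> (rat_size (reward G j u v) <= n)%N.
Proof.
move=> uv; rewrite /n /game_size (bigD1 (u, v)) //= /tuple_size (bigD1 j) //=; lia.
Qed.

Lemma reward_bound j u v : edge G u v -> `|reward G j u v| <= (2 ^ n)%:R.
Proof.
move=> uv; apply: (le_trans (normr_le_numq _)); rewrite ler_nat.
by apply: (leq_trans (absz_numq_le _)); rewrite leq_exp2l // rat_size_le_game.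
Qed.

Definition req_den (v : V) : nat := if lam v is EFin r then absz (denq r) else 1%N.

(** A plain product is small enough: each denominator is at most 2 to the power of its own size, and
    these sizes add up inside [n]. It is restricted to edges because [game_size] measures rewards on
    edges alone. *)
Definition common_den : nat :=
  ((\prod_(e : V * V | edge G e.1 e.2) \prod_j absz (denq (reward G j e.1 e.2))) *
  \prod_v req_den v)%N.

Let denq_absz_gt0 (r : rat) : (0 < absz (denq r))%N.
Proof. by rewrite absz_gt0 denq_neq0. Qed.

Let req_den_gt0 v : (0 < req_den v)%N.
Proof. by rewrite /req_den; case: (lam v). Qed.

Lemma common_den_gt0 : (0 < common_den)%N.
Proof.
by rewrite muln_gt0 !prodn_gt0 // => e; rewrite prodn_gt0.
Qed.

Lemma common_den_le : (common_den <= 2 ^ n)%N.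
Proof.
rewrite /n expnD leq_mul //.
- apply: (@leq_trans (\prod_(e : V * V | edge G e.1 e.2)
      2 ^ tuple_size (fun j => reward G j e.1 e.2))).
    apply: leq_prod => e _; rewrite /tuple_size expnD -[X in (X <= _)%N]mul1n leq_mul ?expn_gt0 //.
    rewrite expn_sum; apply: leq_prod => j _; exact: absz_denq_le.
  by rewrite -expn_sum leq_exp2l // leq_addl.
- rewrite /req_size expnD -[X in (X <= _)%N]mul1n leq_mul ?expn_gt0 // expn_sum.
  apply: leq_prod => v _; rewrite /req_den /erat_size; case: (lam v) => [r||] //.
  exact: absz_denq_le.
Qed.

Lemma common_den_reward j u v : edge G u v ->
  exists z : int, reward G j u v * common_den%:R = z%:~R.
Proof.
move=> uv; have /dvdnP[k e] : (absz (denq (reward G j u v)) %| common_den)%N.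
  rewrite /common_den dvdn_mulr // (bigD1 (u, v)) //= dvdn_mulr // (bigD1 j) //=.
  exact: dvdn_mulr.
exists (numq (reward G j u v) * k%:Z); rewrite e natrM natr_absz rmorphM /= mulrCA.
by rewrite gtr0_norm ?denq_gt0 // mulrC -numqE.
Qed.

Lemma common_den_req v r : lam v = r%:E -> exists z : int, r * common_den%:R = z%:~R.
Proof.
move=> e; have /dvdnP[k e'] : (absz (denq r) %| common_den)%N.
  by rewrite /common_den dvdn_mull // (bigD1 v) //= dvdn_mulr // /req_den e.
exists (numq r * k%:Z); rewrite e' natrM natr_absz rmorphM /= mulrCA.
by rewrite gtr0_norm ?denq_gt0 // mulrC -numqE.
Qed.

Lemma card_players_lt (v0 : V) : (#|Pl|.+1 <= n)%N.
Proof.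
have : (0 < #|V|)%N by apply/card_gt0P; exists v0.
rewrite /n /game_size; lia.
Qed.

Lemma card_vertices_le : (#|V| <= 2 ^ n)%N.
Proof.
apply: (@leq_trans n); last exact/ltnW/ltn_expl.
rewrite /n /game_size; lia.
Qed.

Lemma wsum_reward_int j s x : wpath (edge G) s x ->
  exists z : int, wsum (reward G j) s x * common_den%:R = z%:~R.
Proof.
elim: s => [_|y s IH /= /andP[/(common_den_reward j)[z1 e1] /IH[z2 e2]]].
  by exists 0; rewrite mul0r.
by exists (z1 + z2); rewrite mulrDl e1 e2 rmorphD.
Qed.

Lemma wsum_reward_bound j s x : wpath (edge G) s x ->
  `|wsum (reward G j) s x| <= (2 ^ n)%:R *+ size s.
Proof.
elim: s => [_|y s IH /= /andP[/(reward_bound j) e1 /IH e2]]; first by rewrite normr0.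
by rewrite mulrS (le_trans (ler_normD _ _)) // lerD.
Qed.

End GameBounds.

Lemma finite_nat_bound (T : finType) (P : T -> nat -> Prop) :
  (forall t, exists n0, forall n, (n0 <= n)%N -> P t n) ->
  exists n0, forall t n, (n0 <= n)%N -> P t n.
Proof.
move=> /choice[f hf]; exists (\sum_t f t)%N => t n hn; apply: hf; apply: leq_trans hn.
by rewrite (bigD1 t) //= leq_addr.
Qed.

(** Each of the finitely many vertices either recurs forever or has a last visit; [k0] lies beyond
    all last visits. *)
Lemma eventually_recurrent (V : finType) (rho : nat -> V) :
  exists k0, forall m k, (k0 <= m)%N -> exists2 k', (k <= k')%N & rho k' = rho m.
Proof.
have [|k0 hk] := @finite_nat_bound V (fun v n => rho n = v ->
    forall k, exists2 k', (k <= k')%N & rho k' = v).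
  move=> v; case: (pselect (forall k, exists2 k', (k <= k')%N & rho k' = v)) => h.
    by exists 0%N.
  move/existsNP: h => [k hk]; exists k => n kn e; case: hk; by exists n.
by exists k0 => m k hm; apply: (hk _ m).
Qed.

Definition occ_from (V : finType) (rho : nat -> V) (k : nat) : {set V} :=
  [set v | `[< exists m, rho (k + m)%N = v >]].

Lemma occ_fromP (V : finType) (rho : nat -> V) k v :
  reflect (exists m, rho (k + m)%N = v) (v \in occ_from rho k).
Proof. by rewrite inE; apply: asboolP. Qed.

Section FinitePayoff.
Context (R : realType) (Pl V : finType) (G : game Pl V).

Lemma mp_lb j rho (c : rat) : is_play G rho -> (forall u v, edge G u v -> c <= reward G j u v) ->
  ((ratr c : R)%:E <= mp R G j rho)%E.
Proof.
move=> pl h; apply/mp_geP => e e0; exists 0%N => n _.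
apply: (@le_trans _ _ 0); first by rewrite oppr_le0 mulr_ge0 // ltW.
by apply: sumr_ge0 => k _; rewrite subr_ge0 ler_rat h // pl.
Qed.

Lemma mp_lty j rho : (mp R G j rho < +oo)%E.
Proof.
have [M M0 hM] := finite_bound (gain G j (0 : R)).
apply: (@le_lt_trans _ _ M%:E); last exact: ltry.
apply: mp_le => e e0 n0; exists n0 => //.
apply: (@le_trans _ _ 0); last by rewrite mulr_ge0 // ltW.
apply: sumr_le0 => k _; have := hM (rho k) (rho k.+1); rewrite /gain subr0 ler_norml => /andP[_].
lra.
Qed.

(** The linear program needs one finite rational bound per player. The value [c] stands in when all
    requirements met are [-oo], and [+oo] is excluded by the finiteness of [mu]. *)
Lemma max_requirement (lam : V -> \bar rat) (mu : \bar R) (c : rat) (s : seq V) :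
  (mu < +oo)%E -> ((ratr c : R)%:E <= mu)%E -> (forall v, v \in s -> (er2R R (lam v) <= mu)%E) ->
  exists b : rat, [/\ b = c \/ exists2 v, v \in s & lam v = b%:E, ((ratr b : R)%:E <= mu)%E &
    forall v, v \in s -> (er2R R (lam v) <= (ratr b : R)%:E)%E].
Proof.
move=> muy cmu; elim: s => [|v s IH] hs; first by exists c; split=> //; left.
have [|b [hb bmu bs]] := IH; first by move=> w ws; apply: hs; rewrite inE ws orbT.
have hb' : b = c \/ exists2 w, w \in v :: s & lam w = b%:E.
  by case: hb => [|[w ws e]]; [left|right; exists w => //; rewrite inE ws orbT].
have := hs v; rewrite inE eqxx => /(_ isT) vmu.
case lv : (lam v) => [r||].
- case: (leP r b) => rb.
    exists b; split=> // w; rewrite inE => /orP[/eqP ->|/bs //].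
    by rewrite lv /= lee_fin ler_rat.
  exists r; split; first by right; exists v; rewrite ?inE ?eqxx.
    by rewrite lv in vmu.
  move=> w; rewrite inE => /orP[/eqP ->|/bs h]; first by rewrite lv.
  by apply: (le_trans h); rewrite lee_fin ler_rat ltW.
- by move: vmu; rewrite lv /= leye_eq => /eqP e; rewrite e in muy.
- by exists b; split=> // w; rewrite inE => /orP[/eqP ->|/bs //]; rewrite lv leNye.
Qed.

End FinitePayoff.

(** With [n] the input size, the denominator [q] is at most [2 ^ (4 n^2)] and [D * q] at most
    [2 ^ (4 n^2 + n)]. Averages are at most [2 ^ n], so numerators have [n] bits more. With 3 for
    rounding and 1 for the tuple entry this gives the bracket; the factor [n] covers the players. *)
Definition size_bound (n : nat) : nat := (n * (8 * n ^ 2 + 3 * n + 4))%N.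

Section SmallPayoff.
Context (R : realType) (Pl V : finType) (G : game Pl V) (lam : V -> \bar rat).

Let n := (game_size G + req_size lam)%N.
Let D := common_den G lam.

Lemma scycle_wpath (c : seq V) : scycle (edge G) c ->
  exists x t, [/\ c = x :: t, uniq c & wpath (edge G) c x].
Proof. by case: c => [|x t] // /andP[u w]; exists x, t. Qed.

Lemma csum_reward_int j c : scycle (edge G) c ->
  exists z : int, csum (reward G j) c * D%:R = z%:~R.
Proof. by move=> /scycle_wpath[x [t [-> _ /(wsum_reward_int lam j)]]]. Qed.

Lemma csum_reward_bound j c : scycle (edge G) c ->
  `|csum (reward G j) c| <= (2 ^ n)%:R * (size c)%:R.
Proof.
move=> /scycle_wpath[x [t [-> _ /(wsum_reward_bound lam j)]]].
by rewrite -mulr_natr.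
Qed.

Lemma cycle_average_small (p : bcycle V -> nat) q (v0 : V) :
  (forall c, p c != 0%N -> scycle (edge G) c) ->
  (\sum_(c : bcycle V) size (c : seq V) * p c)%N = q -> (0 < q)%N ->
  (q <= (#|Pl|.+1)`! * (2 ^ (3 * n)) ^ #|Pl|.+1)%N ->
  (tuple_size (cycle_average G p q) <= size_bound n)%N.
Proof.
move=> ps pq q0 qb.
have n1 := card_players_lt G lam v0; rewrite -/n in n1.
have D0 : (0 < D)%N := common_den_gt0 G lam.
have Dn : (D <= 2 ^ n)%N := common_den_le G lam.
have q2 : (q <= 2 ^ (4 * n ^ 2))%N.
  apply: (leq_trans qb); rewrite (_ : 4 * n ^ 2 = n * n + 3 * n * n)%N; last by lia.
  rewrite expnD leq_mul //; last by rewrite -expnM leq_exp2l // leq_mul2l n1 orbT.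
  apply: (leq_trans (leq_fact n1)); apply: (leq_trans (fact_leq_expn n)).
  by rewrite expnM; case: (n) => // k; rewrite leq_exp2r // ltnW // ltn_expl.
have Dq : (D * q <= 2 ^ (4 * n ^ 2 + n))%N by rewrite mulnC expnD leq_mul.
have small j : (rat_size (cycle_average G p q j) <= 8 * n ^ 2 + 3 * n + 3)%N.
  have [z hz] : exists z : int, cycle_average G p q j * (D * q)%:R = z%:~R.
    have [z hz] : exists z : int, (\sum_(c : bcycle V) csum (reward G j) c *+ p c) * D%:R = z%:~R.
      rewrite mulr_suml; elim/big_ind: _ => [|x y [zx ->] [zy ->]|c _].
      - by exists 0.
      - by exists (zx + zy); rewrite rmorphD.
      - case: (eqVneq (p c) 0%N) => [->|/ps sc]; first by exists 0; rewrite mulr0n mul0r.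
        have [z e] := csum_reward_int j sc; exists (z *+ p c).
        by rewrite mulrnAl e rmorphMn.
    exists z; rewrite mulnC natrM -hz /cycle_average mulrA divfK //.
    by rewrite pnatr_eq0 -lt0n.
  have den : (absz (denq (cycle_average G p q j)) <= D * q)%N.
    by apply: denq_le hz; rewrite muln_gt0 D0.
  have ab : `|cycle_average G p q j| <= (2 ^ n)%:R.
    rewrite /cycle_average normrM normfV [X in _ / X]ger0_norm // ler_pdivrMr ?ltr0n //.
    apply: (le_trans (ler_norm_sum _ _ _)); rewrite -pq natr_sum mulr_sumr.
    apply: ler_sum => c _; case: (eqVneq (p c) 0%N) => [->|/ps sc].
      by rewrite mulr0n normr0 mulr_ge0.
    by rewrite normrMn natrM mulrA -[X in X <= _]mulr_natr ler_wpM2r // csum_reward_bound.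
  apply: (@leq_trans ((4 * n ^ 2 + n + n) + (4 * n ^ 2 + n) + 3)); last by lia.
  apply: rat_size_le; last exact: leq_trans den Dq.
  rewrite -(ler_nat rat) natr_absz intr_norm numqE normrM expnD natrM mulrC.
  apply: ler_pM => //; rewrite -intr_norm -natr_absz ler_nat.
  exact: leq_trans den Dq.
rewrite /tuple_size /size_bound.
apply: (@leq_trans (#|Pl| + #|Pl| * (8 * n ^ 2 + 3 * n + 3))); last first.
  rewrite -mulnS -addnS leq_mul //; lia.
by rewrite leq_add2l -sum_nat_const leq_sum.
Qed.

(** The weights come from the recurrent part of [rho], and a finite prefix does not change a mean
    payoff. Hence one vector [x] serves every suffix, whichever date turns out to close the
    punishing cycle. *)
Lemma small_payoff (i : Pl) (a : R) rho :
  is_play G rho -> lam_consistent R G lam rho -> (mp R G i rho < a%:E)%E ->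
  exists x : Pl -> rat,
  [/\ (tuple_size x <= size_bound n)%N, ratr (x i) <= a,
      forall k, (er2R R (lam (rho k)) <= (ratr (x (owner G (rho k))) : R)%:E)%E &
      forall k, exists rho', [/\ is_play G rho', rho' 0%N = rho k, occ_eq rho' (occ_from rho k) &
        forall j, mp R G j rho' = (ratr (x j) : R)%:E]].
Proof.
move=> pl cons mpa.
have [k0 rec] := eventually_recurrent rho.
pose rho1 := suffix_from rho k0.
have pl1 : is_play G rho1 by move=> k; rewrite /rho1 /suffix_from addnS.
pose M0 : rat := - (2 ^ n)%:R.
have /choice[b hb] : forall j, exists b : rat,
    [/\ exists z : int, b * D%:R = z%:~R, ((ratr b : R)%:E <= mp R G j rho)%E &
      forall k, owner G (rho k) = j -> (er2R R (lam (rho k)) <= (ratr b : R)%:E)%E].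
  move=> j; pose s := [seq v <- enum V | `[< (exists k, rho k = v) /\ owner G v = j >]].
  have [||v|b [hb b1 b2]] := @max_requirement R V lam (mp R G j rho) M0 s.
  - exact: mp_lty.
  - apply: mp_lb => // u v /(reward_bound lam j).
    by rewrite ler_norml => /andP[].
  - rewrite mem_filter => /andP[/asboolP[[k <-] <-] _].
    by have := cons k; rewrite mp_suffix.
  - exists b; split=> //.
      case: hb => [->|[v _ /(common_den_req G)//]].
      by exists (- (2 ^ n * D)%:Z); rewrite /M0 rmorphN /= mulNr -natrM.
    move=> k ok; apply: b2; rewrite mem_filter mem_enum andbT; apply/asboolP; split=> //.
    by exists k.
have mp1 j : mp R G j rho1 = mp R G j rho by apply: mp_suffix.
have [||w [[w0 wo] w1 wb wa]] := @limit_weights R Pl V G i a (fun j => ratr (b j)) rho1 pl1.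
- by move=> j; rewrite mp1; have [] := hb j.
- by rewrite mp1.
have ws c : w c != 0 -> scycle (edge G) c by move=> /wo[].
(* Lists that are not simple cycles keep a column; length 1 and payoff 0 make its data admissible,
   and their weight is 0 in [w], hence in [p]. *)
pose len (c : bcycle V) := if scycle (edge G) c then size (c : seq V) else 1%N.
have /choice[T hT] : forall jc : Pl * bcycle V, exists z : int,
    if scycle (edge G) jc.2 then csum (reward G jc.1) jc.2 * D%:R = z%:~R else z = 0.
  move=> [j c] /=; case sc : (scycle _ _); [exact: csum_reward_int|by exists 0].
have /choice[B hB] : forall j, exists z : int, b j * D%:R = z%:~R by move=> j; have [] := hb j.
have D0 : (0 < D)%N := common_den_gt0 G lam.
have Dn : (D <= 2 ^ n)%N := common_den_le G lam.
have DR : 0 < D%:R :> R by rewrite ltr0n.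
have Vn : (#|V| <= 2 ^ n)%N := card_vertices_le G lam.
have szc (c : bcycle V) : (size (c : seq V) <= #|V|)%N by apply: size_bseq.
(* A cycle has at most [2 ^ n] edges of reward at most [2 ^ n], and clearing denominators multiplies
   by at most [2 ^ n]. *)
have K3 : (2 ^ (3 * n) = 2 ^ n * 2 ^ n * 2 ^ n)%N by rewrite -!expnD; congr (_ ^ _)%N; lia.
have sumw (F F' : bcycle V -> R) : (forall c : bcycle V, scycle (edge G) c -> F c = F' c) ->
    \sum_c F c * w c = \sum_c F' c * w c.
  move=> h; apply: eq_bigr => c _; case: (eqVneq (w c) 0) => [->|/ws sc]; first by rewrite !mulr0.
  by rewrite h.
have [|||//|||q [p [[q0 qb] pw pq pB pobj]]] := @small_weights R _ Pl len (fun j c => T (j, c)) B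
    (2 ^ (3 * n)) (fun c => csum (gain G i a) c) w.
- move=> c; rewrite /len; case: ifP => [|_]; last by rewrite expn_gt0.
  move=> /scycle_wpath[x [t [ct _ _]]]; rewrite {1}ct /= (leq_trans (szc c)) //.
  by rewrite (leq_trans Vn) // leq_exp2l //; lia.
- by rewrite expn_gt0.
- move=> j c; have := hT (j, c); case: ifP => [sc /= e|_ ->]; last by rewrite normr0.
  have b1 : `|csum (reward G j) c| <= (2 ^ n)%:R * (2 ^ n)%:R.
    apply: (le_trans (csum_reward_bound j sc)); rewrite ler_wpM2l // ler_nat.
    exact: leq_trans (szc c) Vn.
  rewrite -(ler_int rat) intr_norm -e normrM [X in _ * X]ger0_norm // K3.
  apply: (@le_trans _ _ ((2 ^ n)%:R * (2 ^ n)%:R * (2 ^ n)%:R)); first by rewrite ler_pM ?ler_nat.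
  by rewrite -!natrM.
- rewrite -[RHS]w1; apply: (sumw (fun c => (len c)%:R) (fun c => (size (c : seq V))%:R)) => c sc.
  by rewrite /len sc.
- move=> j.
  have -> : \sum_(c : bcycle V) (T (j, c))%:~R * w c =
      D%:R * \sum_(c : bcycle V) ratr (csum (reward G j) c) * w c :> R.
    rewrite mulr_sumr; under [RHS]eq_bigr do rewrite mulrA.
    apply: (sumw (fun c => (T (j, c))%:~R) (fun c => D%:R * ratr (csum (reward G j) c))) => c sc.
    have := hT (j, c); rewrite /= sc => e.
    by rewrite -[LHS]ratr_int -e rmorphM /= ratr_nat mulrC.
  rewrite -[X in X <= _]ratr_int -hB rmorphM /= ratr_nat mulrC ler_pM2l //.
  have := wb j; under eq_bigr do rewrite csum_gain mulrBl.
  rewrite sumrB subr_ge0; congr (_ <= _).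
  under eq_bigr do rewrite -[ratr (b j) *+ _]mulr_natr -mulrA.
  by rewrite -mulr_sumr w1 mulr1.
have ps c : p c != 0%N -> scycle (edge G) c by move=> /pw/ws.
have pq' : (\sum_(c : bcycle V) size (c : seq V) * p c)%N = q.
  rewrite -pq; apply: eq_bigr => c _; rewrite /len; case: ifP => // /negbT nsc.
  by case: (eqVneq (p c) 0%N) => [->|/ps]; [rewrite !muln0|rewrite (negbTE nsc)].
have qR : 0 < q%:R :> R by rewrite ltr0n.
have qQ : 0 < q%:R :> rat by rewrite ltr0n.
have xb j : b j <= cycle_average G p q j.
  rewrite ler_pdivlMr // -(@ler_pM2r _ D%:R) ?ltr0n // mulrAC hB.
  have := pB j; rewrite -(ler_int rat) rmorphM /= => /le_trans; apply.
  rewrite rmorph_sum /= mulr_suml; apply: ler_sum => c _.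
  case: (eqVneq (p c) 0%N) => [->|/ps sc]; first by rewrite mulr0 mulr0n mul0r.
  have := hT (j, c); rewrite /= sc => e.
  by rewrite rmorphM /= -e mulrnAl -[X in _ <= X]mulr_natr lexx.
exists (cycle_average G p q); split.
- exact: (cycle_average_small (rho 0%N)).
- rewrite /cycle_average rmorphM /= fmorphV /= ratr_nat ler_pdivrMr // -subr_le0.
  have : \sum_(c : bcycle V) csum (gain G i a) c * (p c)%:R <= 0 :> R.
    by apply: (le_trans pobj); rewrite mulr_ge0_le0.
  congr (_ <= _); rewrite rmorph_sum /= -pq' natr_sum mulr_sumr -sumrB; apply: eq_bigr => c _.
  by rewrite csum_gain mulrBl rmorphMn /= natrM mulrA !mulr_natr.
- move=> k; have [_ _ /(_ k erefl) h] := hb (owner G (rho k)).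
  by apply: (le_trans h); rewrite lee_fin ler_rat.
- move=> k.
  (* By [k1] every vertex of [occ_from rho k] has been seen; continuing to [k2] also reaches the
     recurrent part, where cycles can be joined to one another. *)
  have [k1 hk1] : exists k1, forall v, v \in occ_from rho k -> exists2 m, (m < k1)%N & rho (k + m)%N = v.
    have [|k1 hk1] := @finite_nat_bound V (fun v n0 => v \in occ_from rho k -> exists2 m, (m < n0)%N & rho (k + m)%N = v).
      move=> v; case: (boolP (v \in occ_from rho k)) => [/occ_fromP[m e]|_]; last by exists 0%N.
      by exists m.+1 => m' hm _; exists m.
    by exists k1 => v; apply: hk1.
  pose k2 := (k1 + k0)%N; pose rho2 := suffix_from rho (k + k2).
  have pl2 : is_play G rho2 by move=> l; rewrite /rho2 /suffix_from addnS.
  have rec2 m l : exists2 l', (l <= l')%N & rho2 l' = rho2 m.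
    have [|l' ll e] := rec (k + k2 + m)%N (k + k2 + l)%N; first by lia.
    exists (l' - (k + k2))%N; first by lia.
    by rewrite /rho2 /suffix_from subnKC //; lia.
  have pocc c : p c != 0%N -> occ_cycle (edge G) rho2 c.
    move=> pc; split; first exact: ps.
    have [_ oc] := wo _ (pw _ pc); move=> v /oc[m ->].
    have [|l ll e] := rec (k0 + m)%N (k + k2)%N; first by lia.
    by exists (l - (k + k2))%N; rewrite /rho2 /suffix_from subnKC // e.
  have [rho' [pl' r0 rocc rmp]] := realize_average R pl2 rec2 pocc pq' q0.
  pose s := mkseq (suffix_from rho k) k2.
  have s0 : rho' 0%N = suffix_from rho k k2 by rewrite r0 /rho2 /suffix_from addn0.
  exists (prepend s rho'); split.
  + apply: prepend_play => //; rewrite s0; apply: wpath_mkseq => l.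
    by rewrite /suffix_from addnS.
  + rewrite prepend0; rewrite /s; case: (k2) s0 => [->|l _] //=; by rewrite /suffix_from addn0.
  + move=> v; split=> [vW|[l <-]].
      have [m mk e] := hk1 v vW; exists m; rewrite (prepend_lt _ v) ?size_mkseq; last by lia.
      by rewrite nth_mkseq //; lia.
    apply/occ_fromP; case: (ltnP l (size s)) => ls.
      by exists l; rewrite (prepend_lt _ v) // nth_mkseq // -(size_mkseq (suffix_from rho k) k2).
    rewrite -(subnKC ls) prepend_ge; have [m ->] := rocc (l - size s)%N.
    by exists (k2 + m)%N; rewrite /rho2 /suffix_from addnA.
  + by move=> j; rewrite mp_prepend.
Qed.

End SmallPayoff.

(** * Stacks of the first cycle game *)

Section Stacks.
Context (V : finType) (L : Type).
Implicit Types (st : seq (V * L)) (v u : V) (l : L).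

(** A label is stored with the vertex its round started from. For a new vertex [index] returns the
    length, so the same cut pushes and pops nothing; otherwise what is popped is the closed cycle,
    the current round included. *)
Definition stack_cut st v l u : nat := index u (unzip1 (rcons st (v, l))).
Definition stack_step st v l u : seq (V * L) := take (stack_cut st v l u) (rcons st (v, l)).
Definition stack_pop st v l u : seq L := unzip2 (drop (stack_cut st v l u) (rcons st (v, l))).

Lemma unzip1_rcons st v l : unzip1 (rcons st (v, l)) = rcons (unzip1 st) v.
Proof. exact: map_rcons. Qed.

Lemma stack_step_uniq st v l u : uniq (rcons (unzip1 st) v) ->
  uniq (rcons (unzip1 (stack_step st v l u)) u).
Proof.
move=> un; rewrite /stack_step /unzip1 map_take -/unzip1 /stack_cut unzip1_rcons.
exact: cut_uniq.
Qed.

Lemma stack_pop_nil st v l u : u \notin rcons (unzip1 st) v -> stack_pop st v l u = [::].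
Proof.
move=> h; rewrite /stack_pop /stack_cut drop_oversize // unzip1_rcons memNindex //.
by rewrite !size_rcons size_map.
Qed.

Lemma stack_step_push st v l u : u \notin rcons (unzip1 st) v -> stack_step st v l u = rcons st (v, l).
Proof.
move=> h; rewrite /stack_step /stack_cut take_oversize // unzip1_rcons memNindex //.
by rewrite !size_rcons size_map.
Qed.

Lemma stack_pop_size st v l u : uniq (rcons (unzip1 st) v) -> (size (stack_pop st v l u) <= #|V|)%N.
Proof.
move=> /uniq_size_card h; rewrite /stack_pop size_map; apply: leq_trans h.
by rewrite size_drop !size_rcons size_map leq_subr.
Qed.

(** Popping resumes the first cycle game at an earlier position, so an invariant must hold at every
    prefix of the stack together with the vertex on top of it. *)
Definition stack_all (Q : seq (V * L) -> V -> Prop) st v : Prop :=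
  forall k, (k <= size st)%N -> Q (take k st) (nth v (unzip1 st) k).

Lemma stack_all_top Q st v : stack_all Q st v -> Q st v.
Proof. by move=> /(_ _ (leqnn _)); rewrite take_size nth_default // size_map. Qed.

Lemma stack_all_step Q st v l u : stack_all Q st v ->
  (u \notin rcons (unzip1 st) v -> Q (rcons st (v, l)) u) -> stack_all Q (stack_step st v l u) u.
Proof.
move=> h hu k; case: (boolP (u \in rcons (unzip1 st) v)) => us; last first.
  rewrite stack_step_push // size_rcons leq_eqVlt => /orP[/eqP ->|].
    rewrite take_oversize ?size_rcons // nth_default ?size_map ?size_rcons //; exact: hu.
  rewrite ltnS => lk; rewrite -cats1 takel_cat //.
  have := h k lk; rewrite /unzip1 map_cat nth_cat size_map; case: ltnP => lk2.
    by congr (Q _ _); apply: set_nth_default; rewrite size_map.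
  by (have -> : k = size st by lia); rewrite nth_default ?size_map // subnn.
have cutle : (stack_cut st v l u <= size st)%N.
  by rewrite /stack_cut unzip1_rcons -ltnS; move: us; rewrite -index_mem size_rcons size_map.
have stE : stack_step st v l u = take (stack_cut st v l u) st.
  by rewrite /stack_step -cats1 takel_cat.
rewrite stE size_takel // => lk.
have {}h := h k (leq_trans lk cutle).
rewrite -take_min (minn_idPl lk).
suff -> : nth u (unzip1 (take (stack_cut st v l u) st)) k = nth v (unzip1 st) k by [].
have nthr : nth v (unzip1 st) k = nth u (rcons (unzip1 st) v) k.
  rewrite nth_rcons size_map; case: ltngtP => lk2.
  - by apply: set_nth_default; rewrite size_map.
  - by have := leq_trans lk cutle; rewrite leqNgt lk2.
  - by rewrite nth_default // size_map lk2.
rewrite nthr /unzip1 map_take -/unzip1; move: lk; rewrite leq_eqVlt => /orP[/eqP ->|lk].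
  rewrite nth_default; last by rewrite size_take size_map; case: ltnP => //; lia.
  by rewrite /stack_cut unzip1_rcons nth_index.
by rewrite nth_take // nth_rcons size_map (leq_trans lk).
Qed.

Lemma stack_step_all (P : pred L) st v l u : all (fun x => P x.2) st -> P l ->
  all (fun x => P x.2) (stack_step st v l u) /\ all P (stack_pop st v l u).
Proof.
move=> h1 h2; have : all (fun x => P x.2) (rcons st (v, l)) by rewrite all_rcons /= h2.
rewrite -{1}(cat_take_drop (stack_cut st v l u) (rcons st (v, l))) all_cat => /andP[h3 h4].
by split=> //; rewrite /stack_pop all_map.
Qed.

Lemma stack_run_all (P : pred L) (st : nat -> seq (V * L)) (v : nat -> V) (l : nat -> L) :
  st 0%N = [::] -> (forall s, st s.+1 = stack_step (st s) (v s) (l s) (v s.+1)) ->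
  (forall s, P (l s)) ->
  forall s, all (fun x => P x.2) (st s) /\ all P (stack_pop (st s) (v s) (l s) (v s.+1)).
Proof.
move=> st0 stS hl; have h s : all (fun x => P x.2) (st s).
  by elim: s => [|s IH]; rewrite ?st0 // stS; have [] := stack_step_all (v s) (v s.+1) IH (hl s).
by move=> s; split=> //; have [] := stack_step_all (v s) (v s.+1) (h s) (hl s).
Qed.

Section Sums.
Context (R : realType) (om : L -> R).

Lemma stack_step_sum st v l u :
  \sum_(x <- stack_step st v l u) om x.2 + \sum_(x <- stack_pop st v l u) om x =
  \sum_(x <- st) om x.2 + om l.
Proof.
rewrite /stack_pop big_map /= -big_cat cat_take_drop -cats1 big_cat big_seq1 //.
Qed.

Context (st : nat -> seq (V * L)) (v : nat -> V) (l : nat -> L) (C : R).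
Hypotheses (st0 : st 0%N = [::]) (stS : forall s, st s.+1 = stack_step (st s) (v s) (l s) (v s.+1)).
Hypotheses (C0 : 0 <= C) (omC : forall s, om (l s) <= C).

Lemma stack_run_uniq s : uniq (rcons (unzip1 (st s)) (v s)).
Proof. by elim: s => [|s IH]; rewrite ?st0 // stS stack_step_uniq. Qed.

Hypothesis pop_le : forall s, v s.+1 \in rcons (unzip1 (st s)) (v s) ->
  \sum_(x <- stack_pop (st s) (v s) (l s) (v s.+1)) om x <= 0.

(** What has been popped sums to at most zero, so the total is at most what is still on the stack,
    at most [#|V|] entries of value at most [C]. *)
Lemma stack_run_sum s : \sum_(k < s) om (l k) <= C * #|V|%:R.
Proof.
have h1 : \sum_(k < s) om (l k) <= \sum_(x <- st s) om x.2.
  elim: s => [|s IH]; first by rewrite big_ord0 st0 big_nil.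
  rewrite big_ord_recr /= stS; have := stack_step_sum (st s) (v s) (l s) (v s.+1).
  case: (boolP (v s.+1 \in rcons (unzip1 (st s)) (v s))) => [/pop_le|/(stack_pop_nil (l s)) ->]; first by lra.
  rewrite big_nil; lra.
apply: (le_trans h1).
have h2 : \sum_(x <- st s) om x.2 <= \sum_(x <- st s) C.
  have [+ _] := stack_run_all (P := fun x => om x <= C) st0 stS omC s.
  elim: (st s) => [_|y t IH /= /andP[hy /IH ht]]; first by rewrite !big_nil.
  by rewrite !big_cons lerD.
apply: (le_trans h2); rewrite big_const_seq count_predT iter_addr_0 -[X in X <= _]mulr_natr ler_wpM2l // ler_nat.
by have := uniq_size_card (stack_run_uniq s); rewrite size_rcons size_map => /ltnW.
Qed.

End Sums.
End Stacks.

(* Labels of the rounds of the reduced game: a pre-cycle deviation carries the weight of the path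
   played, a post-cycle deviation is [LBad] or [LGood] (for Challenger) depending on whether the
   punishing cycle is negative. *)
Inductive lab (R : Type) := LPre of R | LGood | LBad.
Arguments LGood {R}. Arguments LBad {R}.

Definition isgood (R : Type) (l : lab R) : bool := if l is LGood then true else false.
Definition isbad (R : Type) (l : lab R) : bool := if l is LBad then true else false.
Definition labw (R : nmodType) (l : lab R) : R := if l is LPre r then r else 0.

(** A bad round prevails over good ones because infinitely many bad rounds already bound a lower
    limit. With neither kind the weights decide, and a zero sum goes to Challenger. *)
Definition pgood (R : realType) (c : seq (lab R)) : bool :=
  has (@isbad R) c || (~~ has (@isgood R) c && (\sum_(x <- c) labw x < 0)).

Section Runs.
Context (R : realType) (V : finType) (st : nat -> seq (V * lab R)) (v : nat -> V) (l : nat -> lab R).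
Hypotheses (st0 : st 0%N = [::]) (stS : forall s, st s.+1 = stack_step (st s) (v s) (l s) (v s.+1)).
Context (W : R).
Hypotheses (W0 : 0 <= W) (lW : forall s, `|labw (l s)| <= W).

Let pop s := stack_pop (st s) (v s) (l s) (v s.+1).

Let pop_sum_bound s : `|\sum_(x <- pop s) labw x| <= W * #|V|%:R.
Proof.
apply: (@le_trans _ _ (W * (size (pop s))%:R)).
  have [_] := stack_run_all (P := fun x => `|labw x| <= W) st0 stS lW s; rewrite -/(pop s).
  elim: (pop s) => [_|x t IH /= /andP[hx /IH ht]]; first by rewrite big_nil normr0 mulr0.
  by rewrite big_cons (le_trans (ler_normD _ _)) //= -natr1 mulrDr mulr1 addrC lerD.
by rewrite ler_wpM2l // ler_nat stack_pop_size // (stack_run_uniq st0 stS).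
Qed.

Let sum_has (P : pred (lab R)) c : \sum_(x <- c) (P x)%:R = (count P c)%:R :> R.
Proof. by elim: c => [|x c IH]; rewrite ?big_nil // big_cons IH /= natrD. Qed.

Let sumB (f1 f2 : lab R -> R) c : \sum_(x <- c) (f1 x - f2 x) = \sum_(x <- c) f1 x - \sum_(x <- c) f2 x.
Proof. by rewrite sumrB. Qed.

Section ProverRun.
Hypothesis popP : forall s, v s.+1 \in rcons (unzip1 (st s)) (v s) -> pgood (pop s).

(** Charging: a popped cycle has at most [#|V|] labels. If it contains a bad one, the charge [#|V|]
    of that label pays for all its good ones; otherwise [pgood] excludes good ones. *)
Lemma prover_good_count s :
  \sum_(k < s) (isgood (l k))%:R <= #|V|%:R * (1 + \sum_(k < s) (isbad (l k))%:R) :> R.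
Proof.
have := @stack_run_sum V (lab R) R (fun x => (isgood x)%:R - #|V|%:R * (isbad x)%:R) st v l 1 st0 stS ler01.
move=> /(_ _ _ s); rewrite sumrB -mulr_sumr mul1r => h.
suff : \sum_(k < s) (isgood (l k))%:R - #|V|%:R * \sum_(k < s) (isbad (l k))%:R <= #|V|%:R :> R by lra.
apply: h => [k|k /popP]; first by case: (l k) => [r||] /=; rewrite ?mulr0 ?mulr1 ?subr0 ?ler01 // sub0r; have := ler0n R #|V|; lra.
rewrite -/(pop k) sumB -mulr_sumr !sum_has /pgood => /orP[hb|/andP[hg _]].
  have h1 : (count (@isgood R) (pop k))%:R <= #|V|%:R :> R.
    rewrite ler_nat (leq_trans (count_size _ _)) // stack_pop_size // (stack_run_uniq st0 stS) //.
  have h2 : 1 <= (count (@isbad R) (pop k))%:R :> R by rewrite (ler_nat _ 1) -has_count.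
  have := ler_wpM2l (ler0n R #|V|) h2; rewrite mulr1; lra.
have -> : count (@isgood R) (pop k) = 0%N by apply/eqP; rewrite -leqn0 leqNgt -has_count.
by rewrite sub0r oppr_le0 mulr_ge0.
Qed.

(** The same charging with [W * #|V|], which bounds the weight of any popped cycle. *)
Lemma prover_weight s :
  \sum_(k < s) labw (l k) <= W * #|V|%:R * (1 + \sum_(k < s) (isbad (l k))%:R) :> R.
Proof.
have := @stack_run_sum V (lab R) R (fun x => labw x - W * #|V|%:R * (isbad x)%:R) st v l W st0 stS W0.
move=> /(_ _ _ s); rewrite sumrB -mulr_sumr => h.
suff : \sum_(k < s) labw (l k) - W * #|V|%:R * \sum_(k < s) (isbad (l k))%:R <= W * #|V|%:R :> R by lra.
have WV : 0 <= W * #|V|%:R by rewrite mulr_ge0.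
apply: h => [k|k /popP].
  have := lW k; rewrite ler_norml => /andP[_]; case: (isbad _); rewrite ?mulr0 ?mulr1; lra.
rewrite -/(pop k) sumB -mulr_sumr !sum_has /pgood => /orP[hb|/andP[_ /ltW hw]].
  have h2 : 1 <= (count (@isbad R) (pop k))%:R :> R by rewrite (ler_nat _ 1) -has_count.
  have := ler_wpM2l WV h2; rewrite mulr1.
  have := pop_sum_bound k; rewrite ler_norml => /andP[_]; lra.
have : 0 <= W * #|V|%:R * (count (@isbad R) (pop k))%:R by rewrite mulr_ge0.
lra.
Qed.

End ProverRun.

Section ChallengerRun.
Hypothesis popC : forall s, v s.+1 \in rcons (unzip1 (st s)) (v s) -> ~~ pgood (pop s).

(** Cycles won by Challenger contain no bad label, so every bad label is still on the stack. *)
Lemma challenger_bad_count s : \sum_(k < s) (isbad (l k))%:R <= #|V|%:R :> R.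
Proof.
have := @stack_run_sum V (lab R) R (fun x => (isbad x)%:R) st v l 1 st0 stS ler01.
move=> /(_ _ _ s); rewrite mul1r; apply=> [k|k /popC]; first by rewrite lern1 leq_b1.
rewrite -/(pop k) sum_has negb_or => /andP[hb _].
by rewrite (_ : count _ _ = 0%N) //; apply/eqP; rewrite -leqn0 leqNgt -has_count.
Qed.

Lemma challenger_weight s :
  - (W * #|V|%:R * (1 + \sum_(k < s) (isgood (l k))%:R)) <= \sum_(k < s) labw (l k) :> R.
Proof.
have := @stack_run_sum V (lab R) R (fun x => - labw x - W * #|V|%:R * (isgood x)%:R) st v l W st0 stS W0.
move=> /(_ _ _ s); rewrite sumrB sumrN -mulr_sumr => h.
suff : - \sum_(k < s) labw (l k) - W * #|V|%:R * \sum_(k < s) (isgood (l k))%:R <= W * #|V|%:R :> R by lra.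
have WV : 0 <= W * #|V|%:R by rewrite mulr_ge0.
apply: h => [k|k /popC].
  have := lW k; rewrite ler_norml => /andP[+ _]; case: (isgood _); rewrite ?mulr0 ?mulr1; lra.
rewrite -/(pop k) sumB sumrN -mulr_sumr !sum_has /pgood negb_or negb_and negbK -leNgt.
move=> /andP[_ /orP[hb|hw]].
  have h2 : 1 <= (count (@isgood R) (pop k))%:R :> R by rewrite (ler_nat _ 1) -has_count.
  have := ler_wpM2l WV h2; rewrite mulr1.
  have := pop_sum_bound k; rewrite ler_norml => /andP[+ _]; lra.
have : 0 <= W * #|V|%:R * (count (@isgood R) (pop k))%:R by rewrite mulr_ge0.
lra.
Qed.

End ChallengerRun.
End Runs.

(** * Plays of the reduced game *)

Section ReducedPlays.
Context (R : realType) (Pl V : finType) (G : game Pl V) (lam : V -> \bar rat) (i : Pl) (beta : int).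
Context (pick : fam Pl V -> V -> seq V) (tailpick : fam Pl V -> nat -> V) (v0 : V).
Implicit Types (f : fam Pl V) (d : rstate Pl V) (H : nat -> rstate Pl V).

Definition dev_ok f d (u : V) : Prop :=
  match d with
  | SPre h' w => pre_ok G i f h' w /\ u = w
  | SPost c w => [/\ f.1.1.2 = c, post_ok G i f w & u = w]
  | _ => False
  end.

Definition dev_segment (N : nat) f d : seq V :=
  match d with
  | SPre h' _ => h'
  | SPost _ w => f.1.1.1 ++ ncat ((N + size f.1.1.1) * (N + size f.1.1.1)) f.1.1.2 ++ pick f w
  | _ => [::]
  end.

Definition red_play H : Prop :=
  H 0%N = SProv Pl v0 /\ forall n, rmove R G lam i beta (H n) (H n.+1).

Lemma rmove_state (s t : rstate Pl V) :
  rmove R G lam i beta s t -> is_rstate R G lam i beta s -> is_rstate R G lam i beta t.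
Proof.
case: s => [v|f|c u|h w||]; case: t => [v'|f'|c' u'|h' w'||] //=; first by case.
- by move=> [e po] vf; exists f.
- by move=> po vf; exists f.
Qed.

Lemma rhistE (tP tC : rstrat Pl V) s0 n : rhist tP tC s0 n = mkseq (rout tP tC s0) n.+1.
Proof.
elim: n => // n IH; rewrite [RHS]mkseqS -IH /=; congr (rcons _ _).
by rewrite /rout /= last_rcons.
Qed.

Lemma routS (tP tC : rstrat Pl V) s0 n : rout tP tC s0 n.+1 =
  (if rowner (rout tP tC s0 n) is Prover then tP else tC) (mkseq (rout tP tC s0) n.+1).
Proof. by rewrite {1}/rout /= last_rcons -/(rout tP tC s0 n) rhistE. Qed.

Lemma rout_red_play tP tC : valid_rstrat R G lam i beta Prover tP ->
  valid_rstrat R G lam i beta Challenger tC -> red_play (rout tP tC (SProv Pl v0)).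
Proof.
move=> hP hC; set H := rout _ _ _.
have step n : is_rstate R G lam i beta (H n) -> rmove R G lam i beta (H n) (H n.+1).
  move=> st; rewrite /H routS -/H mkseqS; case e : (rowner (H n)); [exact: hP|exact: hC].
have st n : is_rstate R G lam i beta (H n).
  by elim: n => // n IH; apply: rmove_state (step n IH) IH.
by split=> // n; apply: step.
Qed.

Lemma red_round H s v : red_play H -> (forall n, H n <> SBot Pl V) -> H s = SProv Pl v ->
  exists f, [/\ H s.+1 = SFam f, valid_fam R G lam beta f, head v f.1.1.1 = v &
    H s.+2 = STop Pl V \/ exists u, dev_ok f (H s.+2) u /\ H s.+3 = SProv Pl u].
Proof.
move=> [_ rm] nb hs; have := rm s; rewrite hs; case e1 : (H s.+1) => [v'|f|c u|h w||] //=; last first.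
  by have := nb s.+1; rewrite e1.
move=> [vf hd]; exists f; split=> //.
have := rm s.+1; rewrite e1; case e2 : (H s.+2) => [v'|f'|c u|h w||] //=; last by left.
- move=> [ec po]; right; exists u; split; first by split.
  by have := rm s.+2; rewrite e2; case: (H s.+3) => //= v' ->.
- move=> po; right; exists w; split; first by split.
  by have := rm s.+2; rewrite e2; case: (H s.+3) => //= v' ->.
Qed.

Lemma red_top H s : red_play H -> H s = STop Pl V -> forall k, H (s + k)%N = STop Pl V.
Proof.
move=> [_ rm] hs; elim=> [|k IH]; first by rewrite addn0.
have := rm (s + k)%N; rewrite IH addnS; by case: (H _).
Qed.

Local Notation dacc := (dot_acc pick tailpick).

Lemma dot_step_cat acc (s t : rstate Pl V) :
  exists x, (dot_step pick tailpick acc s t).1 = acc.1 ++ x.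
Proof.
case: acc => pre tl; case: s => [v|[[[h0 c0] x0] W0]|c u|h w||];
  case: t => [v'|f'|c' u'|h' w'||] /=; try (by exists [::]; rewrite cats0); try by eexists.
case: tl => [r|]; last by exists [::]; rewrite cats0.
by exists [:: r 0%N]; rewrite cats1.
Qed.

Lemma dot_accS H n : dacc H n.+1 = dot_step pick tailpick (dacc H n) (H n) (H n.+1).
Proof. by []. Qed.

Lemma dot_acc_cat H m n : exists x, (dacc H (m + n)).1 = (dacc H m).1 ++ x.
Proof.
elim: n => [|n [x e]]; first by exists [::]; rewrite addn0 cats0.
rewrite addnS /=; have [y ->] := dot_step_cat (dacc H (m + n)) (H (m + n)%N) (H (m + n).+1).
by rewrite e; exists (x ++ y); rewrite catA.
Qed.

Lemma dot_acc_nth H m n (d : V) k : (k < size (dacc H m).1)%N -> (k < size (dacc H n).1)%N ->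
  nth d (dacc H m).1 k = nth d (dacc H n).1 k.
Proof.
wlog mn : m n / (m <= n)%N.
  by move=> h km kn; case: (leqP m n) => [/h|/ltnW/h h']; [apply|symmetry; apply: h'].
move=> km _; have [x] := dot_acc_cat H m (n - m); rewrite subnKC // => ->.
by rewrite nth_cat km.
Qed.

Lemma dot_acc_dev H s f d u tl v : H s = SProv Pl v -> H s.+1 = SFam f -> H s.+2 = d ->
  H s.+3 = SProv Pl u -> dev_ok f d u -> dacc H s = (tl, None) ->
  dacc H s.+3 = (tl ++ dev_segment (size tl) f d, None).
Proof.
move=> e0 e1 e2 e3 dv ea.
have d1 : dacc H s.+1 = (tl, None) by rewrite /= ea e0 e1.
rewrite 2!dot_accS d1 e1 e2 e3; move: dv; case: f {e1} => [[[h0 c0] x0] W0].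
by case: d {e2} => [v'|f'|c' u'|h' w'||] //= _; rewrite size_cat.
Qed.

Lemma dev_segment_neq0 N f d u v : valid_fam R G lam beta f -> head v f.1.1.1 = v -> dev_ok f d u ->
  dev_segment N f d != [::] /\ forall e, head e (dev_segment N f d) = v.
Proof.
case: f => [[[h c] x] W] [[y [t [eh _]]] _ _ _ _] /= hd.
have yv : y = v by rewrite eh in hd.
have [z [u' [ec _]]] : exists z u', h = z :: u' /\ z = v by exists y, t.
case: d => [v'|f'|c' w'|h' w'||] //= => [_|[[h0 pf _ _] _]].
  by rewrite eh yv.
split=> // e; move: pf h0; rewrite eh yv; case: h' => //= y' h' /andP[/eqP -> _] //.
Qed.

Hypothesis tailP : tail_pick_spec R G lam beta tailpick.

(** [dot_play] reads vertex [k] in the accumulator of date [3 * k + 3]. The hypothesis on [n < s]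
    makes this long enough before acceptance; afterwards every move adds a vertex. *)
Lemma dot_play_top H s f v p : red_play H -> H (3 * s)%N = SProv Pl v -> H (3 * s).+1 = SFam f ->
  valid_fam R G lam beta f -> H (3 * s).+2 = STop Pl V -> dacc H (3 * s) = (p, None) ->
  (forall n, (n < s)%N -> (n < size (dacc H (3 * n + 3)).1)%N) -> (s <= size p)%N ->
  mp R G i (dot_play pick tailpick v0 H) = (ratr (f.1.2 i) : R)%:E.
Proof.
move=> rp e0 e1 vf e2 ea hsz sp.
have [h [c [x [W ef]]]] : exists h c x W, f = (h, c, x, W) by case: f {e1 vf} => [[[h c] x] W]; exists h, c, x, W.
set Q := p ++ h ++ ncat (size (p ++ h) * size (p ++ h)) c.
have d2 : dacc H (3 * s).+2 = (Q, Some (tailpick f)).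
  by rewrite 2!dot_accS ea e0 e1 e2 ef.
have dk k : dacc H ((3 * s).+2 + k) = (Q ++ mkseq (tailpick f) k, Some (suffix_from (tailpick f) k)).
  elim: k => [|k IH]; first by rewrite addn0 cats0 d2.
  rewrite addnS dot_accS IH -addnS !(red_top rp e2) /=.
  congr (_, Some _); last by apply/funext => l; rewrite /suffix_from addnS.
  by rewrite mkseqS -rcons_cat /suffix_from addn0.
have hne : (0 < size h)%N by move: vf; rewrite ef => -[[y [t [-> _]]] _ _ _ _].
have -> : dot_play pick tailpick v0 H = prepend Q (tailpick f).
  apply/funext => k; rewrite /dot_play.
  have kk : (k < size (dacc H ((3 * s).+2 + k.+1)).1)%N.
    by rewrite dk size_cat size_mkseq ltn_addl.
  rewrite (@dot_acc_nth H _ ((3 * s).+2 + k.+1) v0 k _ kk); last first.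
    case: (ltnP k s) => ks; first exact: hsz.
    have -> : (3 * k + 3 = (3 * s).+2 + (3 * (k - s) + 1))%N by lia.
    rewrite dk size_cat size_mkseq /Q !size_cat; lia.
  rewrite dk /= nth_cat /prepend; case: ltnP => kQ; first exact: set_nth_default.
  by rewrite nth_mkseq //; lia.
rewrite mp_prepend; have := tailP vf; rewrite {1}ef /= => -[_ [+ _]]; rewrite ef; exact.
Qed.

Definition red_rounds H (vs : nat -> V) (fs : nat -> fam Pl V) (p : nat -> seq V) : Prop :=
  [/\ forall s, [/\ H (3 * s)%N = SProv Pl (vs s), H (3 * s).+1 = SFam (fs s),
        valid_fam R G lam beta (fs s), head (vs s) (fs s).1.1.1 = vs s &
        dev_ok (fs s) (H (3 * s).+2) (vs s.+1)],
      vs 0%N = v0, p 0%N = [::] &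
      forall s, p s.+1 = p s ++ dev_segment (size (p s)) (fs s) (H (3 * s).+2)].

(** A play avoiding [SBot] proceeds in blocks of three moves until Challenger accepts. When he never
    does, the date [3 * k + 3] read by [dot_play] is the end of block [k], which is exactly the
    index used by [chain_lim]. *)
Lemma red_play_cases H : red_play H ->
  [\/ exists n, H n = SBot Pl V,
      exists s v f, [/\ H (3 * s)%N = SProv Pl v, H (3 * s).+1 = SFam f, valid_fam R G lam beta f,
        H (3 * s).+2 = STop Pl V &
        nuC R G i pick tailpick v0 H = (ratr (f.1.2 i) : R)%:E] |
      exists vs fs p, red_rounds H vs fs p /\
        nuC R G i pick tailpick v0 H = mp R G i (chain_lim v0 p)].
Proof.
move=> rp; have [hb|hb] := pselect (exists n, H n = SBot Pl V); first by constructor 1.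
have nb n : H n <> SBot Pl V by move=> e; apply: hb; exists n.
have nuE : nuC R G i pick tailpick v0 H = mp R G i (dot_play pick tailpick v0 H).
  by rewrite /nuC; case: pselect.
pose good s := exists v p, [/\ H (3 * s)%N = SProv Pl v, dacc H (3 * s) = (p, None), (s <= size p)%N &
  forall n, (n < s)%N -> (n < size (dacc H (3 * n + 3)).1)%N].
have good0 : good 0%N by exists v0, [::]; split=> //; case: rp.
have round s v p : H (3 * s)%N = SProv Pl v -> dacc H (3 * s) = (p, None) -> (s <= size p)%N ->
    H (3 * s).+2 <> STop Pl V -> exists f u, [/\ H (3 * s).+1 = SFam f, valid_fam R G lam beta f,
      head v f.1.1.1 = v, dev_ok f (H (3 * s).+2) u &
      [/\ H (3 * s.+1)%N = SProv Pl u,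
      dacc H (3 * s.+1) = (p ++ dev_segment (size p) f (H (3 * s).+2), None) &
      (s.+1 <= size (p ++ dev_segment (size p) f (H (3 * s).+2)))%N]].
  move=> e0 ea sp nt; have [f [e1 vf hd [//|[u [dv e3]]]]] := red_round rp nb e0.
  have e3n : (3 * s.+1 = (3 * s).+3)%N by lia.
  exists f, u; split=> //; rewrite e3n; split=> //; first exact: (dot_acc_dev e0 e1 erefl e3 dv ea).
  have [ne _] := dev_segment_neq0 (size p) vf hd dv.
  by rewrite size_cat -addn1 leq_add // lt0n size_eq0.
have [[s [hg ht]]|nt] := pselect (exists s, good s /\ H (3 * s).+2 = STop Pl V).
  constructor 2; have [v [p [e0 ea sp hn]]] := hg.
  have [f [e1 vf hd _]] := red_round rp nb e0.
  exists s, v, f; split=> //; rewrite nuE; exact: (dot_play_top rp e0 e1 vf ht ea hn sp).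
have goodS s : good s.
  elim: s => // s IH; have [v [p [e0 ea sp hn]]] := IH.
  have [f [u [e1 vf hd dv [e3 ea' sp']]]] := round s v p e0 ea sp (fun ht => nt (ex_intro _ s (conj IH ht))).
  exists u, (p ++ dev_segment (size p) f (H (3 * s).+2)); split=> // n; rewrite ltnS leq_eqVlt => /orP[/eqP ->|/hn //].
  by rewrite (_ : 3 * s + 3 = 3 * s.+1)%N ?ea' //; lia.
have nt' s : H (3 * s).+2 <> STop Pl V by move=> ht; apply: nt; exists s.
constructor 3.
pose p s := (dacc H (3 * s)).1.
have dE s : dacc H (3 * s) = (p s, None) by have [v [q [_ e _ _]]] := goodS s; rewrite /p e.
have ps s : (s <= size (p s))%N by have [v [q [_ e h _]]] := goodS s; rewrite /p e.
have /choice[vs hvs] : forall s, exists v, H (3 * s)%N = SProv Pl v.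
  by move=> s; have [v [q [e _ _ _]]] := goodS s; exists v.
have /choice[fs hfs] : forall s, exists f, [/\ H (3 * s).+1 = SFam f, valid_fam R G lam beta f,
    head (vs s) f.1.1.1 = vs s, dev_ok f (H (3 * s).+2) (vs s.+1) &
    p s.+1 = p s ++ dev_segment (size (p s)) f (H (3 * s).+2)].
  move=> s; have [f [u [e1 vf hd dv [e3 ea' sp']]]] := round s _ _ (hvs s) (dE s) (ps s) (nt' s).
  exists f; split=> //; last by rewrite /p ea' dE.
  by move: e3; rewrite hvs => -[->].
exists vs, fs, p; split.
  split=> //.
  - by move=> s; have [] := hfs s.
  - by have := hvs 0%N; rewrite muln0; case: rp => -> _ [].
  - by move=> s; have [] := hfs s.
by rewrite nuE; congr (mp _ _ _ _); apply/funext => k; rewrite /dot_play /chain_lim /p mulnS addnC.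
Qed.

Section RoundChain.
Context (H : nat -> rstate Pl V) (vs : nat -> V) (fs : nat -> fam Pl V) (p : nat -> seq V).
Hypothesis rr : red_rounds H vs fs p.

Let sg s := dev_segment (size (p s)) (fs s) (H (3 * s).+2).

Lemma rounds_p0 : p 0%N = [::]. Proof. by case: rr. Qed.
Lemma rounds_pS s : p s.+1 = p s ++ sg s. Proof. by case: rr. Qed.
Lemma rounds_seg_neq0 s : sg s != [::].
Proof. by case: rr => /(_ s)[_ _ vf hd dv] _ _ _; have [] := dev_segment_neq0 (size (p s)) vf hd dv. Qed.
Lemma rounds_seg_head s e : head e (sg s) = vs s.
Proof. by case: rr => /(_ s)[_ _ vf hd dv] _ _ _; have [_] := dev_segment_neq0 (size (p s)) vf hd dv; apply. Qed.

End RoundChain.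
End ReducedPlays.

(** * Challenger wins the first cycle game *)

(** Complete laps have nonnegative weight; only the interrupted one can cost, and it has at most
    [size c] edges. *)
Lemma wsum_take_ncat_ge (R : realType) (V : finType) (g : V -> V -> R) (M : R) (c : seq V) :
  0 <= M -> (forall u v, `|g u v| <= M) -> 0 <= csum g c ->
  forall k r e, - (M * (size c)%:R) <= wsum g (take r (ncat k c)) e.
Proof.
move=> M0 gM cge; have lb s e : - (M * (size s)%:R) <= wsum g s e.
  have := wsum_bound gM s e; rewrite ler_norml -[M *+ _]mulr_natr => /andP[] //.
elim=> [|k IH] r e; first by rewrite /= oppr_le0 mulr_ge0.
rewrite (_ : ncat k.+1 c = c ++ ncat k c) // take_cat; case: ltnP => rc.
  apply: le_trans (lb _ _); rewrite lerN2 ler_wpM2l // ler_nat size_take; case: ifP => //; lia.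
rewrite wsum_cat; case et : (take (r - size c) (ncat k c)) (IH (r - size c)%N e) => [|y t] /= IHr.
  by rewrite addr0 lb.
have hc : y = head y c /\ c != [::].
  by move: et {IHr}; case: (c) k {IH} => [|x c'] [|k] //=; [elim: k => //=|case: (r - _)%N => //= r' [->]].
have [hy cn] := hc; have -> : wsum g c y = csum g c by rewrite /csum; case: (c) hy cn => //= x c' ->.
by rewrite -[X in X <= _]add0r lerD.
Qed.

Lemma bounded_count_eventually (R : realType) (b : nat -> bool) (C : R) :
  (forall s, \sum_(k < s) (b k)%:R <= C) -> exists s0, forall k, (s0 <= k)%N -> ~~ b k.
Proof.
move=> hC; apply: contrapT => /forallNP h.
have {}h s0 : exists2 k, (s0 <= k)%N & b k.
  by have /existsNP[k /not_implyP[sk /negP]] := h s0; rewrite negbK => bk; exists k.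
have hm (m : nat) : exists s, m%:R <= \sum_(k < s) (b k)%:R :> R.
  elim: m => [|m [s IH]]; first by exists 0%N; rewrite big_ord0.
  have [k sk bk] := h s; exists k.+1; rewrite big_ord_recr /= bk -natr1 lerD // (le_trans IH) //.
  rewrite -(subnKC sk) big_split_ord /= lerDl; exact: sumr_ge0.
have [s] := hm (Num.bound `|C|); apply/negP; rewrite -ltNge.
apply: (le_lt_trans (hC s)); apply: (le_lt_trans (ler_norm _)); exact: archi_boundP.
Qed.

Section FirstCycle.
Context (R : realType) (Pl V : finType) (G : game Pl V) (lam : V -> \bar rat) (i : Pl) (beta : int).
Context (a : R).
Implicit Types (f : fam Pl V) (d : rstate Pl V) (st : seq (V * lab R)).

Let g := gain G i a.

(** The label ignores the time elapsed, although the true weight of a post-cycle round depends on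
    it; this keeps the first cycle game independent of the past. *)
Definition dev_label f d : lab R :=
  match d with
  | SPre h' w => LPre (wsum g h' w)
  | _ => if csum g f.1.1.2 < 0 then LBad else LGood
  end.

(* Prover wins the game played until the first cycle closes on the stack. *)
Inductive prover_wins : seq (V * lab R) -> V -> Prop :=
| ProverWins st v f of valid_fam R G lam beta f & head v f.1.1.1 = v & ratr (f.1.2 i) < a &
    (forall d u, dev_ok G i f d u -> u \in rcons (unzip1 st) v ->
      pgood (stack_pop st v (dev_label f d) u)) &
    (forall d u, dev_ok G i f d u -> u \notin rcons (unzip1 st) v ->
      prover_wins (rcons st (v, dev_label f d)) u) : prover_wins st v.

Lemma fam_sizes f : valid_fam R G lam beta f ->
  [/\ (0 < size f.1.1.1 <= #|V|)%N, (0 < size f.1.1.2 <= #|V|)%N &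
      forall h', prefix h' (f.1.1.1 ++ f.1.1.2) -> (size h' <= 2 * #|V|)%N].
Proof.
case: f => [[[h c] x] W] /= [[v [t [eh [_ uh]]]] [u [t' [ec [_ [uc _]]]]] _ _ _].
have hV := uniq_size_card uh; have cV := uniq_size_card uc.
split; [by rewrite hV eh|by rewrite cV ec|].
move=> h' /prefixP[t'' e]; apply: (@leq_trans (size h + size c)).
  by rewrite -size_cat e size_cat leq_addr.
by rewrite mul2n -addnn leq_add.
Qed.

Lemma dev_label_bound f d u (M : R) : 0 <= M -> (forall x y, `|g x y| <= M) ->
  valid_fam R G lam beta f -> dev_ok G i f d u -> `|labw (dev_label f d)| <= M * (2 * #|V|)%:R.
Proof.
move=> M0 gM vf; have MV : 0 <= M * (2 * #|V|)%:R by rewrite mulr_ge0.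
case: d => [v'|f'|c' w'|h' w'||] //=; first by case: ifP => _; rewrite normr0.
move=> [po _]; apply: (le_trans (wsum_bound gM _ _)); rewrite -[X in X <= _]mulr_natr ler_wpM2l // ler_nat.
have [_ _ h] := fam_sizes vf; apply: h; by move: po; case: f {vf} => [[[h0 c0] x0] W0] [].
Qed.

Lemma dev_ok_move f d u : dev_ok G i f d u -> rmove R G lam i beta (SFam f) d.
Proof. by case: d => [v'|f'|c' w'|h' w'||] //= => [[]|[]]. Qed.

Lemma dev_ok_fun f d u u' : dev_ok G i f d u -> dev_ok G i f d u' -> u = u'.
Proof. by case: d => [v'|f'|c' w'|h' w'||] //= => [[_ _ ->] [_ _ ->]|[_ ->] [_ ->]]. Qed.

Definition response st v f d : Prop :=
  ~ prover_wins st v -> valid_fam R G lam beta f -> head v f.1.1.1 = v ->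
  (d = STop Pl V /\ a <= ratr (f.1.2 i)) \/
  exists u, [/\ dev_ok G i f d u,
    u \in rcons (unzip1 st) v -> ~~ pgood (stack_pop st v (dev_label f d) u) &
    u \notin rcons (unzip1 st) v -> ~ prover_wins (rcons st (v, dev_label f d)) u].

(** Determinacy: if no deviation refutes the family, it meets all premises of [ProverWins] except
    possibly the strict payoff bound. Where Prover does not win, that bound must fail, so accepting
    yields at least [a]. *)
Lemma response_ex st v f : exists d, response st v f d.
Proof.
case: (pselect (exists d u, [/\ dev_ok G i f d u,
    u \in rcons (unzip1 st) v -> ~~ pgood (stack_pop st v (dev_label f d) u) &
    u \notin rcons (unzip1 st) v -> ~ prover_wins (rcons st (v, dev_label f d)) u])) => [[d hd]|nd].
  by exists d => _ _ _; right.
exists (STop Pl V) => nw vf hd; left; split=> //; rewrite leNgt; apply/negP => xa; apply: nw.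
apply: (ProverWins vf hd xa) => d u dok us.
  apply: contrapT => np; apply: nd; exists d, u; split=> //; first by move=> _; apply/negP.
  by rewrite us.
by apply: contrapT => np; apply: nd; exists d, u; split=> //; rewrite (negbTE us).
Qed.

Definition choose_response (x : seq (V * lab R) * V * fam Pl V) : rstate Pl V :=
  projT1 (cid (response_ex x.1.1 x.1.2 x.2)).

Lemma choose_responseP st v f : response st v f (choose_response (st, v, f)).
Proof. exact: (projT2 (cid (response_ex st v f))). Qed.

Definition cmem := (seq (V * lab R) * V * fam Pl V)%type.

Definition cmem_upd (m : cmem) (s : rstate Pl V) : cmem :=
  let: (st, v, f) := m in
  match s with
  | SFam f' => (st, v, f')
  | SPre _ w => (stack_step st v (dev_label f s) w, w, f)
  | SPost _ w => (stack_step st v (dev_label f s) w, w, f)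
  | _ => m
  end.

Section Challenger.
Context (v0 : V).

Definition cmem0 : cmem := ([::], v0, ([::], [::], fun=> 0, finset.set0)).
Definition cmem_of (hs : seq (rstate Pl V)) : cmem := foldl cmem_upd cmem0 hs.

(** The test on [rmove] makes the strategy legal after every history, including those where the
    memory carries no guarantee. *)
Definition challenger (hs : seq (rstate Pl V)) : rstate Pl V :=
  match last (SBot Pl V) hs with
  | SFam f => let d := choose_response (cmem_of hs) in
      if pselect (rmove R G lam i beta (SFam f) d) then d else STop Pl V
  | SPre _ w | SPost _ w => SProv Pl w
  | STop => STop Pl V
  | _ => SBot Pl V
  end.

Lemma challenger_valid : valid_rstrat R G lam i beta Challenger challenger.
Proof.
move=> hs s _; rewrite /challenger last_rcons; case: s => //= f _.
by case: pselect.
Qed.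

Definition good_response st v f d : Prop :=
  (d = STop Pl V /\ a <= ratr (f.1.2 i)) \/
  exists u, [/\ dev_ok G i f d u,
    u \in rcons (unzip1 st) v -> ~~ pgood (stack_pop st v (dev_label f d) u) &
    u \notin rcons (unzip1 st) v -> ~ prover_wins (rcons st (v, dev_label f d)) u].

Lemma challenger_move hs st v f : cmem_of (rcons hs (SFam f)) = (st, v, f) ->
  ~ prover_wins st v -> valid_fam R G lam beta f -> head v f.1.1.1 = v ->
  good_response st v f (challenger (rcons hs (SFam f))).
Proof.
move=> em nw vf hd; rewrite /challenger last_rcons em.
have := choose_responseP nw vf hd; set d := choose_response _.
case: pselect => [mv|nm] //= [[e xa]|[u [dok _ _]]]; first by case: nm; rewrite e.
by case: nm; apply: dev_ok_move dok.
Qed.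

Section Play.
Context (H : nat -> rstate Pl V).
Hypothesis rp : red_play R G lam i beta v0 H.
Hypothesis follow : forall n, rowner (H n) = Challenger -> H n.+1 = challenger (mkseq H n.+1).
Hypothesis lose : ~ prover_wins [::] v0.

Let mem n := cmem_of (mkseq H n.+1).

Let memS n : mem n.+1 = cmem_upd (mem n) (H n.+1).
Proof. by rewrite /mem /cmem_of mkseqS -cats1 foldl_cat. Qed.

Lemma red_back n u : H n.+3 = SProv Pl u -> exists v f, [/\ H n = SProv Pl v, H n.+1 = SFam f,
  valid_fam R G lam beta f, head v f.1.1.1 = v & dev_ok G i f (H n.+2) u].
Proof.
case: rp => _ rm e3; have := rm n; have := rm n.+1; have := rm n.+2; rewrite e3.
case e2 : (H n.+2) => [v'|f'|c' w'|h' w'||] //= ->; case e1 : (H n.+1) => [v1|f1|c1 w1|h1 w1||] //=.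
- by move=> [? ?]; case: (H n) => // v [? ?]; exists v, f1; split.
- by move=> ?; case: (H n) => // v [? ?]; exists v, f1; split.
Qed.

(** Every prefix of the stack is a position that Prover does not win, so Challenger can go on from
    it after a pop. *)
Lemma challenger_inv s v : H (3 * s)%N = SProv Pl v -> exists st f,
  mem (3 * s) = (st, v, f) /\ stack_all (fun st v => ~ prover_wins st v) st v.
Proof.
elim: s v => [v|s IH v].
  rewrite muln0; case: (rp) => e0 _; rewrite e0 => -[<-]; exists [::], cmem0.2.
  by rewrite /mem /= /cmem_of /= e0 /=; split=> // k; rewrite leqn0 => /eqP ->.
have -> : (3 * s.+1 = (3 * s).+3)%N by lia.
move=> e3; have [v' [f [e0 e1 vf hd dv]]] := red_back e3.
have [st [f0 [em al]]] := IH v' e0.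
have m1 : mem (3 * s).+1 = (st, v', f) by rewrite memS em e1.
have := follow (n := (3 * s).+1); rewrite e1 => /(_ erefl); rewrite mkseqS e1 => e2.
have mm : cmem_of (rcons (mkseq H (3 * s).+1) (SFam f)) = (st, v', f) by rewrite -e1 -mkseqS.
have := challenger_move mm (stack_all_top al) vf hd; rewrite -e2 => -[[e _]|[u [dok pop push]]].
  by rewrite e in dv.
have uv := dev_ok_fun dok dv; rewrite uv in dok pop push.
have m3 : mem (3 * s).+3 = (stack_step st v' (dev_label f (H (3 * s).+2)) v, v, f).
  rewrite memS e3 memS m1; move: dv; case: (H (3 * s).+2) => [?|?|c' w'|h' w'||] //=.
    by move=> [_ _ ->].
  by move=> [_ ->].
exists (stack_step st v' (dev_label f (H (3 * s).+2)) v), f; split=> //.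
exact: stack_all_step.
Qed.

Lemma challenger_round s v f : H (3 * s)%N = SProv Pl v -> H (3 * s).+1 = SFam f ->
  valid_fam R G lam beta f -> head v f.1.1.1 = v ->
  good_response (mem (3 * s)).1.1 v f (H (3 * s).+2) /\
  forall u, H (3 * s).+3 = SProv Pl u ->
    (mem (3 * s).+3).1.1 = stack_step (mem (3 * s)).1.1 v (dev_label f (H (3 * s).+2)) u.
Proof.
move=> e0 e1 vf hd; have [st [f0 [em al]]] := challenger_inv e0; rewrite em /=.
have m1 : mem (3 * s).+1 = (st, v, f) by rewrite memS em e1.
have := follow (n := (3 * s).+1); rewrite e1 => /(_ erefl); rewrite mkseqS e1 => e2.
have mm : cmem_of (rcons (mkseq H (3 * s).+1) (SFam f)) = (st, v, f) by rewrite -e1 -mkseqS.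
split; first by rewrite e2; apply: challenger_move (stack_all_top al) vf hd.
move=> u e3; have [v' [f' [_ e1' _ _]]] := red_back e3.
move: e1'; rewrite e1 => -[<-]; rewrite memS e3 memS m1.
by case: (H (3 * s).+2) => [?|?|c' w'|h' w'||] //= => [[_ _ ->]|[_ ->]].
Qed.

End Play.
End Challenger.
End FirstCycle.

Lemma pays_suffix_seg (R : nmodType) (V : finType) (g : V -> V -> R) (d : V) (p s : nat -> seq V) n r :
  p 0%N = [::] -> (forall n, p n.+1 = p n ++ s n) -> (forall n, s n != [::]) ->
  (r <= size (s n))%N ->
  exists e, pays g (suffix_from (chain_lim d p) (size (p n))) r = wsum g (take r (s n)) e.
Proof.
move=> p0 pS s0 rs; rewrite -wsum_mkseq; eexists; congr (wsum g _ _).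
apply: (@eq_from_nth _ d); rewrite size_mkseq ?size_takel // => k kr.
by rewrite nth_mkseq // nth_take // /suffix_from (chain_lim_segment d pS s0) // (leq_trans kr).
Qed.

Lemma size_take_leq (T : Type) (s : seq T) k b : (size s <= b)%N -> (size (take k s) <= b)%N.
Proof. by move=> h; rewrite size_take_min; apply: leq_trans (geq_minr _ _) h. Qed.

Section ChallengerWins.
Context (R : realType) (Pl V : finType) (G : game Pl V) (lam : V -> \bar rat) (i : Pl) (beta : int).
Context (pick : fam Pl V -> V -> seq V) (tailpick : fam Pl V -> nat -> V) (v0 : V) (a : R).
Hypothesis pickP : shortest_pick_spec R G lam i beta pick.
Hypothesis tailP : tail_pick_spec R G lam beta tailpick.

Let g := gain G i a.

(** The tail of the family leads from its start to a vertex with an edge to [w]. Removing the loops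
    of that walk gives an admissible history of at most [#|V|] vertices, and the chosen one is no
    longer. *)
Lemma pick_size f w : valid_fam R G lam beta f -> post_ok G i f w -> (size (pick f w) <= #|V|)%N.
Proof.
move=> vf po; have := pickP w vf; move: vf po.
case: f => [[[h c] x] W] /= [[y [t [eh _]]] [u [t' [ec _]]] _ [rho [pl [_ [occ eg]]]] _] [z zW [oz ez]].
have [k rk] := (occ z).1 zW.
have pt : path (edge G) (rho 0%N) (mkseq (fun n => rho n.+1) k).
  apply/(pathP (rho 0%N)) => n; rewrite size_mkseq => nk; rewrite nth_mkseq //.
  by case: n nk => [|n] nk //=; rewrite nth_mkseq 1?ltnW //; apply: pl.
have lt : last (rho 0%N) (mkseq (fun n => rho n.+1) k) = z.
  by rewrite -rk; case: (k) => // k'; rewrite mkseqS last_rcons.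
case: (shortenP pt) lt => p' pp' up' sub lt hpick.
have [|_ hmin] := hpick.
  exists (rho 0%N :: p'), (rho 0%N), p'; split=> //; split.
    by move: eg; rewrite ec.
  split=> //; split; last by rewrite /= lt.
  move=> v; rewrite inE => /orP[/eqP ->|/sub]; first by apply/occ; exists 0%N.
  by move=> /mapP[n _ ->]; apply/occ; exists n.+1.
apply: leq_trans (uniq_size_card up'); apply: hmin.
exists (rho 0%N), p'; split=> //; split; first by move: eg; rewrite ec.
split=> //; split; last by rewrite /= lt.
move=> v; rewrite inE => /orP[/eqP ->|/sub]; first by apply/occ; exists 0%N.
by move=> /mapP[n _ ->]; apply/occ; exists n.+1.
Qed.

(** [h], one interrupted lap and the final shortest history each have at most [#|V|] edges, and
    complete laps do not cost, whence the factor 3 whatever [N] is. *)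
Lemma segment_take_ge (M : R) N f d u r e : 0 <= M -> (forall x y, `|g x y| <= M) ->
  valid_fam R G lam beta f -> dev_ok G i f d u -> ~~ isbad (dev_label G i a f d) ->
  - (M * (3 * #|V|)%:R) <= wsum g (take r (dev_segment pick N f d)) e.
Proof.
move=> M0 gM vf dv nb; have [/andP[_ hV] /andP[_ cV] hp] := fam_sizes vf.
have lb s b e' : (size s <= b)%N -> - (M * b%:R) <= wsum g s e'.
  move=> sb; have := wsum_bound gM s e'; rewrite ler_norml -[M *+ _]mulr_natr => /andP[h _].
  by apply: le_trans h; rewrite lerN2 ler_wpM2l // ler_nat.
case: d dv nb => [v'|f'|c' w'|h' w'||] //=.
  move=> [_ po _]; case: ltP => // cge _.
  rewrite take_cat; case: ltnP => rh.
    apply: lb; apply: size_take_leq; by rewrite (leq_trans hV) // leq_pmull.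
  rewrite take_cat; set r' := (r - _)%N; case: ltnP => rc.
    rewrite wsum_cat.
    have h1 := lb _ _ (head e (take r' (ncat ((N + size f.1.1.1) * (N + size f.1.1.1)) f.1.1.2))) hV.
    have h2 := wsum_take_ncat_ge M0 gM cge ((N + size f.1.1.1) * (N + size f.1.1.1)) r' e.
    have h3 : M * (size f.1.1.2)%:R <= M * #|V|%:R by rewrite ler_wpM2l // ler_nat.
    have h4 : M * (3 * #|V|)%:R = 3 * (M * #|V|%:R) by rewrite natrM mulrCA.
    have h5 : 0 <= M * #|V|%:R by rewrite mulr_ge0.
    lra.
  rewrite !wsum_cat; set r'' := (r' - _)%N.
  set e1 := head _ _; set e2 := head _ _.
  have h1 := lb _ _ e1 hV.
  have := wsum_take_ncat_ge M0 gM cge ((N + size f.1.1.1) * (N + size f.1.1.1)) (size (ncat ((N + size f.1.1.1) * (N + size f.1.1.1)) f.1.1.2)) e2.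
  rewrite take_size => h2.
  have h6 : - (M * #|V|%:R) <= wsum g (take r'' (pick f w')) e.
    by apply: lb; apply: size_take_leq; apply: pick_size.
  have h3 : M * (size f.1.1.2)%:R <= M * #|V|%:R by rewrite ler_wpM2l // ler_nat.
  have h4 : M * (3 * #|V|)%:R = 3 * (M * #|V|%:R) by rewrite natrM mulrCA.
  lra.
move=> [po _] _; apply: lb.
have : prefix h' (f.1.1.1 ++ f.1.1.2) by move: po; case: f {vf hV cV hp} => [[[h0 c0] x0] W0] [].
by move=> /hp h; apply: size_take_leq; apply: (leq_trans h); rewrite leq_mul2r orbT.
Qed.

Lemma segment_pre N f d u : dev_ok G i f d u -> ~~ isgood (dev_label G i a f d) ->
  ~~ isbad (dev_label G i a f d) -> wsum g (dev_segment pick N f d) u = labw (dev_label G i a f d).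
Proof.
by case: d => [v'|f'|c' w'|h' w'||] //= => [_|[_ ->]] //; case: ifP.
Qed.

Lemma segment_post_size N f d u : valid_fam R G lam beta f -> dev_ok G i f d u ->
  isgood (dev_label G i a f d) -> ((N.+1) ^ 2 <= size (dev_segment pick N f d))%N.
Proof.
move=> /fam_sizes[/andP[h0 _] /andP[c0 _] _]; case: d => [v'|f'|c' w'|h' w'||] //= _ _.
rewrite !size_cat size_ncat.
have : ((N.+1) ^ 2 <= (N + size f.1.1.1) * (N + size f.1.1.1) * size f.1.1.2)%N.
  by rewrite (leq_trans _ (leq_pmulr _ c0)) // -mulnn leq_mul //; lia.
by move=> h; rewrite (leq_trans h) // addnCA leq_addr.
Qed.

(** Either [c] is at most [|K| / e] and the left side is bounded by a constant, or [|K|] is below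
    [e * c] and [c ^ 2 <= n] concludes. *)
Lemma absorb_sqrt (K e : R) : 0 < e -> exists n0 : nat, forall n c : nat, (n0 <= n)%N -> (c ^ 2 <= n)%N ->
  K * c%:R <= e * n%:R.
Proof.
move=> e0; have [n0 hn] := archi_bound (`|K| * (`|K| / e)) e0; exists n0 => n c ln cn.
have h1 : K * c%:R <= `|K| * c%:R by rewrite ler_wpM2r // ler_norm.
apply: (le_trans h1); case: (lerP (c%:R) (`|K| / e)) => hc.
  by apply: le_trans (hn n ln); rewrite ler_wpM2l.
move: hc; rewrite ltr_pdivrMr // => /ltW hc.
apply: (@le_trans _ _ (c%:R * e * c%:R)); first by rewrite ler_wpM2r.
by rewrite mulrC mulrA mulrC ler_wpM2l ?(ltW e0) // -natrM ler_nat mulnn.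
Qed.

(** After finitely many bad rounds, every loss is a constant plus a constant per good round. Good
    rounds lengthen the play quadratically, so their number is at most the square root of the
    date. *)
Lemma challenger_mp H vs fs p : red_rounds R G lam i beta pick v0 H vs fs p ->
  (forall st : nat -> seq (V * lab R), st 0%N = [::] ->
    (forall s, st s.+1 = stack_step (st s) (vs s) (dev_label G i a (fs s) (H (3 * s).+2)) (vs s.+1)) ->
    (forall s, vs s.+1 \in rcons (unzip1 (st s)) (vs s) ->
      ~~ pgood (stack_pop (st s) (vs s) (dev_label G i a (fs s) (H (3 * s).+2)) (vs s.+1))) ->
  (a%:E <= mp R G i (chain_lim v0 p))%E).
Proof.
move=> rr st st0 stS popC.
have p0 := rounds_p0 rr; have pS := rounds_pS rr; have s0 := rounds_seg_neq0 rr.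
have shd := rounds_seg_head rr.
case: (rr) => rnd _ _ _.
set sg := fun s => dev_segment pick (size (p s)) (fs s) (H (3 * s).+2) in pS s0 shd.
pose l s := dev_label G i a (fs s) (H (3 * s).+2).
have [M M0 gM] := finite_bound g.
pose W := M * (2 * #|V|)%:R; have W0 : 0 <= W by rewrite mulr_ge0.
have lW s : `|labw (l s)| <= W.
  by have [_ _ vf _ dv] := rnd s; apply: (dev_label_bound M0 gM vf dv).
have badc s := challenger_bad_count st0 stS popC s.
have wgt s := challenger_weight st0 stS W0 lW popC s.
have [b0 hb0] := bounded_count_eventually (b := fun k => isbad (l k)) badc.
pose C1 := M * (3 * #|V|)%:R; have C10 : 0 <= C1 by rewrite mulr_ge0.
pose WV := W * #|V|%:R; have WV0 : 0 <= WV by rewrite mulr_ge0.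
pose e_ s := wsum g (sg s) (vs s.+1).
have eE s : wsum g (p s) (vs s) = \sum_(k < s) e_ k.
  elim: s => [|s IH]; first by rewrite p0 big_ord0.
  have := chain_wsumS v0 pS s0 g s; rewrite !shd => ->.
  by rewrite big_ord_recr /= IH.
(* The gap between the weight really played and the label; [C1] compensates for the cost of a good
   round, whose label weighs 0. *)
pose del k := e_ k - labw (l k) + C1 * (isgood (l k))%:R.
have del0 k : (b0 <= k)%N -> 0 <= del k.
  move=> /hb0 nb; have [_ _ vf _ dv] := rnd k; rewrite /del; case: (boolP (isgood (l k))) => lg.
    have -> : labw (l k) = 0 by move: lg; rewrite /l; case: (dev_label _ _ _ _ _).
    have := segment_take_ge (size (p k)) (size (sg k)) (vs k.+1) M0 gM vf dv nb.
    rewrite /sg take_size -/(sg k) -/(e_ k) -/C1 mulr1; lra.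
  rewrite /e_ segment_pre // -/(l k) mulr0; lra.
pose K0 := \sum_(k < b0) `|del k|.
have sdel s : - K0 <= \sum_(k < s) del k.
  case: (leqP b0 s) => bs.
    rewrite -(subnKC bs) big_split_ord /= -[X in X <= _]addr0 lerD //.
      by rewrite -sumrN; apply: ler_sum => k _; rewrite lerNnormlW.
    by apply: sumr_ge0 => k _; apply: del0; rewrite leq_addr.
  apply: (@le_trans _ _ (- \sum_(k < s) `|del k|)).
    rewrite lerN2 /K0 -(subnKC (ltnW bs)) big_split_ord /= lerDl; exact: sumr_ge0.
  by rewrite -sumrN; apply: ler_sum => k _; rewrite lerNnormlW.
pose gam s := (\sum_(k < s) isgood (l k))%N.
have gamR s : (gam s)%:R = \sum_(k < s) (isgood (l k))%:R :> R by rewrite natr_sum.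
(* A good round at length [N] adds at least [(N+1)^2] vertices, more than the square of the new
   count requires. *)
have gam2 s : (gam s ^ 2 <= size (p s))%N.
  elim: s => [|s IH]; first by rewrite /gam big_ord0.
  rewrite /gam big_ord_recr /= -/(gam s) pS size_cat; case: (boolP (isgood (l s))) => lg.
    have [_ _ vf _ dv] := rnd s; have := segment_post_size (size (p s)) vf dv lg.
    rewrite -/(sg s) => h; nia.
  by rewrite addn0 (leq_trans IH) // leq_addr.
have lbS s : - (K0 + WV) - (WV + C1) * (gam s)%:R <= wsum g (p s) (vs s).
  have := sdel s; have := wgt s; rewrite -/WV eE gamR.
  have -> : \sum_(k < s) del k = \sum_(k < s) e_ k - \sum_(k < s) labw (l k) + C1 * \sum_(k < s) (isgood (l k))%:R.
    by rewrite mulr_sumr -sumrB -big_split.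
  rewrite -/(l _); lra.
apply/mp_geP => e e0; have e2 : 0 < e / 2 by lra.
have [n1 hn1] := archi_bound (K0 + WV + C1) e2.
have [n2 hn2] := absorb_sqrt (WV + C1) e2.
exists (n1 + n2 + size (p b0))%N => n ln.
have [s /andP[sn ns]] := chain_locate p0 pS s0 n.
have bs : (b0 <= s)%N.
  rewrite leqNgt; apply/negP => h; have := chain_mono pS h; lia.
have rs : (n - size (p s) <= size (sg s))%N by rewrite leq_subLR -size_cat -(pS s) ltnW.
rewrite -{2}(subnKC sn) paysD (chain_pays v0 pS s0) shd.
have [x ->] := pays_suffix_seg g v0 p0 pS s0 rs.
have [_ _ vf _ dv] := rnd s.
have h1 := segment_take_ge (size (p s)) (n - size (p s)) x M0 gM vf dv (hb0 s bs).
have h2 := lbS s.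
have h3 := hn1 n ltac:(lia).
have h4 := hn2 n (gam s) ltac:(lia) (leq_trans (gam2 s) sn).
rewrite -/C1 -/(sg s) in h1; lra.
Qed.

Lemma challenger_guarantee tP : ~ prover_wins G lam i beta a [::] v0 ->
  valid_rstrat R G lam i beta Prover tP ->
  (a%:E <= nuC R G i pick tailpick v0 (rout tP (challenger G lam i beta a v0) (SProv Pl v0)))%E.
Proof.
move=> lose hP; set H := rout _ _ _.
have rp : red_play R G lam i beta v0 H by apply: rout_red_play => //; apply: challenger_valid.
have follow n : rowner (H n) = Challenger -> H n.+1 = challenger G lam i beta a v0 (mkseq H n.+1).
  by move=> own; rewrite /H routS -/H own.
have [[n hn]|[s [v [f [e0 e1 vf e2 ->]]]]|[vs [fs [p [rr ->]]]]] := red_play_cases pick tailP rp.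
- by rewrite /nuC; case: pselect => [h|nh] /=; [exact: leey|case: nh; exists n].
- have hd : head v f.1.1.1 = v.
    by case: rp => _ /(_ (3 * s)%N); rewrite e0 e1 /= => -[].
  have [[[_ xa]|[u [+ _ _]]] _] := challenger_round rp follow lose e0 e1 vf hd; last by rewrite e2.
  by rewrite lee_fin.
- case: (rr) => rnd vs0 _ _.
  pose st s := (cmem_of G i a v0 (mkseq H (3 * s).+1)).1.1.
  have e3 s : (3 * s.+1 = (3 * s).+3)%N by lia.
  have stS s : st s.+1 = stack_step (st s) (vs s) (dev_label G i a (fs s) (H (3 * s).+2)) (vs s.+1).
    have [e0 e1 vf hd dv] := rnd s; have [_ h] := challenger_round rp follow lose e0 e1 vf hd.
    rewrite /st e3; apply: h; have [+ _ _ _ _] := rnd s.+1; by rewrite e3.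
  apply: (challenger_mp rr (st := st)) => //.
  move=> s; have [e0 e1 vf hd dv] := rnd s.
  have [[[e _]|[u [dok pop _]]] _] := challenger_round rp follow lose e0 e1 vf hd.
    by rewrite e in dv.
  by rewrite -(dev_ok_fun dok dv).
Qed.

End ChallengerWins.

(** * Prover wins the first cycle game *)

Section Outcomes.
Context (Pl V : finType) (G : game Pl V).
Implicit Types (sigma : Pl -> strat V) (pre : seq V) (w : V).

Lemma out_histE pre sigma w n : out_hist G pre sigma w n = mkseq (outcome G pre sigma w) n.+1.
Proof.
elim: n => // n IH; rewrite [RHS]mkseqS -IH /=; congr (rcons _ _).
by rewrite /outcome /= last_rcons.
Qed.

Lemma outcomeS pre sigma w n : outcome G pre sigma w n.+1 =
  sigma (owner G (outcome G pre sigma w n)) (pre ++ mkseq (outcome G pre sigma w) n.+1).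
Proof. by rewrite {1}/outcome /= last_rcons -/(outcome G pre sigma w n) out_histE. Qed.

Lemma outcome_play pre sigma w : (forall j, valid_strat G j (sigma j)) ->
  is_play G (outcome G pre sigma w).
Proof. by move=> h n; rewrite outcomeS mkseqS -rcons_cat; apply: h. Qed.

(** Leaving out the strategy of player [i] allows reading that player's moves off the play
    itself. *)
Definition cplay (i : Pl) sigma (v0 : V) (eta : nat -> V) : Prop :=
  [/\ eta 0%N = v0, is_play G eta &
      forall n, owner G (eta n) != i -> eta n.+1 = sigma (owner G (eta n)) (mkseq eta n.+1)].

Lemma upd_profile_valid i sigma t : (forall j, j != i -> valid_strat G j (sigma j)) ->
  valid_strat G i t -> forall j, valid_strat G j (upd_profile sigma i t j).
Proof. by move=> hs ht j; rewrite /upd_profile; case: eqP => [->|/eqP/hs]. Qed.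

Lemma outcome_cplay i sigma t v0 : (forall j, j != i -> valid_strat G j (sigma j)) ->
  valid_strat G i t -> cplay i sigma v0 (outcome G [::] (upd_profile sigma i t) v0).
Proof.
move=> hs ht; split=> //; first exact/outcome_play/upd_profile_valid.
by move=> n oi; rewrite outcomeS /upd_profile (negbTE oi).
Qed.

Definition succ_of (x : V) : V := projT1 (cid (edge_total G x)).

Lemma succ_ofP x : edge G x (succ_of x).
Proof. exact: (projT2 (cid (edge_total G x))). Qed.

(** The strategy replays [eta] as long as the history agrees with it, and moves legally
    otherwise. *)
Lemma cplay_outcome i sigma v0 eta : cplay i sigma v0 eta ->
  exists2 t, valid_strat G i t & outcome G [::] (upd_profile sigma i t) v0 = eta.
Proof.
move=> [e0 pl hs].
pose t (h : seq V) := if h == mkseq eta (size h) then eta (size h) else succ_of (last v0 h).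
exists t.
  move=> h x ox; rewrite /t; case: eqP => [e|_]; last by rewrite last_rcons; apply: succ_ofP.
  move: e; rewrite size_rcons mkseqS => /rcons_inj[_ ->]; exact: pl.
have key n : mkseq (outcome G [::] (upd_profile sigma i t) v0) n.+1 = mkseq eta n.+1.
  elim: n => [|n IH]; first by rewrite /mkseq /= e0.
  have hn : outcome G [::] (upd_profile sigma i t) v0 n = eta n.
    by have := congr1 (fun s => nth v0 s n) IH; rewrite !nth_mkseq.
  rewrite [LHS]mkseqS [RHS]mkseqS IH; congr (rcons _ _); rewrite outcomeS IH /= hn /upd_profile.
  case: (eqVneq (owner G (eta n)) i) => oi; last by rewrite hs.
  by rewrite /t size_mkseq eqxx.
by apply/funext => n; have := congr1 (fun s => nth v0 s n) (key n); rewrite !nth_mkseq.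
Qed.

End Outcomes.

Section UpperBounds.
Context (R : realType) (Pl V : finType) (G : game Pl V) (i : Pl) (a : R).

Lemma mp_le_bounded rho (C : R) :
  (forall n0, exists2 n, (n0 <= n)%N & pays (gain G i a) rho n <= C) -> (mp R G i rho <= a%:E)%E.
Proof.
move=> h; apply: mp_le => e e0 n0; have [n1 hn1] := archi_bound C e0.
have [n ln hn] := h (maxn n0 n1); exists n; first by rewrite (leq_trans _ ln) // leq_maxl.
by apply: (le_trans hn); apply: hn1; rewrite (leq_trans _ ln) // leq_maxr.
Qed.

(** At such dates the average is of order [K / N], and they recur with [N] unbounded. *)
Lemma mp_le_sqrt rho (K : R) :
  (forall N0 : nat, exists N, [/\ (N0 <= N)%N & exists2 n, (N * N <= n)%N &
     pays (gain G i a) rho n <= K * N%:R]) -> (mp R G i rho <= a%:E)%E.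
Proof.
move=> h; apply: mp_le => e e0 n0; have [n1 hn1] := archi_bound K e0.
have [N [hN [n nN hn]]] := h (n0 + n1 + 1)%N; exists n; first by nia.
apply: (le_trans hn); apply: (@le_trans _ _ (e * N%:R * N%:R)).
  by rewrite ler_wpM2r // hn1 //; lia.
by rewrite -mulrA -natrM ler_wpM2l ?(ltW e0) // ler_nat.
Qed.

Lemma wsum_repeat_le (g : V -> V -> R) (M : R) P c k e : 0 <= M -> (forall u v, `|g u v| <= M) ->
  c != [::] -> csum g c <= 0 -> wsum g (P ++ ncat k c) e <= M * (size P)%:R + (M + M).
Proof.
move=> M0 gM; case: c => // x t _ cle.
have h1 : wsum g (P ++ ncat k (x :: t)) e <= wsum g (P ++ ncat k (x :: t)) x + (M + M) by apply: wsum_end.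
apply: (le_trans h1); rewrite lerD2r wsum_cat wsum_ncat -[X in _ <= X]addr0 lerD //.
  have := wsum_bound gM P (head x (ncat k (x :: t))); rewrite ler_norml -[M *+ _]mulr_natr => /andP[] //.
by rewrite mulrn_wle0.
Qed.

End UpperBounds.

Lemma nth_ncat (V : finType) (d : V) k c n : (n < k * size c)%N ->
  nth d (ncat k c) n = nth d c (n %% size c).
Proof.
elim: k n => // k IH n; rewrite (_ : ncat k.+1 c = c ++ ncat k c) // nth_cat mulSn.
case: (ltnP n (size c)) => nc h; first by rewrite modn_small.
rewrite IH; last by lia.
by rewrite -[in RHS](subnK nc) modnDr.
Qed.

(** The last lap is kept nonempty, of [1 + n %% size c] vertices, so that the cut ends at the vertex
    of index [n]. *)
Lemma take_ncat (V : finType) k (c : seq V) n : (n < k * size c)%N ->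
  take n.+1 (ncat k c) = ncat (n %/ size c) c ++ take (n %% size c).+1 c.
Proof.
elim: k n => // k IH n; rewrite (_ : ncat k.+1 c = c ++ ncat k c) // mulSn => h.
have c0 : (0 < size c)%N by case: (c) h => //; rewrite /= muln0.
rewrite take_cat; case: ltnP => nc.
  by rewrite divn_small 1?ltnW // modn_small // ltnW.
move: nc; rewrite leq_eqVlt => /orP[/eqP e|nc].
  rewrite e subnn take0 cats0.
  by rewrite divn_small -?e // modn_small -?e // take_size.
have cn : (size c <= n)%N by rewrite -ltnS.
rewrite (_ : n.+1 - size c = (n - size c).+1)%N; last by lia.
rewrite IH; last by lia.
have e1 : (n %/ size c = (n - size c) %/ size c + 1)%N by rewrite -{1}(subnK cn) divnDr // divnn c0.
have e2 : (n %% size c = (n - size c) %% size c)%N by rewrite -{1}(subnK cn) modnDr.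
by rewrite e1 e2 addn1 catA.
Qed.

Lemma lam_consistent_suffix (R : realType) (Pl V : finType) (G : game Pl V) lam rho m :
  lam_consistent R G lam rho -> lam_consistent R G lam (suffix_from rho m).
Proof. by move=> h n; rewrite suffix_from_add; apply: h. Qed.

Section Coalition.
Context (R : realType) (Pl V : finType) (G : game Pl V) (lam : V -> \bar rat) (i : Pl) (beta : int).
Context (tailpick : fam Pl V -> nat -> V) (v0 : V) (a : R).
Hypothesis tailP : tail_pick_spec R G lam beta tailpick.
Implicit Types (f : fam Pl V) (st : seq (V * lab R)).

Let g := gain G i a.
Let pwins := prover_wins G lam i beta a.

Definition winning_family st v f : Prop :=
  [/\ valid_fam R G lam beta f, head v f.1.1.1 = v, ratr (f.1.2 i) < a,
    forall d u, dev_ok G i f d u -> u \in rcons (unzip1 st) v ->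
      pgood (stack_pop st v (dev_label G i a f d) u) &
    forall d u, dev_ok G i f d u -> u \notin rcons (unzip1 st) v ->
      pwins (rcons st (v, dev_label G i a f d)) u].

Lemma winning_family_ex st v : exists f, pwins st v -> winning_family st v f.
Proof.
case: (pselect (pwins st v)) => [w|nw].
  by case: w => {}st {}v f *; exists f.
by exists ([::], [::], fun=> 0, finset.set0) => /nw.
Qed.

Definition wfam st v : fam Pl V := projT1 (cid (winning_family_ex st v)).

Lemma wfamP st v : pwins st v -> winning_family st v (wfam st v).
Proof. exact: (projT2 (cid (winning_family_ex st v))). Qed.

(* [pT] is the date at which the current plan started, [ppos] the position in it. *)
Record pmem := PMem { pT : nat; pst : seq (V * lab R); pv : V; ppos : nat }.

Definition pfam (m : pmem) := wfam (pst m) (pv m).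

(* Repeating a nonnegative cycle only helps player [i], so it is played once. *)
Definition plaps (m : pmem) : nat :=
  let N := (pT m + size (pfam m).1.1.1)%N in
  if csum g (pfam m).1.1.2 < 0 then (N * N)%N else 1%N.

Definition plead (m : pmem) : seq V := (pfam m).1.1.1 ++ ncat (plaps m) (pfam m).1.1.2.
Definition pplan (m : pmem) : nat -> V := prepend (plead m) (tailpick (pfam m)).

(** The reduced game knows pre-cycle deviations only along [h c]; one occurring in a later lap is
    reported at the same place of the first lap. *)
Definition pdev (m : pmem) (y : V) : rstate Pl V :=
  let h := (pfam m).1.1.1 in let c := (pfam m).1.1.2 in
  if (ppos m < size (plead m))%N then
    SPre Pl (if (ppos m < size h)%N then take (ppos m).+1 h
             else h ++ take ((ppos m - size h) %% size c).+1 c) y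
  else SPost Pl c y.

Definition plabel m y := dev_label G i a (pfam m) (pdev m y).

Definition pupd (m : pmem) (y : V) : pmem :=
  if y == pplan m (ppos m).+1 then PMem (pT m) (pst m) (pv m) (ppos m).+1
  else PMem (pT m + ppos m).+1 (stack_step (pst m) (pv m) (plabel m y) y) y 0.

Definition pmem_of (hist : seq V) : pmem := foldl pupd (PMem 0 [::] v0 0) (behead hist).

(** One function for all players: it also serves player [i] as the strategy witnessing rationality.
    The fallback gives a legal move on histories that no plan describes. *)
Definition coalition (hist : seq V) : V :=
  let y := pplan (pmem_of hist) (ppos (pmem_of hist)).+1 in
  if edge G (last v0 hist) y then y else succ_of G (last v0 hist).

Lemma coalition_valid j : valid_strat G j coalition.
Proof. by move=> h x _; rewrite /coalition last_rcons; case: ifP => // _; apply: succ_ofP. Qed.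

Lemma pmem_of_rcons hist y : hist != [::] -> pmem_of (rcons hist y) = pupd (pmem_of hist) y.
Proof. by case: hist => // x t _; rewrite /pmem_of /= -cats1 foldl_cat. Qed.

Definition plan_inv (m : pmem) (x : V) : Prop :=
  [/\ pplan m (ppos m) = x, stack_all pwins (pst m) (pv m) & uniq (rcons (unzip1 (pst m)) (pv m))].

Section Plan.
Context (m : pmem).
Hypothesis al : stack_all pwins (pst m) (pv m).

Let f := pfam m.
Let wf : winning_family (pst m) (pv m) f.
Proof. by apply: wfamP; apply: stack_all_top. Qed.

Lemma plan_fam_tail : fam_tail R G f (tailpick f).
Proof. by case: wf => vf _ _ _ _; apply: tailP. Qed.

Lemma plan_sizes : (0 < size f.1.1.1)%N /\ (0 < size f.1.1.2)%N.
Proof. by case: wf => /fam_sizes[/andP[? _] /andP[? _] _]. Qed.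

Lemma plaps_gt0 : (0 < plaps m)%N.
Proof. by have [h0 _] := plan_sizes; rewrite /plaps -/f; case: ifP => // _; rewrite muln_gt0; lia. Qed.

Lemma plan_play : is_play G (pplan m).
Proof.
have := plan_fam_tail; case: wf => + _ _ _ _; rewrite /pplan /plead -/f.
have := plaps_gt0; move: (plaps m).
case: f => [[[h c] x] W] k k0 /= [[y [t [eh [ph _]]]] [u [t' [ec [cc [_ lu]]]]] _ _ _] [pl [_ [_ eg]]].
apply: prepend_play => //; rewrite wpath_cat; apply/andP; split.
  have -> : head (tailpick (h, c, x, W) 0%N) (ncat k c) = u by rewrite ec; case: (k) k0.
  by rewrite eh wpath_cons rcons_path ph /=; move: lu; rewrite eh.
case: k k0 => // k _; rewrite (_ : ncat k.+1 c = ncat k c ++ c); last first.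
  by rewrite /ncat -addn1 nseqD flatten_cat /= cats0.
have wc e : edge G (last u c) e -> wpath (edge G) c e.
  rewrite ec wpath_cons rcons_path /= => ->; rewrite andbT.
  by move: cc; rewrite ec /= rcons_path => /andP[].
have hc : head (tailpick (h, c, x, W) 0%N) c = u by rewrite ec.
have lc d : last d c = last u c by rewrite ec.
rewrite wpath_cat hc wc; last by move: eg; rewrite lc.
rewrite andbT {1}ec; apply: wpath_ncat; rewrite -ec; apply: wc.
by move: cc; rewrite ec /= rcons_path => /andP[].
Qed.

Lemma plan0 : pplan m 0 = pv m.
Proof.
rewrite /pplan prepend0 /plead -/f; case: wf => vf hd _ _ _; have [h0 _] := plan_sizes.
by move: hd h0; case: f {vf} => [[[h c] x] W] /=; case: h.
Qed.

Lemma plan_consistent : lam_consistent R G lam (pplan m).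
Proof.
have tl := plan_fam_tail; case: wf => + _ _ _ _; rewrite /pplan /plead -/f.
have := plaps_gt0; move: (plaps m) tl.
by case: f => [[[h c] x] W] k tl k0 /= [_ _ _ _]; apply.
Qed.

Lemma plan_mp : mp R G i (pplan m) = (ratr (f.1.2 i) : R)%:E.
Proof.
rewrite /pplan mp_prepend -/f; have := plan_fam_tail.
by case: f => [[[h c] x] W] [_ [+ _]]; apply.
Qed.

(** The complete laps missing from [h'] have nonpositive weight, since more than one lap is planned
    only for a negative cycle. The path played is thus no better for player [i] than its label
    says. *)
Lemma plan_pre_end k : (k < size (plead m))%N -> forall y,
  let h' := (if (k < size f.1.1.1)%N then take k.+1 f.1.1.1
             else f.1.1.1 ++ take ((k - size f.1.1.1) %% size f.1.1.2).+1 f.1.1.2) in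
  [/\ h' != [::], prefix h' (f.1.1.1 ++ f.1.1.2), last y h' = pplan m k &
      wsum g (mkseq (pplan m) k.+1) y <= wsum g h' y].
Proof.
move=> kl y h'; have [h0 c0] := plan_sizes.
have mk : mkseq (pplan m) k.+1 = take k.+1 (plead m).
  apply: (@eq_from_nth _ y); rewrite size_mkseq ?size_takel // => n nk.
  by rewrite nth_mkseq // nth_take // /pplan (prepend_lt _ y) // (leq_trans nk).
have lk : pplan m k = nth y (plead m) k by rewrite /pplan (prepend_lt _ y).
rewrite /h' {h'}; case: ltnP => kh.
  split.
  - by rewrite -size_eq0 size_takel.
  - by rewrite (catl_prefix (s3 := drop k.+1 f.1.1.1)) // cat_take_drop prefix_prefix.
  - by rewrite lk /plead -/f nth_cat kh -nth_last size_takel // nth_take.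
  - by rewrite mk /plead -/f takel_cat.
set r := (k - size f.1.1.1)%N.
have rk : (r < plaps m * size f.1.1.2)%N.
  by move: kl; rewrite /plead -/f size_cat size_ncat /r; lia.
have rc : (r %% size f.1.1.2 < size f.1.1.2)%N by rewrite ltn_mod.
have ct : take (r %% size f.1.1.2).+1 f.1.1.2 != [::] by rewrite -size_eq0 size_takel.
split.
- by rewrite -size_eq0 size_cat; case: (f.1.1.1) h0.
- apply/prefixP; exists (drop (r %% size f.1.1.2).+1 f.1.1.2).
  by rewrite -catA cat_take_drop.
- rewrite lk /plead -/f nth_cat ltnNge kh /= -/r nth_ncat // last_cat -nth_last size_takel // nth_take //.
  by apply: set_nth_default.
- rewrite mk /plead -/f take_cat ltnNge (leq_trans kh (leqnSn k)) /=.
  rewrite (_ : k.+1 - size f.1.1.1 = r.+1)%N; last by rewrite /r; lia.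
  rewrite take_ncat // !wsum_cat; set q := (r %/ _)%N; set t := take _ f.1.1.2.
  have hd e : head e t = head y f.1.1.2 by rewrite /t head_take //; case: (f.1.1.2) c0.
  have hd2 e : head e (ncat q f.1.1.2 ++ t) = head y f.1.1.2.
    by case: (q) => [|q']; rewrite /= ?hd //; case: (f.1.1.2) c0.
  rewrite hd2 !hd lerD2l gerDr.
  have -> : wsum g (ncat q f.1.1.2) (head y f.1.1.2) = csum g f.1.1.2 *+ q.
    by case: (f.1.1.2) c0 => // z s _; rewrite wsum_ncat.
  have : (q < plaps m)%N by rewrite /q ltn_divLR.
  rewrite /plaps -/f; case: ltP => [cn _|_]; first by rewrite mulrn_wle0 // ltW.
  by case: (q) => // _; rewrite mulr0n.
Qed.

Lemma plan_dev_ok y : owner G (pplan m (ppos m)) = i -> edge G (pplan m (ppos m)) y ->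
  dev_ok G i f (pdev m y) y.
Proof.
move=> ow eg; rewrite /pdev -/f; case: ltnP => pl.
  split=> //; have [h1 h2 h3 _] := plan_pre_end pl y.
  rewrite /pre_ok; case: f h1 h2 h3 => [[[h c] x] W] /= h1 h2 h3.
  by split=> //; rewrite h3.
split=> //; have := plan_fam_tail; move: ow eg.
rewrite -(subnKC pl) /pplan prepend_ge -/f; case: f => [[[h c] x] W] /= ow eg [_ [_ [occ _]]].
by exists (tailpick (h, c, x, W) (ppos m - size (plead m))%N) => //; apply/occ; eexists.
Qed.

End Plan.

Lemma plan_inv_step m x y : plan_inv m x -> edge G x y ->
  (owner G x != i -> y = pplan m (ppos m).+1) -> plan_inv (pupd m y) y.
Proof.
move=> [px al un] eg hy; rewrite /pupd; case: eqP => [->|ny]; first by split.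
have ow : owner G x = i by apply/eqP; apply: contraT => /hy.
have dv := plan_dev_ok al; rewrite px in dv; have {}dv := dv y ow eg.
have [_ _ _ _ push] := wfamP (stack_all_top al).
have al' : stack_all pwins (stack_step (pst m) (pv m) (plabel m y) y) y.
  by apply: stack_all_step => // yn; apply: push.
split=> //=; last exact: stack_step_uniq.
exact: (plan0 (m := PMem (pT m + ppos m).+1 _ y 0) al').
Qed.

Section CoalitionPayoff.
Hypothesis win : pwins [::] v0.

Lemma plan_inv0 : plan_inv (pmem_of [:: v0]) v0.
Proof.
have al : stack_all pwins [::] v0 by move=> k; rewrite leqn0 => /eqP ->.
by split=> //; apply: (plan0 (m := PMem 0 [::] v0 0) al).
Qed.

Lemma coalition_follow m hist : plan_inv m (last v0 hist) -> m = pmem_of hist ->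
  coalition hist = pplan m (ppos m).+1.
Proof.
move=> [px al _] em; rewrite /coalition -em -px.
by rewrite (plan_play al).
Qed.

Lemma compatible_plan_inv h : compatible G i (fun=> coalition) v0 h ->
  plan_inv (pmem_of h) (last v0 h) /\ h != [::].
Proof.
move=> [t [-> [pt hs]]]; split=> //.
have key n : (n <= size t)%N -> plan_inv (pmem_of (take n.+1 (v0 :: t))) (nth v0 (v0 :: t) n).
  elim: n => [_|n IH nt]; first by rewrite /= take0; apply: plan_inv0.
  have {}IH := IH (ltnW nt).
  have tk : take n.+2 (v0 :: t) = rcons (take n.+1 (v0 :: t)) (nth v0 (v0 :: t) n.+1).
    by rewrite (take_nth v0).
  rewrite tk pmem_of_rcons //; apply: (plan_inv_step IH).
    exact: (pathP v0 pt).
  have lt : last v0 (take n.+1 (v0 :: t)) = nth v0 (v0 :: t) n.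
    by rewrite (take_nth v0) ?last_rcons //= ltnS ltnW.
  move=> ow; rewrite hs //; apply: coalition_follow => //.
  rewrite lt; exact: IH.
have := key (size t) (leqnn _); rewrite take_oversize //=.
by rewrite (last_nth v0).
Qed.

Lemma plan_outcome h x : plan_inv (pmem_of (rcons h x)) x -> forall n,
  let eta := outcome G h (fun=> coalition) x in let m := pmem_of (rcons h x) in
  eta n = pplan m (ppos m + n) /\
  pmem_of (h ++ mkseq eta n.+1) = PMem (pT m) (pst m) (pv m) (ppos m + n).
Proof.
move=> inv n eta m; elim: n => [|n [IH1 IH2]].
  by rewrite addn0 cats1 /eta /=; split; [case: inv|rewrite -/m; case: (m)].
have [px al un] := inv.
have eS : eta n.+1 = pplan m (ppos m + n).+1.
  rewrite /eta outcomeS -/eta; have := @coalition_follow (PMem (pT m) (pst m) (pv m) (ppos m + n)) (h ++ mkseq eta n.+1).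
  rewrite /= => -> //; split=> //=; rewrite mkseqS -rcons_cat last_rcons; exact: esym.
rewrite eS addnS; split=> //.
rewrite mkseqS -rcons_cat pmem_of_rcons; last by rewrite -size_eq0 size_cat size_mkseq addnS.
by rewrite IH2 /pupd /= eS eqxx.
Qed.

(** After any compatible history the play that follows is a suffix of the current plan, an element
    of a lambda-consistent family. *)
Lemma coalition_rational : lam_rational R G lam i (fun=> coalition) v0.
Proof.
exists coalition; split; first exact: coalition_valid.
have -> : upd_profile (fun=> coalition) i coalition = (fun=> coalition).
  by apply/funext => j; rewrite /upd_profile; case: ifP.
move=> h ch; have [inv _] := compatible_plan_inv ch; have [t [eh _]] := ch.
rewrite eh /=; set x := last v0 t.
have hx : h = rcons (belast v0 t) x by rewrite eh lastI.
have {}inv : plan_inv (pmem_of (rcons (belast v0 t) x)) x.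
  by move: inv; rewrite hx last_rcons.
have -> : outcome G (belast v0 t) (fun=> coalition) x =
    suffix_from (pplan (pmem_of (rcons (belast v0 t) x))) (ppos (pmem_of (rcons (belast v0 t) x))).
  by apply/funext => n; have [-> _] := plan_outcome inv n.
apply: lam_consistent_suffix; apply: plan_consistent; by case: inv.
Qed.

Context (eta : nat -> V).

Hypothesis cp : cplay G i (fun=> coalition) v0 eta.

Let m n := pmem_of (mkseq eta n.+1).

Let mS n : m n.+1 = pupd (m n) (eta n.+1).
Proof. by rewrite /m mkseqS pmem_of_rcons. Qed.

Let inv n : plan_inv (m n) (eta n).
Proof.
have [e0 pl hs] := cp.
elim: n => [|n IH]; first by rewrite /m /mkseq /= e0; apply: plan_inv0.
rewrite mS; apply: (plan_inv_step IH (pl n)) => ow.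
by rewrite hs //; apply: coalition_follow => //; rewrite mkseqS last_rcons.
Qed.

Let timeE n : (pT (m n) + ppos (m n) = n)%N.
Proof.
elim: n => // n IH; rewrite mS /pupd; case: eqP => _ /=; first by rewrite addnS IH.
by rewrite addn0 IH.
Qed.

Let dev n : bool := eta n.+1 != pplan (m n) (ppos (m n)).+1.

Let follow_run n k : (forall j, (j < k)%N -> ~~ dev (n + j)) ->
  m (n + k) = PMem (pT (m n)) (pst (m n)) (pv (m n)) (ppos (m n) + k).
Proof.
elim: k => [_|k IH h]; first by rewrite !addn0; case: (m n).
have {}IH := IH (fun j jk => h j (ltnW jk)).
have := h k (ltnSn k); rewrite /dev negbK addnS mS /pupd => /eqP e.
by rewrite e eqxx IH /= addnS.
Qed.

Lemma coalition_finite n0 : (forall n, (n0 <= n)%N -> ~~ dev n) -> (mp R G i eta <= a%:E)%E.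
Proof.
move=> h.
have e : suffix_from eta n0 = suffix_from (pplan (m n0)) (ppos (m n0)).
  apply/funext => k; rewrite /suffix_from; have [+ _ _] := inv (n0 + k).
  by rewrite follow_run => [<-|j _] //; apply: h; rewrite leq_addr.
have [_ al _] := inv n0.
rewrite -(mp_suffix R G i eta n0) e mp_suffix (plan_mp al) lee_fin ltW //.
by have [] := wfamP (stack_all_top al).
Qed.

Section Infinite.
Hypothesis infdev : forall n0, exists2 n, (n0 <= n)%N & dev n.

Let next_dev n : exists k, dev (n + k) /\ forall j, (j < k)%N -> ~~ dev (n + j).
Proof.
have ex : exists k, dev (n + k).
  by have [n' nn' d] := infdev n; exists (n' - n)%N; rewrite subnKC.
case: (ex_minnP ex) => k dk kmin; exists k; split=> // j jk; apply/negP => dj.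
by have := kmin j dj; rewrite leqNgt jk.
Qed.

Let kk := projT1 (choice next_dev).
Let kkP n : dev (n + kk n) /\ forall j, (j < kk n)%N -> ~~ dev (n + j) := projT2 (choice next_dev) n.

Let E s := iter s (fun n => (n + kk n).+1) 0%N.
Let k_ s := kk (E s).
Let ms s := m (E s).

Let ES s : E s.+1 = (E s + k_ s).+1.
Proof. by []. Qed.

Let run s j : (j <= k_ s)%N -> m (E s + j) = PMem (pT (ms s)) (pst (ms s)) (pv (ms s)) (ppos (ms s) + j).
Proof.
by move=> jk; apply: follow_run => l lj; have [_ h] := kkP (E s); apply: h; apply: leq_trans jk.
Qed.

Let lastm s := PMem (pT (ms s)) (pst (ms s)) (pv (ms s)) (ppos (ms s) + k_ s).
Let l s : lab R := plabel (lastm s) (eta (E s.+1)).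

Let msS s : ms s.+1 = PMem (E s.+1) (stack_step (pst (ms s)) (pv (ms s)) (l s) (eta (E s.+1))) (eta (E s.+1)) 0.
Proof.
have [d _] := kkP (E s); move: d; rewrite /dev -ES /ms ES mS -/(k_ s) /pupd => /negbTE ->.
have r := run (leqnn (k_ s)); rewrite r /=.
have := timeE (E s + k_ s); rewrite r /= => ->.
by congr PMem; rewrite /l /plabel -ES.
Qed.

Let pos0 s : ppos (ms s) = 0%N.
Proof. by case: s => [|s]; rewrite ?msS. Qed.

Let pTE s : pT (ms s) = E s.
Proof. by have := timeE (E s); rewrite -/(ms s) pos0 addn0. Qed.

Let pvE s : pv (ms s) = eta (E s).
Proof. by case: s => [|s]; rewrite ?msS //; have [-> _ _] := cp. Qed.

Let al s : stack_all (pwins) (pst (ms s)) (pv (ms s)).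
Proof. by have [] := inv (E s). Qed.

Let etaE s j : (j <= k_ s)%N -> eta (E s + j) = pplan (ms s) j.
Proof. by move=> jk; have [<- _ _] := inv (E s + j); rewrite run // pos0. Qed.

Let devok s : dev_ok G i (pfam (ms s)) (pdev (lastm s) (eta (E s.+1))) (eta (E s.+1)).
Proof.
have [_ pl hs] := cp.
have e : eta (E s + k_ s) = pplan (lastm s) (ppos (lastm s)) by rewrite etaE //= pos0.
have ow : owner G (pplan (lastm s) (ppos (lastm s))) = i.
  rewrite -e; apply/eqP; apply: contraT => ow; have [d _] := kkP (E s); move: d.
  rewrite /dev -/(k_ s) hs // (@coalition_follow (m (E s + k_ s))) ?eqxx //.
  by rewrite mkseqS last_rcons; apply: inv.
have eg : edge G (pplan (lastm s) (ppos (lastm s))) (eta (E s.+1)) by rewrite -e ES; apply: pl.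
exact: (plan_dev_ok (m := lastm s) (@al s) ow eg).
Qed.

Let Ege s : (s <= E s)%N.
Proof. by elim: s => // s IH; rewrite ES ltnS (leq_trans IH) // leq_addr. Qed.

Let seg_sum s : pays g eta (E s.+1) = pays g eta (E s) + wsum g (mkseq (pplan (ms s)) (k_ s).+1) (eta (E s.+1)).
Proof.
have e : suffix_from eta (E s) (k_ s).+1 = eta (E s.+1) by rewrite /suffix_from addnS.
have -> : pays g eta (E s.+1) = pays g eta (E s + (k_ s).+1) by rewrite addnS.
rewrite paysD -[pays _ (suffix_from _ _) _]wsum_mkseq e; congr (_ + wsum g _ _).
apply: (@eq_from_nth _ v0); rewrite ?size_mkseq // => j jk.
by rewrite !nth_mkseq // /suffix_from etaE.
Qed.

Let seg_pre s : ~~ isgood (l s) -> ~~ isbad (l s) -> pays g eta (E s.+1) <= pays g eta (E s) + labw (l s).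
Proof.
move=> ng nb; rewrite seg_sum lerD2l; move: ng nb.
rewrite /l /plabel /pdev; case: ltnP => [pl _ _|_]; last by rewrite /dev_label; case: ifP.
have [_ _ _ h] := plan_pre_end (m := lastm s) (@al s) pl (eta (E s.+1)).
have e : ppos (lastm s) = k_ s by rewrite /lastm pos0.
rewrite e in h *; exact: h.
Qed.

Let M := projT1 (cid2 (finite_bound g)).
Let M0 : 0 <= M. Proof. exact: (s2valP (cid2 (finite_bound g))). Qed.
Let gM u v : `|g u v| <= M. Proof. exact: (s2valP' (cid2 (finite_bound g))). Qed.

(** A bad round runs all [N * N] laps. When they end the sum is at most [M * N] for what precedes
    them plus [2 * M] for the last edge, hence at most [3 * M * N]. *)
Let seg_bad s : isbad (l s) -> exists N n, [/\ (E s <= N)%N, (N * N <= n)%N & pays g eta n <= M * 3 * N%:R].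
Proof.
set f := pfam (ms s).
have e : ppos (lastm s) = k_ s by rewrite /lastm pos0.
rewrite /l /plabel /pdev e; case: ltnP => // pl.
change (is_true (size (plead (ms s)) <= k_ s)%N) in pl.
change (isbad (if csum g f.1.1.2 < 0 then @LBad R else @LGood R) -> exists N n, [/\ (E s <= N)%N, (N * N <= n)%N & pays g eta n <= M * 3 * N%:R]).
case: ltP => // cn _.
have [h0 c0] := plan_sizes (@al s); rewrite -/f in h0 c0.
pose N := (E s + size f.1.1.1)%N.
have lapsE : plaps (ms s) = (N * N)%N by rewrite /plaps -/f cn pTE.
have szE : size (plead (ms s)) = (size f.1.1.1 + N * N * size f.1.1.2)%N.
  by rewrite /plead -/f size_cat size_ncat lapsE.
exists N, (E s + size (plead (ms s)))%N; split; first exact: leq_addr.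
  rewrite szE (leq_trans (leq_pmulr (N * N) c0)) //; lia.
rewrite paysD -[pays _ (suffix_from _ _) _]wsum_mkseq.
have -> : mkseq (suffix_from eta (E s)) (size (plead (ms s))) = plead (ms s).
  apply: (@eq_from_nth _ v0); rewrite ?size_mkseq // => j jk.
  rewrite nth_mkseq // /suffix_from etaE; last exact: leq_trans (ltnW jk) pl.
  by rewrite /pplan (prepend_lt _ v0).
have cne : f.1.1.2 != [::] by rewrite -size_eq0 -lt0n.
have h1 := wsum_repeat_le f.1.1.1 (N * N) (suffix_from eta (E s) (size (plead (ms s)))) M0 gM cne (ltW cn).
have h2 := pays_bound gM eta (E s); move: h2; rewrite ler_norml -[M *+ _]mulr_natr => /andP[_ h2].
rewrite /plead -/f lapsE.
have h3 : M * N%:R = M * (E s)%:R + M * (size f.1.1.1)%:R by rewrite /N natrD mulrDr.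
have h4 : M <= M * N%:R by rewrite ler_peMr // (ler_nat _ 1) /N; lia.
rewrite /plead -/f lapsE in h1; lra.
Qed.

Let pop_good s : eta (E s.+1) \in rcons (unzip1 (pst (ms s))) (eta (E s)) ->
  pgood (stack_pop (pst (ms s)) (eta (E s)) (l s) (eta (E s.+1))).
Proof.
by rewrite -(pvE s); have [_ _ _ h _] := wfamP (stack_all_top (@al s)); apply: h; apply: devok.
Qed.

Lemma coalition_infinite : (mp R G i eta <= a%:E)%E.
Proof.
have st0 : pst (ms 0) = [::] by [].
have stS s : pst (ms s.+1) = stack_step (pst (ms s)) (eta (E s)) (l s) (eta (E s.+1)).
  by rewrite msS /= pvE.
have [inf|fin] := pselect (forall s0, exists2 s, (s0 <= s)%N & isbad (l s)).
  apply: (@mp_le_sqrt _ _ _ _ _ _ _ (M * 3)) => N0; have [s ss /seg_bad[N [n [EN Nn hn]]]] := inf N0.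
  exists N; split; first exact: leq_trans ss (leq_trans (Ege s) EN).
  by exists n.
have [s0 hs0] : exists s0, forall s, (s0 <= s)%N -> ~~ isbad (l s).
  move/existsNP: fin => [s0 h]; exists s0 => s ss; apply/negP => b; apply: h; by exists s.
have badb s : \sum_(k < s) (isbad (l k))%:R <= s0%:R :> R.
  rewrite -natr_sum ler_nat; case: (leqP s s0) => ss.
    by rewrite (leq_trans _ ss) // -[X in (_ <= X)%N]card_ord -sum1_card leq_sum // => k _; apply: leq_b1.
  rewrite -(subnKC (ltnW ss)) big_split_ord /= [X in (_ + X)%N]big1 ?addn0.
    by rewrite -[X in (_ <= X)%N]card_ord -sum1_card leq_sum // => k _; apply: leq_b1.
  by move=> k _; rewrite (negbTE (hs0 _ _)) // leq_addr.
(* With finitely many bad rounds the charging also bounds the good ones, so from [s2] on only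
   pre-cycle deviations remain, and their labels bound the weight played. *)
have [s1 hs1] : exists s1, forall s, (s1 <= s)%N -> ~~ isgood (l s).
  apply: (@bounded_count_eventually R _ (#|V|%:R * (1 + s0%:R))) => s.
  apply: (le_trans (prover_good_count st0 stS pop_good s)).
  by rewrite ler_wpM2l // lerD2l.
pose W := M * (2 * #|V|)%:R; have W0 : 0 <= W by rewrite mulr_ge0.
have lW s : `|labw (l s)| <= W.
  have [vf _ _ _ _] := wfamP (stack_all_top (@al s)); exact: (dev_label_bound M0 gM vf (devok s)).
have wgt s := prover_weight st0 stS W0 lW pop_good s.
pose s2 := (s0 + s1)%N.
pose C := pays g eta (E s2) - \sum_(k < s2) labw (l k) + W * #|V|%:R * (1 + s0%:R).
apply: (@mp_le_bounded _ _ _ _ _ _ _ C) => n0; exists (E (s2 + n0)).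
  by rewrite (leq_trans _ (Ege _)) // leq_addl.
have h s : (s2 <= s)%N -> pays g eta (E s) - \sum_(k < s) labw (l k) <= pays g eta (E s2) - \sum_(k < s2) labw (l k).
  elim: s => [|s IH]; first by rewrite leqn0 => /eqP ->.
  rewrite leq_eqVlt => /orP[/eqP <- //|]; rewrite ltnS => ss.
  have ng : ~~ isgood (l s) by apply: hs1; rewrite /s2 in ss; lia.
  have nb : ~~ isbad (l s) by apply: hs0; rewrite /s2 in ss; lia.
  have := IH ss; have := seg_pre ng nb; rewrite big_ord_recr /=; lra.
have := h (s2 + n0)%N (leq_addr _ _); have := wgt (s2 + n0)%N.
have : W * #|V|%:R * (1 + \sum_(k < s2 + n0) (isbad (l k))%:R) <= W * #|V|%:R * (1 + s0%:R).
  by rewrite ler_wpM2l ?mulr_ge0 // lerD2l.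
rewrite /C; lra.
Qed.

End Infinite.

Lemma coalition_payoff : (mp R G i eta <= a%:E)%E.
Proof.
have [h|h] := pselect (forall n0, exists2 n, (n0 <= n)%N & dev n); first exact: coalition_infinite.
move/existsNP: h => [n0 h]; apply: (@coalition_finite n0) => n nn; apply/negP => d; apply: h.
by exists n.
Qed.

End CoalitionPayoff.
End Coalition.

Lemma nego_le (R : realType) (Pl V : finType) (G : game Pl V) lam i beta tailpick v0 (a : R) :
  owner G v0 = i -> tail_pick_spec R G lam beta tailpick ->
  prover_wins G lam i beta a [::] v0 -> (nego R G lam v0 <= a%:E)%E.
Proof.
move=> ow tailP win; rewrite /nego ow.
pose sigma := coalition G lam i beta tailpick v0 a.
apply: (@le_trans _ _ (ereal_sup [set mp R G i (outcome G [::] (upd_profile (fun=> sigma) i t) v0)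
    | t in [set t | valid_strat G i t]]%classic)).
  apply: ereal_inf_lbound; exists (fun=> sigma) => //; split.
    by move=> j _; apply: coalition_valid.
  exact: coalition_rational.
apply: ge_ereal_sup => _ [t vt <-]; apply: (coalition_payoff tailP win).
by apply: outcome_cplay => // j _; apply: coalition_valid.
Qed.

(** * Prover simulates a rational coalition *)

Lemma csum_rot1 (R : nmodType) (V : finType) (g : V -> V -> R) u t :
  csum g (rcons t u) = csum g (u :: t).
Proof. by case: t => [|x t] //; rewrite -[LHS]/(wsum g (rcons (x :: t) u) x) wsum_rcons addrC. Qed.

Section CompatibleHistories.
Context (Pl V : finType) (G : game Pl V) (i : Pl) (sigma : Pl -> strat V) (v0 : V).

Lemma compatible1 : compatible G i sigma v0 [:: v0].
Proof. by exists [::]. Qed.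

Lemma compatible_rcons h x y : compatible G i sigma v0 (rcons h x) -> edge G x y ->
  (owner G x != i -> y = sigma (owner G x) (rcons h x)) ->
  compatible G i sigma v0 (rcons (rcons h x) y).
Proof.
move=> [t [e [pt hs]]] eg hy; exists (rcons t y); rewrite e rcons_cons; split=> //.
rewrite -rcons_cons -e.
have lx : last v0 t = x by rewrite -[LHS]/(last v0 (v0 :: t)) -e last_rcons.
split; first by rewrite rcons_path pt lx.
move=> k; rewrite size_rcons ltnS => kl.
rewrite nth_rcons kl; move: (kl); rewrite leq_eqVlt => /orP[/eqP ke|kl'].
  have -> : nth v0 (rcons h x) k = x.
    by rewrite nth_rcons; move: ke; rewrite size_rcons => -[->]; rewrite ltnn eqxx.
  move=> /hy ->; rewrite nth_rcons ke ltnn eqxx; congr (sigma _ _).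
  by rewrite -[rcons (rcons h x) _]cats1 take_size_cat.
move=> oi; rewrite nth_rcons kl' hs //; congr (sigma _ _).
by rewrite -[rcons (rcons h x) y]cats1 takel_cat.
Qed.

Lemma cplay_of_prefixes eta :
  (forall n0, exists2 n, (n0 <= n)%N & compatible G i sigma v0 (mkseq eta n)) ->
  cplay G i sigma v0 eta.
Proof.
move=> h; split.
- have [n n0 [t [e _]]] := h 1%N; have := congr1 (fun s => nth v0 s 0) e.
  by rewrite nth_mkseq.
- move=> k; have [n nk [t [e [pt _]]]] := h k.+2.
  have kt : (k < size t)%N by have := congr1 size e; rewrite size_mkseq /=; lia.
  have := pathP v0 pt k kt; have -> : nth v0 t k = nth v0 (v0 :: t) k.+1 by [].
  by rewrite -e !nth_mkseq //; lia.
- move=> k oi; have [n nk [t [e [_ hs]]]] := h k.+2.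
  have := hs k; rewrite size_mkseq !nth_mkseq; [|lia|lia] => -> //.
  by congr (sigma _ _); rewrite /mkseq -map_take take_iota (minn_idPl _) //; lia.
Qed.

End CompatibleHistories.

Section ProverFollows.
Context (R : realType) (Pl V : finType) (G : game Pl V) (lam : V -> \bar rat) (i : Pl) (beta : int).
Context (pick : fam Pl V -> V -> seq V) (tailpick : fam Pl V -> nat -> V) (v0 : V) (a : R).
Hypothesis tailP : tail_pick_spec R G lam beta tailpick.
Hypothesis betaP : ((size_bound (game_size G + req_size lam))%:Z <= beta)%R.
Context (sigma : Pl -> strat V) (t0 : strat V).
Hypothesis sigmaP : forall j, j != i -> valid_strat G j (sigma j).
Hypothesis t0P : valid_strat G i t0.
Hypothesis rational : forall h, compatible G i sigma v0 h ->
  lam_consistent R G lam (outcome G (belast v0 (behead h)) (upd_profile sigma i t0) (last v0 (behead h))).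
Hypothesis bounded : forall eta, cplay G i sigma v0 eta -> (mp R G i eta < a%:E)%E.

Let g := gain G i a.
Let M := projT1 (cid2 (finite_bound g)).
Let M0 : 0 <= M. Proof. exact: (s2valP (cid2 (finite_bound g))). Qed.
Let gM u v : `|g u v| <= M. Proof. exact: (s2valP' (cid2 (finite_bound g))). Qed.
Let K := M * (#|V|.+1)%:R.

Let hmem := (seq V * V)%type.
Let hok (m : hmem) := compatible G i sigma v0 (rcons m.1 m.2).

Definition follow (m : hmem) : nat -> V := outcome G m.1 (upd_profile sigma i t0) m.2.

Lemma follow_play m : is_play G (follow m).
Proof. exact/outcome_play/upd_profile_valid. Qed.

Lemma follow0 m : follow m 0%N = m.2.
Proof. by []. Qed.

Lemma follow_consistent m : hok m -> lam_consistent R G lam (follow m).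
Proof.
move=> hm; have [t [e _]] := hm; have := rational hm.
rewrite e /=; have := e; rewrite lastI => /rcons_inj[e1 e2].
by rewrite -e1 -e2.
Qed.

Lemma follow_ok m n : hok m -> hok (m.1 ++ mkseq (follow m) n, follow m n).
Proof.
move=> hm; elim: n => [|n IH]; first by rewrite /hok /= cats0.
rewrite /hok /= mkseqS -rcons_cat; apply: compatible_rcons => //; first exact: follow_play.
by move=> oi; rewrite {1}/follow outcomeS /upd_profile -/(follow m) (negbTE oi) mkseqS rcons_cat.
Qed.

Lemma follow_deviate m n u : hok m -> owner G (follow m n) = i -> edge G (follow m n) u ->
  hok (m.1 ++ mkseq (follow m) n.+1, u).
Proof.
move=> hm oi eg; rewrite /hok /= mkseqS -rcons_cat; apply: compatible_rcons => //; first exact: follow_ok.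
by rewrite oi eqxx.
Qed.

Lemma follow_mp m : hok m -> (mp R G i (follow m) < a%:E)%E.
Proof.
move=> hm; rewrite -(mp_prepend R G i m.1); apply: bounded; apply: cplay_of_prefixes => n0.
exists (size m.1 + n0.+1)%N; first by lia.
have -> : mkseq (prepend m.1 (follow m)) (size m.1 + n0.+1) = rcons (m.1 ++ mkseq (follow m) n0) (follow m n0).
  rewrite rcons_cat -mkseqS; apply: (@eq_from_nth _ v0); rewrite size_mkseq ?size_cat ?size_mkseq // => k kl.
  rewrite nth_mkseq // nth_cat; case: ltnP => km; first exact: prepend_lt.
  by rewrite /prepend ltnNge km /= nth_mkseq //; lia.
exact: follow_ok.
Qed.

(* The vertex [follow m k] explains in [G] the deviation [d] to [u] of the reduced game. *)
Definition answer (m : hmem) (d : rstate Pl V) (u : V) (k : nat) : Prop :=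
  [/\ owner G (follow m k) = i, edge G (follow m k) u &
      if d is SPre h' _ then
        wsum g h' u <= wsum g (mkseq (follow m) k.+1) u /\
        forall k', (k' <= k)%N -> - K <= pays g (follow m) k'
      else True].

Definition safe_family (m : hmem) (f : fam Pl V) : Prop :=
  [/\ valid_fam R G lam beta f, head m.2 f.1.1.1 = m.2, ratr (f.1.2 i) <= a, csum g f.1.1.2 < 0 &
      forall d u, dev_ok G i f d u -> exists k, answer m d u k].

(** The cycle is listed from the successor of its entry [u] and ends in [u], while [h] ends in [u]
    too. So [h] is never empty, [h] followed by one lap is the stack plus the closing vertex, and
    the tail can start at the vertex after that. All vertices involved occur in [rho], whose
    requirements [x] meets. *)
Lemma lasso_fam_valid (rho : nat -> V) n st x t : is_play G rho ->
  lasso_stack (edge G) g rho n st -> rho n.+1 \in rcons st (rho n) ->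
  drop (index (rho n.+1) (rcons st (rho n))) (rcons st (rho n)) = rho n.+1 :: t ->
  (tuple_size x <= size_bound (game_size G + req_size lam))%N ->
  (forall k, (er2R R (lam (rho k)) <= (ratr (x (owner G (rho k))) : R)%:E)%E) ->
  (exists rho', [/\ is_play G rho', rho' 0%N = rho n.+2, occ_eq rho' (occ_from rho n.+2) &
        forall j, mp R G j rho' = (ratr (x j) : R)%:E]) ->
  valid_fam R G lam beta (rcons (take (index (rho n.+1) (rcons st (rho n))) (rcons st (rho n))) (rho n.+1),
    rcons t (rho n.+1), x, occ_from rho n.+2).
Proof.
move=> pl [un wp hd sm pf] us dr sx lx [rho' [pl' r0 occ mpx]].
set u := rho n.+1 in us dr *; set s := rcons st (rho n) in un us dr *; set idx := index u s in dr *.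
have ws : wpath (edge G) s u by rewrite wpath_rcons wp pl.
have /andP[wt wd] := cut_wpath us ws.
rewrite -/idx dr wpath_cons in wd.
have unt : uniq (u :: t) by rewrite -dr drop_uniq.
have sE : s = take idx s ++ u :: t by rewrite -dr cat_take_drop.
have socc v : v \in s -> exists k, v = rho k.
  move=> vs; have := vs; rewrite -index_mem /s size_rcons ltnS => /pf[k [_ e _]].
  by exists k; rewrite -e -/s; rewrite (nth_index _ vs).
split.
- have uq : uniq (rcons (take idx s) u) by apply: cut_uniq.
  case e : (take idx s) => [|z q]; first by exists u, [::].
  exists z, (rcons q u); split=> //; split; last by rewrite -e.
  by move: wt; rewrite -/idx e wpath_cons.
- case e : (rcons t u) => [|z q]; first by move: e; case: (t).
  exists z, q; split=> //; rewrite -e; split; last split.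
  + by rewrite -[rcons t u](rot1_cons u t) rot_cycle.
  + by rewrite rcons_uniq -[_ && _]/(uniq (u :: t)).
  + by rewrite last_rcons; move: wd; rewrite e => /andP[].
- by apply: le_trans betaP; rewrite lez_nat.
- by exists rho'; split=> //; split=> //; split=> //; rewrite last_rcons r0; apply: pl.
move=> n' r n0 [plr [mpr [occr _]]] k.
rewrite mp_suffix_prepend mpr.
suff [j ->] : exists j, prepend (rcons (take idx s) u ++ ncat n' (rcons t u)) r k = rho j by [].
rewrite /prepend; case: ltnP => kl.
  have := mem_nth (r 0%N) kl; rewrite mem_cat => /orP[|/mem_ncat].
    by rewrite mem_rcons inE => /orP[/eqP ->|/mem_take/socc]; [exists n.+1|].
  set v := nth _ _ _ => h; apply: socc; rewrite mem_rcons in h; rewrite sE mem_cat; by rewrite h orbT.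
set y := r _; have /occ_fromP[j <-] : y \in occ_from rho n.+2 by apply/occr; eexists.
by eexists.
Qed.

(** A prefix of the stack has its own date in [lasso_stack], where the coalition's play visits the
    same vertex with at least the same weight; the whole list corresponds to date [n.+1]. *)
Lemma lasso_pre_answer m n st h' u' (s := rcons st (follow m n)) :
  lasso_stack (edge G) g (follow m) n st ->
  (forall k, (k <= n)%N -> exists st, lasso_stack (edge G) g (follow m) k st) ->
  h' != [::] -> prefix h' (rcons s (follow m n.+1)) -> owner G (last u' h') = i -> edge G (last u' h') u' ->
  exists k, answer m (SPre Pl h' u') u' k.
Proof.
set rho := follow m => ls stk h0 pf.
have Klb k : (k <= n)%N -> - (M * #|V|%:R) <= pays g rho k.
  by move=> /stk[st' /lasso_stack_lb h]; apply: h.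
(* The extra [M] in [K] pays for the edge leading to date [n.+1]. *)
have K1 : K = M * #|V|%:R + M by rewrite /K -natr1 mulrDr mulr1.
have pre k : (k <= n)%N -> - K <= pays g rho k by move=> /Klb h; rewrite K1; have := M0; lra.
have [_ wp _ sm nths] := ls.
case: (lastP h') h0 pf => // h z _ pf; rewrite last_rcons => oz ez.
have [k kh] : exists k, size h = k by exists (size h).
move/prefixP: (pf) => [tl etl].
have ks : (k <= size s)%N.
  by have := congr1 size etl; rewrite size_cat !size_rcons; lia.
have he : h = take k (rcons s (rho n.+1)).
  by rewrite etl -[rcons h z]cats1 -catA take_size_cat.
have ze : z = nth (rho n) (rcons s (rho n.+1)) k.
  by rewrite etl nth_cat size_rcons kh ltnSn nth_rcons kh ltnn eqxx.
(* Either the deviation occurs at the closing vertex, or inside the stack. *)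
move: ks; rewrite leq_eqVlt => /orP[/eqP ks|ks].
  have zr : z = rho n.+1 by rewrite ze nth_rcons ks ltnn eqxx.
  have hs : h = s by rewrite he ks -cats1 take_size_cat.
  exists n.+1; rewrite /answer -/rho -zr; split=> //; split.
    rewrite hs zr [X in _ <= wsum g X _]mkseqS !wsum_rcons mkseqS wsum_rcons wsum_mkseq lerD2r lerD2r.
    exact: sm.
  move=> k'; rewrite leq_eqVlt => /orP[/eqP ->|]; last by rewrite ltnS => /pre.
  rewrite /pays big_ord_recr /= -/(pays g rho n); have := Klb n (leqnn n).
  by have := gM (rho n) (rho n.+1); rewrite ler_norml K1 => /andP[]; lra.
have ks' : (k <= size st)%N by move: ks; rewrite /s size_rcons ltnS.
have [j [jn ej wj]] := nths k ks'.
have zr : z = rho j by rewrite ze nth_rcons ks.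
have hs : h = take k st by rewrite he /s -!cats1 -catA takel_cat.
exists j; rewrite /answer -/rho -zr; split=> //; split.
  rewrite hs mkseqS !wsum_rcons zr wsum_mkseq lerD2r; exact: wj.
by move=> k' kj; apply: pre; apply: leq_trans jn.
Qed.

Lemma safe_family_ex m : hok m -> exists f, safe_family m f.
Proof.
move=> hm; set rho := follow m; have pl := follow_play m.
have [n [[st [ls us neg]] stk]] := lasso_stop_ex pl (follow_mp hm).
have [x [sx xa lx tl]] := small_payoff pl (follow_consistent hm) (follow_mp hm).
have [t dr] := cut_head us.
have vf := lasso_fam_valid pl ls us dr sx lx (tl n.+2).
set s := rcons st (follow m n) in us neg dr vf; set u := follow m n.+1 in us neg dr vf.
have sE : s = take (index u s) s ++ u :: t by rewrite -dr cat_take_drop.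
have hcE : rcons (take (index u s) s) u ++ rcons t u = rcons s u.
  by rewrite [in RHS]sE -cats1 -catA /= rcons_cat rcons_cons.
eexists; split; first exact: vf.
- rewrite /=; have -> : head m.2 (rcons (take (index u s) s) u) = head m.2 (rcons s u).
    by rewrite -hcE; case: (take _ _).
  have [_ _ hd _ _] := ls; rewrite /s; case: (st) hd => //=.
- exact: xa.
- by rewrite /= csum_rot1 -dr.
move=> d w; case: d => [?|?|c' w'|h' w'||] //=.
  move=> [_ [z /occ_fromP[k <-] [oz ez]] ->]; by exists (n.+2 + k)%N.
rewrite hcE => -[[h0 pf oz ez] ->]; exact: (lasso_pre_answer ls stk).
Qed.

Lemma safe_family_choice m : exists f, hok m -> safe_family m f.
Proof.
case: (pselect (hok m)) => [h|nh]; first by have [f hf] := safe_family_ex h; exists f.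
by exists ([::], [::], fun=> 0, finset.set0) => /nh.
Qed.

Definition fsel m : fam Pl V := projT1 (cid (safe_family_choice m)).

Lemma fselP m : hok m -> safe_family m (fsel m).
Proof. exact: (projT2 (cid (safe_family_choice m))). Qed.

Lemma answer_choice m d u : exists k, (exists k', answer m d u k') -> answer m d u k.
Proof.
case: (pselect (exists k', answer m d u k')) => [[k h]|nh]; first by exists k.
by exists 0%N => /nh.
Qed.

Definition ksel m d u : nat := projT1 (cid (answer_choice m d u)).

Lemma kselP m d u : hok m -> dev_ok G i (fsel m) d u -> answer m d u (ksel m d u).
Proof. by move=> /fselP[_ _ _ _ h] /h; apply: (projT2 (cid (answer_choice m d u))). Qed.

Definition hupd (m : hmem) (s : rstate Pl V) : hmem :=
  match s with
  | SPre _ u | SPost _ u => (m.1 ++ mkseq (follow m) (ksel m s u).+1, u)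
  | _ => m
  end.

Definition hmem_of (hs : seq (rstate Pl V)) : hmem := foldl hupd ([::], v0) hs.

Definition prover (hs : seq (rstate Pl V)) : rstate Pl V :=
  if pselect (rmove R G lam i beta (last (SBot Pl V) hs) (SFam (fsel (hmem_of hs))))
  then SFam (fsel (hmem_of hs)) else SBot Pl V.

Lemma prover_valid : valid_rstrat R G lam i beta Prover prover.
Proof.
move=> hs s _; rewrite /prover last_rcons; case: s => //= v _; by case: pselect.
Qed.

Lemma hmem_of_rcons hs s : hmem_of (rcons hs s) = hupd (hmem_of hs) s.
Proof. by rewrite /hmem_of -cats1 foldl_cat. Qed.

Lemma hupd_ok m d u : hok m -> dev_ok G i (fsel m) d u -> hok (hupd m d) /\ (hupd m d).2 = u.
Proof.
move=> hm dv; have [ow eg _] := kselP hm dv.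
case: d dv ow eg => [?|?|c w|h w||] //= dv ow eg.
- have e : u = w by case: dv.
  by rewrite e in ow eg *; split=> //; apply: follow_deviate.
- have e : u = w by case: dv.
  by rewrite e in ow eg *; split=> //; apply: follow_deviate.
Qed.

Section ProverPlay.
Context (tC : rstrat Pl V).
Hypothesis tCP : valid_rstrat R G lam i beta Challenger tC.

Let H := rout prover tC (SProv Pl v0).
Let mm n := hmem_of (mkseq H n.+1).

Let rp : red_play R G lam i beta v0 H.
Proof. by apply: rout_red_play => //; apply: prover_valid. Qed.

Let mmS n : mm n.+1 = hupd (mm n) (H n.+1).
Proof. by rewrite /mm mkseqS hmem_of_rcons. Qed.

Let inv n : hok (mm n) /\ match H n with
  | SProv v => v = (mm n).2
  | SFam f => f = fsel (mm n)
  | SPre _ u | SPost _ u => u = (mm n).2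
  | STop => True
  | SBot => False
  end.
Proof.
elim: n => [|n [hm hH]].
  by rewrite /mm /mkseq /= ; split=> //; apply: compatible1.
have := rp.2 n; have := mmS n; have hS := routS prover tC (SProv Pl v0) n.
rewrite -/H in hS; case e : (H n) hH => [v|f|c u|h w||] // hH.
- rewrite e /= in hS; rewrite hS => -> _; rewrite /prover mkseqS last_rcons -mkseqS -/(mm n) e.
  case: pselect => [h|nh] //=; case: nh; have [vf hd _ _ _] := fselP hm; split=> //.
  by rewrite hH.
- case: (H n.+1) => [v'|f'|c' u'|h' w'||] //= -> mv //.
  + have dv : dev_ok G i (fsel (mm n)) (SPost Pl c' u') u' by rewrite -hH; case: mv.
    by have [] := hupd_ok hm dv.
  + have dv : dev_ok G i (fsel (mm n)) (SPre Pl h' w') w' by rewrite -hH.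
    by have [] := hupd_ok hm dv.
- by case: (H n.+1) => [v'|f'|c' u'|h' w'||] //= -> ->.
- by case: (H n.+1) => [v'|f'|c' u'|h' w'||] //= -> ->.
- by case: (H n.+1) => [v'|f'|c' u'|h' w'||] //= ->.
Qed.

Section Rounds.
Context (vs : nat -> V) (fs : nat -> fam Pl V) (p : nat -> seq V).
Hypothesis rr : red_rounds R G lam i beta pick v0 H vs fs p.

Let ms s := mm (3 * s).
Let d s := H (3 * s).+2.
Let k_ s := ksel (ms s) (d s) (vs s.+1).
Let q s := (ms s).1.
Let eta := chain_lim v0 p.
Let sg s := dev_segment pick (size (p s)) (fs s) (d s).

Let rnd s : [/\ H (3 * s)%N = SProv Pl (vs s), H (3 * s).+1 = SFam (fs s),
  valid_fam R G lam beta (fs s), head (vs s) (fs s).1.1.1 = vs s & dev_ok G i (fs s) (d s) (vs s.+1)].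
Proof. by case: rr => h _ _ _; apply: h. Qed.

Let msok s : hok (ms s). Proof. by have [] := inv (3 * s)%N. Qed.

Let ms2 s : (ms s).2 = vs s.
Proof. by have [_ +] := inv (3 * s)%N; have [-> _ _ _ _] := rnd s. Qed.

Let mm1 s : mm (3 * s).+1 = ms s.
Proof. by rewrite mmS; have [_ -> _ _ _] := rnd s. Qed.

Let fsE s : fs s = fsel (ms s).
Proof. by have [_ +] := inv (3 * s).+1; rewrite mm1; have [_ -> _ _ _] := rnd s. Qed.

Let devok s : dev_ok G i (fsel (ms s)) (d s) (vs s.+1).
Proof. by rewrite -fsE; have [] := rnd s. Qed.

Let msS s : ms s.+1 = (q s ++ mkseq (follow (ms s)) (k_ s).+1, vs s.+1).
Proof.
have e3 : (3 * s.+1 = (3 * s).+3)%N by lia.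
have [e _ _ _ _] := rnd s.+1.
rewrite /ms e3 mmS -{1}e3 e /= mmS mm1 -/(d s); have := devok s; rewrite /k_.
by case: (d s) => [?|?|c w|h w||] //= [] // *; subst.
Qed.

Let ans s : answer (ms s) (d s) (vs s.+1) (k_ s).
Proof. exact: kselP. Qed.

Let p0 : p 0%N = [::] := rounds_p0 rr.
Let pS s : p s.+1 = p s ++ sg s := rounds_pS rr s.
Let sg0 s : sg s != [::] := rounds_seg_neq0 rr s.
Let sgh s e : head e (sg s) = vs s := rounds_seg_head rr s e.

Let post_bound s c u : d s = SPost Pl c u ->
  exists N n, [/\ (s <= N)%N, (N * N <= n)%N & pays g eta n <= M * 3 * N%:R].
Proof.
move=> ds; have [vf _ _ cn _] := fselP (msok s); rewrite -fsE in cn vf.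
have [/andP[h0 _] /andP[c0 _] _] := fam_sizes vf.
set N := (size (p s) + size (fs s).1.1.1)%N.
have sgE : sg s = (fs s).1.1.1 ++ ncat (N * N) (fs s).1.1.2 ++ pick (fs s) u by rewrite /sg ds.
pose pre := (p s ++ (fs s).1.1.1) ++ ncat (N * N) (fs s).1.1.2.
have sN : (s <= N)%N by rewrite (leq_trans (chain_size pS sg0 s)) // leq_addr.
exists N, (size pre); split=> //.
  by rewrite /pre size_cat size_ncat (leq_trans (leq_pmulr (N * N) c0)) // leq_addl.
have mk : mkseq eta (size pre) = pre.
  have pe : p s.+1 = pre ++ pick (fs s) u by rewrite pS sgE /pre -!catA.
  apply: (@eq_from_nth _ v0); rewrite size_mkseq // => j jk; rewrite nth_mkseq //.
  by rewrite /eta (@chain_lim_nth _ v0 p sg pS sg0 s.+1) pe ?nth_cat ?jk // size_cat ltn_addr.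
rewrite -wsum_mkseq mk.
have cne : (fs s).1.1.2 != [::] by rewrite -size_eq0 -lt0n.
have := wsum_repeat_le (p s ++ (fs s).1.1.1) (N * N) (eta (size pre)) M0 gM cne (ltW cn).
rewrite size_cat -/N -/pre.
have : M <= M * N%:R by rewrite ler_peMr // (ler_nat _ 1) /N; lia.
lra.
Qed.

Let q0 : q 0%N = [::].
Proof. by rewrite /q /ms /mm muln0 /mkseq /= /H. Qed.

Let qS s : q s.+1 = q s ++ mkseq (follow (ms s)) (k_ s).+1.
Proof. by rewrite {1}/q msS. Qed.

Let qs0 s : mkseq (follow (ms s)) (k_ s).+1 != [::]. Proof. by []. Qed.

(** The play of [G] by which Prover explains the reduced play: the expected plays of the coalition,
    each cut at the date answering Challenger's deviation. It obeys the coalition, so its mean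
    payoff is below [a]. *)
Let theta := chain_lim v0 q.

Let theta_head s : theta (size (q s)) = vs s.
Proof. by rewrite /theta (chain_lim_head v0 qS qs0) /= -ms2. Qed.

Let theta_cplay : cplay G i sigma v0 theta.
Proof.
apply: cplay_of_prefixes => n0; exists (size (q n0)).+1.
  by rewrite (leq_trans (chain_size qS qs0 n0)).
rewrite mkseqS theta_head (mkseq_chain_lim v0 qS qs0) -ms2; exact: msok.
Qed.

(** Low dates of [theta] may fall inside a round. The lower bound kept in [answer] carries them back
    to the start of the round at the price of [K]. *)
Let theta_low s j : (j <= k_ s)%N -> (if d s is SPre _ _ then true else false) ->
  wsum g (q s) (vs s) - K <= pays g theta (size (q s) + j).
Proof.
move=> jk ds; have [_ _] := ans s; case: (d s) ds => // h w _ [_ /(_ j jk) lb].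
rewrite paysD; have -> : pays g theta (size (q s)) = wsum g (q s) (vs s).
  by rewrite -wsum_mkseq theta_head (mkseq_chain_lim v0 qS qs0).
have -> : pays g (suffix_from theta (size (q s))) j = pays g (follow (ms s)) j.
  have e n : (n <= k_ s)%N -> suffix_from theta (size (q s)) n = follow (ms s) n.
    by move=> nk; rewrite /suffix_from /theta (chain_lim_segment v0 qS qs0) ?size_mkseq // nth_mkseq.
  by apply: eq_bigr => n _; rewrite !e //; have := ltn_ord n; lia.
lra.
Qed.

Lemma prover_rounds : (mp R G i eta <= a%:E)%E.
Proof.
pose isp s := if d s is SPost _ _ then true else false.
have [inf|fin] := pselect (forall s0, exists2 s, (s0 <= s)%N & isp s).
  apply: (@mp_le_sqrt _ _ _ _ _ _ _ (M * 3)) => N0; have [s ss] := inf N0; rewrite /isp.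
  case ds : (d s) => [?|?|c u|?||] // _; have [N [n [sN Nn hn]]] := post_bound ds.
  by exists N; split; [exact: leq_trans sN|exists n].
have [s0 hs0] : exists s0, forall s, (s0 <= s)%N -> if d s is SPre _ _ then true else false.
  move/existsNP: fin => [s0 h]; exists s0 => s ss; have := devok s.
  case ds : (d s) => [?|?|c u|?||] // _; exfalso; apply: h; exists s => //.
  by rewrite /isp ds.
(* The coalition's walk weighs at least as much as the reduced one in each pre-cycle round, so this
   difference does not increase. *)
pose D s := wsum g (p s) (vs s) - wsum g (q s) (vs s).
have Dle s : (s0 <= s)%N -> D s <= D s0.
  elim: s => [|s IH]; first by rewrite leqn0 => /eqP ->.
  rewrite leq_eqVlt => /orP[/eqP <- //|]; rewrite ltnS => ss.
  apply: le_trans (IH ss); rewrite /D pS qS !wsum_cat sgh.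
  have := hs0 s ss; have [_ _] := ans s; rewrite /sg; case: (d s) => // h w [hw _] _.
  rewrite [head _ (mkseq _ _)]follow0 ms2.
  lra.
apply: (@mp_le_bounded _ _ _ _ _ _ _ (D s0 + K)) => n0.
(* Sums of [theta] are nonpositive infinitely often; through [theta_low] and [D] the reduced play is
   then at most [D s0 + K] at the start of that round. *)
have [n nn pn] := mp_lt (bounded theta_cplay) (size (q (s0 + n0))).
have [s /andP[sn ns]] := chain_locate q0 qS qs0 n.
have ss : (s0 + n0 <= s)%N.
  rewrite leqNgt; apply/negP => ss; have := chain_mono qS ss.
  by move=> /(leq_trans ns)/leq_trans/(_ nn); rewrite ltnn.
exists (size (p s)); first by rewrite (leq_trans _ (chain_size pS sg0 s)) //; lia.
rewrite (chain_pays v0 pS sg0) sgh.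
have jk : (n - size (q s) <= k_ s)%N by move: ns; rewrite qS size_cat size_mkseq; lia.
have := theta_low jk (hs0 s _); rewrite subnKC // => /(_ _)/le_trans/(_ pn).
have := Dle s; rewrite /D => h1 h2.
have s0s : (s0 <= s)%N by lia.
have := h1 s0s; have := h2 s0s; lra.
Qed.

End Rounds.

Lemma prover_guarantee : (nuC R G i pick tailpick v0 H <= a%:E)%E.
Proof.
have [[n hn]|[s [v [f [e0 e1 vf e2 ->]]]]|[vs [fs [p [rr ->]]]]] := red_play_cases pick tailP rp.
- by have [_] := inv n; rewrite hn.
- have [hm] := inv (3 * s).+1; rewrite e1 => ->; rewrite lee_fin.
  by have [] := fselP hm.
- exact: prover_rounds rr.
Qed.

End ProverPlay.

Lemma val_infsup_le : (val_infsup R G lam i beta pick tailpick v0 <= a%:E)%E.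
Proof.
apply: (@le_trans _ _ (ereal_sup [set nuC R G i pick tailpick v0 (rout prover tC (SProv Pl v0))
    | tC in [set t | valid_rstrat R G lam i beta Challenger t]]%classic)).
  by apply: ereal_inf_lbound; exists prover => //; apply: prover_valid.
by apply: ge_ereal_sup => _ [tC vt <-]; apply: prover_guarantee.
Qed.

End ProverFollows.

(** * Comparison of the three values *)

Lemma ereal_between (R : realType) (x y : \bar R) : (x < y)%E ->
  exists a : R, (x < a%:E)%E /\ (a%:E < y)%E.
Proof.
case: x => [x||]; case: y => [y||] //.
- by rewrite lte_fin => xy; exists ((x + y) / 2); rewrite !lte_fin; split; lra.
- by move=> _; exists (x + 1); rewrite lte_fin ltry; split=> //; lra.
- by move=> _; exists (y - 1); rewrite lte_fin ltNyr; split=> //; lra.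
- by move=> _; exists 0; rewrite ltNyr ltry.
Qed.

Section Values.
Context (R : realType) (Pl V : finType) (G : game Pl V) (lam : V -> \bar rat) (i : Pl) (beta : int).
Context (pick : fam Pl V -> V -> seq V) (tailpick : fam Pl V -> nat -> V) (v0 : V).

Lemma val_supinf_le_infsup :
  (val_supinf R G lam i beta pick tailpick v0 <= val_infsup R G lam i beta pick tailpick v0)%E.
Proof.
apply: ge_ereal_sup => _ [tC vC <-]; apply: le_ereal_inf_tmp => _ [tP vP <-].
apply: (@le_trans _ _ (nuC R G i pick tailpick v0 (rout tP tC (SProv Pl v0)))).
  by apply: ereal_inf_lbound; exists tP.
by apply: ereal_sup_ubound; exists tC.
Qed.

Hypothesis ow : owner G v0 = i.
Hypothesis tailP : tail_pick_spec R G lam beta tailpick.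

(** At a threshold strictly between the two values, either outcome of the first cycle game
    contradicts one of the bounds. *)
Lemma nego_le_val_supinf : shortest_pick_spec R G lam i beta pick ->
  (nego R G lam v0 <= val_supinf R G lam i beta pick tailpick v0)%E.
Proof.
move=> pickP; rewrite leNgt; apply/negP => /ereal_between[a [lo up]].
case: (pselect (prover_wins G lam i beta a [::] v0)) => [win|lose].
  by have := nego_le ow tailP win; rewrite leNgt up.
suff : (a%:E <= val_supinf R G lam i beta pick tailpick v0)%E by rewrite leNgt lo.
apply: (@le_trans _ _ (ereal_inf [set nuC R G i pick tailpick v0
     (rout tP (challenger G lam i beta a v0) (SProv Pl v0))
   | tP in [set t | valid_rstrat R G lam i beta Prover t]]%classic)).
  by apply: le_ereal_inf_tmp => _ [tP vP <-]; apply: challenger_guarantee.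
by apply: ereal_sup_ubound; exists (challenger G lam i beta a v0) => //; apply: challenger_valid.
Qed.

Lemma val_infsup_le_nego : ((size_bound (game_size G + req_size lam))%:Z <= beta)%R ->
  (val_infsup R G lam i beta pick tailpick v0 <= nego R G lam v0)%E.
Proof.
move=> hb; rewrite /nego ow; apply: le_ereal_inf_tmp => _ [sigma [sigmaP [t0 [t0P rat]]] <-].
rewrite leNgt; apply/negP => /ereal_between[a [lo up]].
suff : (val_infsup R G lam i beta pick tailpick v0 <= a%:E)%E by rewrite leNgt up.
apply: (val_infsup_le pick tailP hb sigmaP t0P rat) => eta /cplay_outcome[t vt <-].
by apply: le_lt_trans lo; apply: ereal_sup_ubound; exists t.
Qed.

End Values.

Theorem theorem8 :
  exists P : {poly int},
  forall (R : realType) (Pl V : finType) (G : game Pl V)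
         (lam : V -> \bar rat) (i : Pl) (v0 : V),
  owner G v0 = i ->
  forall beta : int,
  P.[((game_size G + req_size lam)%N)%:Z] <= beta ->
  forall (pick : fam Pl V -> V -> seq V) (tailpick : fam Pl V -> nat -> V),
  shortest_pick_spec R G lam i beta pick ->
  tail_pick_spec R G lam beta tailpick ->
  nego R G lam v0 = val_infsup R G lam i beta pick tailpick v0 /\
  nego R G lam v0 = val_supinf R G lam i beta pick tailpick v0.
Proof.
(* The polynomial form of [size_bound]. *)
exists ('X * (8%:P * 'X^2 + 3%:P * 'X + 4%:P)) => R Pl V G lam i v0 ow beta hb pick tailpick pickP tailP.
have {}hb : (size_bound (game_size G + req_size lam))%:Z <= beta.
  apply: le_trans hb; rewrite /size_bound; move: (game_size G + req_size lam)%N => n.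
  by rewrite !(hornerM, hornerD, hornerC, hornerX, hornerXn); nia.
have h1 := nego_le_val_supinf ow tailP pickP.
have h2 := val_supinf_le_infsup R G lam i beta pick tailpick v0.
have h3 := val_infsup_le_nego pick ow tailP hb.
split; apply/eqP; rewrite eq_le.
  by rewrite h3 (le_trans h1 h2).
by rewrite h1 (le_trans h2 h3).
Qed.
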